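(* Let $X\in\mathbb R^p$, $Y\in\mathbb R^q$ be random vectors, $Z=(X^\top,Y^\top)^\top$, and let $Z_i=(X_i^\top,Y_i^\top)^\top$, $i=1,\dots,n$, be i.i.d. copies of $Z$. Let $w_p$ on $\mathbb R^p$ and $w_q$ on $\mathbb R^q$ each satisfy assumption (A), with characteristic functions $C_{w_p},C_{w_q}$. Define $$U_{n,1}=\tfrac{1}{n(n-1)}\sum_{i\ne j}C_{w_p}(X_i-X_j)C_{w_q}(Y_i-Y_j),\quad U_{n,2}=\tfrac{1}{n(n-1)}\sum_{i\ne j}C_{w_p}(X_i-X_j),\quad U_{n,3}=\tfrac{1}{n(n-1)}\sum_{i\ne j}C_{w_q}(Y_i-Y_j),$$ $$U_{n,4}=\tfrac{1}{n(n-1)(n-2)}\sum_{i,j,k\ \text{pairwise distinct}}C_{w_p}(X_i-X_j)C_{w_q}(Y_i-Y_k),$$ and $\Delta^{(\mathcal I)}_{n,w}=U_{n,1}+U_{n,2}U_{n,3}-2U_{n,4}$. Let $S_1=\mathbb E[C_{w_p}(X-X_1)C_{w_q}(Y-Y_1)]$, $S_2=\mathbb E[C_{w_p}(X-X_1)]$, $S_3=\mathbb E[C_{w_q}(Y-Y_1)]$, $S_4=\mathbb E[C_{w_p}(X-X_1)C_{w_q}(Y-Y_2)]$, where $Z_1,Z_2$ are independent copies of $Z$. Then, as $n\to\infty$: (i) if $\Delta^{(\mathcal I)}_{w,Z}>0$, then $\sqrt n\,(\Delta^{(\mathcal I)}_{n,w}-\Delta^{(\mathcal I)}_{w,Z})\to\mathcal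 N(0,\sigma^{2(\mathcal I)}_w)$ in distribution, where $$\sigma^{2(\mathcal I)}_w=\sum_{i,j=1}^4 m_im_j\,h_i'h_j'\,\zeta_1(i,j),$$ with $m_1=m_2=m_3=2$, $m_4=3$, $(h_1',h_2',h_3',h_4')=(1,S_3,S_2,-2)$ (the gradient of $h(u)=u_1+u_2u_3-2u_4$ at $u=(S_1,\dots,S_4)$), and $\zeta_1(i,j)=\mathrm{Cov}\big(\psi^{\mathcal I,i}_1(Z),\psi^{\mathcal I,j}_1(Z)\big)$, where $\psi^{\mathcal I,i}_1(z)=\mathbb E[\psi^{\mathcal I,i}(z,Z_1,\dots,Z_{m_i-1})]$ with $Z_1,\dots$ i.i.d. copies of $Z$, and the kernels are $\psi^{\mathcal I,1}(z,z_1)=C_{w_p}(x-x_1)C_{w_q}(y-y_1)$, $\psi^{\mathcal I,2}(z,z_1)=C_{w_p}(x-x_1)$, $\psi^{\mathcal I,3}(z,z_1)=C_{w_q}(y-y_1)$, and $\psi^{\mathcal I,4}(z,z_1,z_2)=\tfrac16\{C_{w_p}(x-x_1)C_{w_q}(y-y_2)+C_{w_p}(x-x_2)C_{w_q}(y-y_1)+C_{w_p}(x-x_1)C_{w_q}(y_1-y_2)+C_{w_p}(x_1-x_2)C_{w_q}(y-y_1)+C_{w_p}(x-x_2)C_{w_q}(y_1-y_2)+C_{w_p}(x_1-x_2)C_{w_q}(y-y_2)\}$ (writing $z=(x^\top,y^\top)^\top$ etc.); (ii) if $\Delta^{(\mathcal I)}_{w,Z}=0$, then $\sqrt n\,\Delta^{(\mathcal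 I)}_{n,w}\to0$ in probability.
   Context: Assumption (A) for a weight $w$ on $\mathbb R^d$: $w$ is a probability density symmetric about the origin, $w(t)=w(-t)$, $\int w=1$; its characteristic function is real-valued. The independence distance is $\Delta^{(\mathcal I)}_{w,Z}=\int_{\mathbb R^{p+q}}|\varphi_{X,Y}(t_1,t_2)-\varphi_X(t_1)\varphi_Y(t_2)|^2w_p(t_1)w_q(t_2)\,dt_1dt_2$, where $\varphi_{X,Y}$ is the joint characteristic function and $\varphi_X,\varphi_Y$ the marginal ones; it equals $S_1+S_2S_3-2S_4$ and vanishes iff $X$ and $Y$ are independent. No moment assumptions are imposed. *)

(* Defs.v *)
From HB Require Import structures.
From mathcomp Require Import all_boot all_order all_algebra.
From mathcomp Require Import all_classical all_reals all_analysis.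

Set Implicit Arguments.
Unset Strict Implicit.
Unset Printing Implicit Defensive.

Import Order.TTheory GRing.Theory Num.Def Num.Theory.
Import numFieldTopology.Exports.

Local Open Scope classical_set_scope.
Local Open Scope ring_scope.

Section Defs.
Context {R : realType}.

Definition dotv n (s t : n.-tuple R) : R := \sum_(i < n) tnth s i * tnth t i.
Definition subv n (s t : n.-tuple R) : n.-tuple R :=
  [tuple tnth s i - tnth t i | i < n].
Definition oppv n (s : n.-tuple R) : n.-tuple R := [tuple - tnth s i | i < n].

(* Lebesgue measure on R^n, built as the iterated product of the Lebesgue
   measure on R (same construction as the library's product_measure1):
   leb_tuple 0 = Dirac mass at the unique point of R^0,
   leb_tuple (m+1) A = \int dx  leb_tuple m {t | (x :: t) \in A}. *)
Fixpoint leb_tuple (n : nat) : set (n.-tuple R) -> \bar R :=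
  match n return set (n.-tuple R) -> \bar R with
  | 0 => fun A => \d_([tuple] : 0.-tuple R) A
  | m.+1 => fun A =>
      (\int[@lebesgue_measure R]_x @leb_tuple m [set t | A (cons_tuple x t)])%E
  end.

Definition assumptionA n (w : n.-tuple R -> R) : Prop :=
  [/\ measurable_fun setT w,
      (forall t, 0 <= w t),
      (\int[@leb_tuple n]_t (w t)%:E = 1)%E &
      (forall t, w (oppv t) = w t)].

(* Characteristic function C_w(t) = \int e^{i t.s} w(s) ds of the weight w.
   Under (A) its imaginary part \int sin(t.s) w(s) ds vanishes (w symmetric),
   so C_w is the real-valued function below. *)
Definition charw n (w : n.-tuple R -> R) (t : n.-tuple R) : R :=
  fine (\int[@leb_tuple n]_s (cos (dotv t s) * w s)%:E)%E.

Section prob.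
Context {d} {T : measurableType d} (P : probability T R).

Definition mutually_independent {d'} {T' : measurableType d'}
    (Z : nat -> T -> T') : Prop :=
  forall (s : seq nat) (A : nat -> set T'),
    uniq s -> (forall i, measurable (A i)) ->
    P (\bigcap_(i in [set` s]) (Z i @^-1` A i)) =
    (\prod_(i <- s) P (Z i @^-1` A i))%E.

Definition identically_distributed {d'} {T' : measurableType d'}
    (Z : nat -> T -> T') : Prop :=
  forall i (A : set T'), measurable A -> P (Z i @^-1` A) = P (Z 0%N @^-1` A).

Definition iid {d'} {T' : measurableType d'} (Z : nat -> T -> T') : Prop :=
  mutually_independent Z /\ identically_distributed Z.

(* real expectation (all functions used below are bounded) *)
Definition Ereal (f : T -> R) : R := fine ('E_P[f])%E.

Variables (p q : nat).

Definition cf_re n (V : T -> n.-tuple R) (t : n.-tuple R) : R :=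
  Ereal (fun om => cos (dotv t (V om))).
Definition cf_im n (V : T -> n.-tuple R) (t : n.-tuple R) : R :=
  Ereal (fun om => sin (dotv t (V om))).
Definition jcf_re (X : T -> p.-tuple R) (Y : T -> q.-tuple R) t1 t2 : R :=
  Ereal (fun om => cos (dotv t1 (X om) + dotv t2 (Y om))).
Definition jcf_im (X : T -> p.-tuple R) (Y : T -> q.-tuple R) t1 t2 : R :=
  Ereal (fun om => sin (dotv t1 (X om) + dotv t2 (Y om))).

(* |phi_{X,Y}(t1,t2) - phi_X(t1) phi_Y(t2)|^2 written with real and
   imaginary parts *)
Definition cf_gap2 (X : T -> p.-tuple R) (Y : T -> q.-tuple R) t1 t2 : R :=
  (jcf_re X Y t1 t2 - (cf_re X t1 * cf_re Y t2 - cf_im X t1 * cf_im Y t2)) ^+ 2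
  + (jcf_im X Y t1 t2 - (cf_re X t1 * cf_im Y t2 + cf_im X t1 * cf_re Y t2)) ^+ 2.

Definition indep_dist (wp : p.-tuple R -> R) (wq : q.-tuple R -> R)
    (X : T -> p.-tuple R) (Y : T -> q.-tuple R) : \bar R :=
  (\int[@leb_tuple p]_t1 \int[@leb_tuple q]_t2
      (cf_gap2 X Y t1 t2 * wp t1 * wq t2)%:E)%E.

Variables (wp : p.-tuple R -> R) (wq : q.-tuple R -> R).
Local Notation Cp := (charw wp).
Local Notation Cq := (charw wq).

Section ustat.
Variables (X : nat -> T -> p.-tuple R) (Y : nat -> T -> q.-tuple R).

Definition U1 (n : nat) (om : T) : R :=
  (n * (n - 1))%:R^-1 * \sum_(i < n) \sum_(j < n | i != j)
     Cp (subv (X i om) (X j om)) * Cq (subv (Y i om) (Y j om)).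
Definition U2 (n : nat) (om : T) : R :=
  (n * (n - 1))%:R^-1 * \sum_(i < n) \sum_(j < n | i != j)
     Cp (subv (X i om) (X j om)).
Definition U3 (n : nat) (om : T) : R :=
  (n * (n - 1))%:R^-1 * \sum_(i < n) \sum_(j < n | i != j)
     Cq (subv (Y i om) (Y j om)).
Definition U4 (n : nat) (om : T) : R :=
  (n * (n - 1) * (n - 2))%:R^-1 *
  \sum_(i < n) \sum_(j < n) \sum_(k < n | [&& i != j, i != k & j != k])
     Cp (subv (X i om) (X j om)) * Cq (subv (Y i om) (Y k om)).

Definition Delta_n (n : nat) (om : T) : R :=
  U1 n om + U2 n om * U3 n om - 2 * U4 n om.

Definition S1 : R := Ereal (fun om =>
  Cp (subv (X 0%N om) (X 1%N om)) * Cq (subv (Y 0%N om) (Y 1%N om))).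
Definition S2 : R := Ereal (fun om => Cp (subv (X 0%N om) (X 1%N om))).
Definition S3 : R := Ereal (fun om => Cq (subv (Y 0%N om) (Y 1%N om))).
Definition S4 : R := Ereal (fun om =>
  Cp (subv (X 0%N om) (X 1%N om)) * Cq (subv (Y 0%N om) (Y 2%N om))).

(* kernels psi^{I,k}; index k = 0,1,2,3 stands for the paper's 1,2,3,4 *)
Definition psi (k : nat) (x : p.-tuple R) (y : q.-tuple R)
    (x1 : p.-tuple R) (y1 : q.-tuple R) (x2 : p.-tuple R) (y2 : q.-tuple R) : R :=
  match k with
  | 0 => Cp (subv x x1) * Cq (subv y y1)
  | 1 => Cp (subv x x1)
  | 2 => Cq (subv y y1)
  | _ => 6^-1 * (Cp (subv x x1) * Cq (subv y y2) + Cp (subv x x2) * Cq (subv y y1)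
               + Cp (subv x x1) * Cq (subv y1 y2) + Cp (subv x1 x2) * Cq (subv y y1)
               + Cp (subv x x2) * Cq (subv y1 y2) + Cp (subv x1 x2) * Cq (subv y y2))
  end.

(* psi^{I,k}_1(z) = E[psi^{I,k}(z, Z_1, ..., Z_{m_k - 1})] (for k < 3 the
   kernel does not depend on its last argument) *)
Definition psi1 (k : nat) (x : p.-tuple R) (y : q.-tuple R) : R :=
  Ereal (fun om => psi k x y (X 1%N om) (Y 1%N om) (X 2%N om) (Y 2%N om)).

Definition zeta1 (k l : nat) : R :=
  fine (covariance P (fun om => psi1 k (X 0%N om) (Y 0%N om))
                     (fun om => psi1 l (X 0%N om) (Y 0%N om))).

Definition mdeg (k : nat) : R := if k == 3%N then 3 else 2.
Definition hgrad (k : nat) : R :=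
  match k with 0 => 1 | 1 => S3 | 2 => S2 | _ => -2 end.

Definition sigma2 : R :=
  \sum_(k < 4) \sum_(l < 4) mdeg k * mdeg l * hgrad k * hgrad l * zeta1 k l.

End ustat.
End prob.

Definition normal_law (s2 : R) : set R -> \bar R :=
  if s2 == 0 then \d_(0 : R) else normal_prob 0 (Num.sqrt s2).

Definition cvg_dist_normal {d} {T : measurableType d} (P : probability T R)
    (W : nat -> T -> R) (s2 : R) : Prop :=
  forall f : R -> R, continuous f -> (exists M, forall x, `|f x| <= M) ->
    ('E_P[f \o W n])%E @[n --> \oo] --> (\int[normal_law s2]_x (f x)%:E)%E.

Definition cvg_prob0 {d} {T : measurableType d} (P : probability T R)
    (W : nat -> T -> R) : Prop :=
  forall eps : R, 0 < eps ->
    P [set om | eps < `|W n om|] @[n --> \oo] --> 0%E.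

End Defs.

(* Main.v *)
(* By Fubini the weights turn into probability laws nup, nuq of frequencies, and
   Delta becomes gap2, the mean of |phi_{X,Y} - phi_X phi_Y|^2 under nup x nuq.
   The U-statistic Delta_n differs by O(1/n) from its V-statistic analogue, which
   is the same functional evaluated at the empirical characteristic functions.
   That functional is a polynomial in six bounded empirical means, so a pointwise
   second-order expansion, integrated over the frequencies, gives
     E |Delta_n - Delta - (1/n) sum_i g(Z_i)| = O(1/n)
   with an explicit bounded centred influence function g.  Then
   - comparing g with the first-order projections psi_1 of the kernels shows that
     E g(Z)^2 is sigma2, and a Lindeberg replacement argument gives the central
     limit theorem, also when sigma2 = 0;
   - if Delta = 0 then g = 0 identically, so sqrt n * Delta_n = O(1/sqrt n) in L^1. *)

Require Import Defs.
From HB Require Import structures.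
From mathcomp Require Import all_boot all_order all_algebra.
From mathcomp Require Import all_classical all_reals all_analysis.
From mathcomp Require Import measurable_realfun.
From mathcomp Require Import ring lra.

Import Order.TTheory GRing.Theory Num.Def Num.Theory.
Import numFieldTopology.Exports numFieldNormedType.Exports.
Local Open Scope classical_set_scope.
Local Open Scope ring_scope.

Set Implicit Arguments.
Unset Strict Implicit.
Unset Printing Implicit Defensive.

(** * Bounded measurable functions *)

(** No moment of the data is assumed, but the kernels and the frequency features are all bounded by
    1. Hence the class [bm]: inside it, integrability and Fubini are automatic under any
    probability, and the unbounded moments that remain are those of Gaussian laws. Independent
    copies are modelled by integrating several times over the same probability space.

    The expansion is made at a fixed frequency because the functional is there a polynomial in
    finitely many means. Its remainder is controlled by the squared deviations of six means of
    bounded variables, each of variance at most [4 / n], so the degenerate parts of the U-statistics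
    never need to be analysed. The price is the passage from U- to V-statistics, a matter of
    counting coincident indices.

    Replacement suits the limit because Gaussian laws indexed by their variance, the Dirac mass at 0
    included, are closed under convolution; the same induction then runs for every variance
    [v >= 0]. Its test functions must have a cubic Taylor remainder, for the replacement, and be
    Lipschitz, to absorb an error known only in mean. *)

Definition bm {d} {T : measurableType d} {R : realType} (f : T -> R) : Prop :=
  measurable_fun setT f /\ exists M, forall x, `|f x| <= M.

Section bounded_measurable.
Context {d} {T : measurableType d} {R : realType}.
Implicit Types f g : T -> R.

Lemma bm_cst (c : R) : bm (fun _ : T => c).
Proof. by split; [exact: measurable_cst | exists `|c|]. Qed.

Lemma bmD f g : bm f -> bm g -> bm (fun x => f x + g x).
Proof.
move=> [mf [M fM]] [mg [N gN]]; split; first exact: measurable_funD.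
by exists (M + N) => x; rewrite (le_trans (ler_normD _ _))// lerD.
Qed.

Lemma bmN f : bm f -> bm (fun x => - f x).
Proof.
move=> [mf [M fM]]; split; first exact: measurableT_comp.
by exists M => x; rewrite normrN.
Qed.

Lemma bmB f g : bm f -> bm g -> bm (fun x => f x - g x).
Proof. by move=> bf bg; apply: bmD => //; exact: bmN. Qed.

Lemma bmM f g : bm f -> bm g -> bm (fun x => f x * g x).
Proof.
move=> [mf [M fM]] [mg [N gN]]; split; first exact: measurable_funM.
by exists (M * N) => x; rewrite normrM ler_pM.
Qed.

Lemma bmZ (c : R) f : bm f -> bm (fun x => c * f x).
Proof. by move=> bf; apply: bmM => //; exact: bm_cst. Qed.

Lemma bmX f n : bm f -> bm (fun x => f x ^+ n).
Proof.
move=> bf; elim: n => [|n ih]; first exact: bm_cst.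
by under eq_fun do rewrite exprS; exact: bmM.
Qed.

Lemma bm_norm f : bm f -> bm (fun x => `|f x|).
Proof.
move=> [mf [M fM]]; split; first exact: measurableT_comp.
by exists M => x; rewrite normr_id.
Qed.

Lemma bm_sum I (r : seq I) (P : pred I) (F : I -> T -> R) :
  (forall i, bm (F i)) -> bm (fun x => \sum_(i <- r | P i) F i x).
Proof.
move=> bF; elim: r => [|i r ih].
  by under eq_fun do rewrite big_nil; exact: bm_cst.
under eq_fun do rewrite big_cons.
by case: (P i) => //; exact: bmD.
Qed.

Lemma bm_comp d' (T' : measurableType d') (h : T' -> T) f :
  measurable_fun setT h -> bm f -> bm (fun x => f (h x)).
Proof.
move=> mh [mf [M fM]]; split; first exact: measurableT_comp.
by exists M => x; exact: fM.
Qed.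

Lemma bm_cos f : measurable_fun setT f -> bm (fun x => cos (f x)).
Proof.
move=> mf; split; last by exists 1 => x; rewrite ler_norml cos_geN1 cos_le1.
apply: measurableT_comp => //.
by apply: continuous_measurable_fun => x; exact: continuous_cos.
Qed.

Lemma bm_sin f : measurable_fun setT f -> bm (fun x => sin (f x)).
Proof.
move=> mf; split; last by exists 1 => x; rewrite ler_norml sin_geN1 sin_le1.
apply: measurableT_comp => //.
by apply: continuous_measurable_fun => x; exact: continuous_sin.
Qed.

End bounded_measurable.

Section expectation_bm.
Context {d} {T : measurableType d} {R : realType} (mu : probability T R).
Implicit Types f g : T -> R.

Lemma bm_integrable f : bm f -> mu.-integrable setT (EFin \o f).
Proof.
move=> [mf [M fM]]; apply: measurable_bounded_integrable => //.
- by rewrite (le_lt_trans (probability_le1 _ _))// ltry.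
- exists M; split; first exact: num_real.
  by move=> x Mx y _ /=; exact: le_trans (fM y) (ltW Mx).
Qed.

Lemma EFin_Rintegral f : bm f ->
  (\int[mu]_x (f x)%:E)%E = (\int[mu]_x f x)%:E.
Proof.
by move=> bf; rewrite /Rintegral fineK//; exact/integrable_fin_num/bm_integrable.
Qed.

Lemma bm_RintegralD f g : bm f -> bm g ->
  \int[mu]_x (f x + g x) = \int[mu]_x f x + \int[mu]_x g x.
Proof. by move=> bf bg; rewrite RintegralD//; exact: bm_integrable. Qed.

Lemma bm_RintegralB f g : bm f -> bm g ->
  \int[mu]_x (f x - g x) = \int[mu]_x f x - \int[mu]_x g x.
Proof. by move=> bf bg; rewrite RintegralB//; exact: bm_integrable. Qed.

Lemma bm_RintegralZl (c : R) f : bm f ->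
  \int[mu]_x (c * f x) = c * \int[mu]_x f x.
Proof. by move=> bf; rewrite RintegralZl//; exact: bm_integrable. Qed.

Lemma bm_RintegralZr (c : R) f : bm f ->
  \int[mu]_x (f x * c) = (\int[mu]_x f x) * c.
Proof. by move=> bf; rewrite RintegralZr//; exact: bm_integrable. Qed.

Lemma Rintegral_probcst (c : R) : \int[mu]_x c = c.
Proof. by rewrite Rintegral_cst//= [X in fine X]probability_setT mulr1. Qed.

Lemma bm_le_Rintegral f g : bm f -> bm g -> (forall x, f x <= g x) ->
  \int[mu]_x f x <= \int[mu]_x g x.
Proof. by move=> bf bg fg; apply: le_Rintegral => //; exact: bm_integrable. Qed.

Lemma bm_Rintegral_sum I (r : seq I) (P : pred I) (F : I -> T -> R) :
  (forall i, bm (F i)) ->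
  \int[mu]_x (\sum_(i <- r | P i) F i x) = \sum_(i <- r | P i) \int[mu]_x F i x.
Proof.
move=> bF; elim: r => [|i r ih].
  under eq_Rintegral do rewrite big_nil.
  by rewrite Rintegral_probcst big_nil.
under eq_Rintegral do rewrite big_cons.
rewrite big_cons; case: (P i) => //.
by rewrite bm_RintegralD ?ih//; exact: bm_sum.
Qed.

Lemma bm_norm_Rintegral_le f : bm f ->
  `|\int[mu]_x f x| <= \int[mu]_x `|f x|.
Proof. by move=> bf; apply: le_normr_Rintegral => //; exact: bm_integrable. Qed.

Lemma norm_Rintegral_le f (M : R) : bm f -> (forall x, `|f x| <= M) ->
  `|\int[mu]_x f x| <= M.
Proof.
move=> bf fM; rewrite (le_trans (bm_norm_Rintegral_le bf))//.
rewrite -[leRHS]Rintegral_probcst; apply: bm_le_Rintegral => //.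
- exact: bm_norm.
- exact: bm_cst.
Qed.

(** The variance of [f], expanded, is nonnegative. *)
Lemma bm_sqr_Rintegral_le f : bm f ->
  (\int[mu]_x f x) ^+ 2 <= \int[mu]_x f x ^+ 2.
Proof.
move=> bf; set e := \int[mu]_x f x.
have : 0 <= \int[mu]_x (f x - e) ^+ 2.
  by apply: Rintegral_ge0 => x _; exact: sqr_ge0.
rewrite (_ : \int[mu]_x _ = \int[mu]_x (f x ^+ 2 - (2 * e * f x - e ^+ 2))).
  have b1 := bmZ (2 * e) bf; have b2 := bm_cst (T := T) (e ^+ 2).
  rewrite bm_RintegralB//; [|exact: bmX|exact: bmB].
  by rewrite bm_RintegralB// bm_RintegralZl// Rintegral_probcst -/e; nra.
by apply: eq_Rintegral => x _; ring.
Qed.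

End expectation_bm.

Section fubini_bm.
Context {d1 d2} {T1 : measurableType d1} {T2 : measurableType d2} {R : realType}.
Context (m1 : probability T1 R) (m2 : probability T2 R).

Lemma bm_pair1 (F : T1 * T2 -> R) y : bm F -> bm (fun x => F (x, y)).
Proof. by apply: (bm_comp (h := fun x => (x, y))); exact: measurable_fun_pair. Qed.

Lemma bm_pair2 (F : T1 * T2 -> R) x : bm F -> bm (fun y => F (x, y)).
Proof. by apply: (bm_comp (h := fun y => (x, y))); exact: measurable_fun_pair. Qed.

Lemma bm_swap (F : T1 * T2 -> R) : bm F -> bm (fun z : T2 * T1 => F (z.2, z.1)).
Proof.
apply: (bm_comp (h := fun z : T2 * T1 => (z.2, z.1))).
exact: measurable_fun_pair.
Qed.

Lemma bm_Rintegral2 (F : T1 * T2 -> R) : bm F ->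
  bm (fun x => \int[m2]_y F (x, y)).
Proof.
move=> bF; split; last first.
  have [_ [M FM]] := bF; exists M => x; apply: norm_Rintegral_le => //.
  exact: bm_pair2.
apply/measurable_EFinP; rewrite (_ : _ \o _ = fubini_F m2 (EFin \o F)).
  by apply: (measurable_fubini_F (m1 := m1)); exact: bm_integrable.
by apply/funext => x; rewrite /= -EFin_Rintegral//; exact: bm_pair2.
Qed.

Lemma bm_Rintegral_prod (F : T1 * T2 -> R) : bm F ->
  \int[(m1 \x m2)%E]_z F z = \int[m1]_x \int[m2]_y F (x, y).
Proof.
move=> bF; rewrite {1}/Rintegral -integral12_prod_meas1/=; last exact: bm_integrable.
congr fine; apply: eq_integral => x _.
by rewrite /fubini_F/= EFin_Rintegral//; exact: bm_pair2.
Qed.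

End fubini_bm.

Section fubini_bm2.
Context {d1 d2} {T1 : measurableType d1} {T2 : measurableType d2} {R : realType}.
Context (m1 : probability T1 R) (m2 : probability T2 R).

Lemma bm_Fubini (F : T1 * T2 -> R) : bm F ->
  \int[m1]_x \int[m2]_y F (x, y) = \int[m2]_y \int[m1]_x F (x, y).
Proof.
move=> bF; apply: EFin_inj.
rewrite -!EFin_Rintegral//; [|exact: (bm_Rintegral2 m2 m1 (bm_swap bF))|exact: bm_Rintegral2].
transitivity (\int[m1]_x \int[m2]_y (F (x, y))%:E)%E.
  by apply: eq_integral => x _; rewrite EFin_Rintegral//; exact: bm_pair2.
rewrite (Fubini (f := EFin \o F)); last exact: bm_integrable.
by apply: eq_integral => y _; rewrite /= EFin_Rintegral//; exact: bm_pair1.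
Qed.

End fubini_bm2.

Lemma bm_Rintegral_distribution {d d'} {T : measurableType d} {T' : measurableType d'}
    {R : realType} (P : probability T R) (X : {mfun T >-> T'}) (f : T' -> R) :
  bm f -> \int[distribution P X]_x f x = \int[P]_x f (X x).
Proof.
move=> bf; rewrite /Rintegral; congr fine.
rewrite (integral_distribution (f := EFin \o f))//.
- by apply/measurable_EFinP; case: bf.
- by apply: (bm_integrable P (f := f \o X)); exact: bm_comp.
Qed.

(** * Weights as probability densities *)

Section density_integral.
Context {d} {T : measurableType d} {R : realType}.
Variables (mu nu : {measure set T -> \bar R}) (w : T -> R).
Hypotheses (mw : measurable_fun setT w) (w0 : forall x, 0 <= w x).
Hypothesis nuE : forall A, measurable A -> nu A = (\int[mu]_(x in A) (w x)%:E)%E.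
Local Open Scope ereal_scope.

Import HBNNSimple.

Let nnsfun_density (g : {nnsfun T >-> R}) :
  \int[nu]_x (g x)%:E = \int[mu]_x ((g x)%:E * (w x)%:E).
Proof.
rewrite integralT_nnsfun sintegralE.
transitivity (\int[mu]_x \sum_(k \in range g)
    (k%:E * ((\1_(g @^-1` [set k]) x)%:E * (w x)%:E))).
  rewrite ge0_integral_fsum//; last 2 first.
  - move=> k; apply: measurable_funeM; apply/measurable_EFinP.
    exact: measurable_funM.
  (* Nonnegativity is asked of every real [k]; the preimage of a negative one under [g] is empty. *)
  - move=> k x _; have [k0|k0] := leP 0%R k.
      by rewrite -!EFinM lee_fin !mulr_ge0.
    by rewrite preimage_nnfun0//= indicE in_set0 mul0e mule0.
  apply: eq_fsbigr => k _; have [k0|k0] := leP 0%R k; last first.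
    rewrite preimage_nnfun0// measure0 mule0 integral0_eq// => x _.
    by rewrite indicE in_set0 mul0e mule0.
  rewrite ge0_integralZl_EFin//=; last 2 first.
  - by move=> x _; rewrite -EFinM lee_fin mulr_ge0.
  - by apply/measurable_EFinP; exact: measurable_funM.
  congr (_ * _); rewrite nuE// integral_mkcond; apply: eq_integral => x _.
  rewrite patchE indicE; case: ifPn => _; first by rewrite mul1e.
  by rewrite mul0e.
apply: eq_integral => x _.
rewrite fimfunE -fsumEFin// ge0_mule_fsuml; last first.
  by move=> k; exact: nnfun_muleindic_ge0.
by apply: eq_fsbigr => k _; rewrite EFinM muleA.
Qed.

(** Both sides agree on simple functions and pass to increasing limits by monotone convergence. This
    serves the weights as well as the Gaussian density. *)
Lemma ge0_integral_density (f : T -> \bar R) :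
  measurable_fun setT f -> (forall x, 0 <= f x) ->
  \int[nu]_x f x = \int[mu]_x (f x * (w x)%:E).
Proof.
move=> mf f0; pose g := nnsfun_approx measurableT mf.
transitivity (limn (fun n => \int[nu]_x (g n x)%:E)).
  rewrite -monotone_convergence//=.
  - by apply: eq_integral => x _; apply/esym/cvg_lim => //; exact: cvg_nnsfun_approx.
  - by move=> n; exact/measurable_EFinP/measurable_funP.
  - by move=> n x _; rewrite lee_fin.
  - by move=> x _ m n mn; rewrite lee_fin; exact/lefP/nd_nnsfun_approx.
transitivity (limn (fun n => \int[mu]_x ((g n x)%:E * (w x)%:E))).
  by congr (limn _); apply/funext => n; exact: nnsfun_density.
rewrite -monotone_convergence//=.
- apply: eq_integral => x _; apply/cvg_lim => //.
  by apply: cvgeZr => //; exact: cvg_nnsfun_approx.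
- by move=> n; apply/measurable_EFinP/measurable_funM.
- by move=> n x _; rewrite -EFinM lee_fin mulr_ge0.
- move=> x _ m n mn; rewrite -!EFinM lee_fin ler_wpM2r//.
  exact/lefP/nd_nnsfun_approx.
Qed.

End density_integral.

Section density.
Context {d} {T : measurableType d} {R : realType}.
Variables (mu : {measure set T -> \bar R}) (w : T -> R).
Hypotheses (mw : measurable_fun setT w) (w0 : forall x, 0 <= w x).
Hypothesis w1 : (\int[mu]_x (w x)%:E = 1)%E.

Lemma density_probability : exists nu : probability T R,
  forall A, measurable A -> nu A = (\int[mu]_(x in A) (w x)%:E)%E.
Proof.
pose f A := (\int[mu]_(x in A) (w x)%:E)%E.
have f0 : f set0 = 0%E by rewrite /f integral_set0.
have f_ge0 A : (0 <= f A)%E.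
  by apply: integral_ge0 => x _; rewrite lee_fin.
have fs : semi_sigma_additive f.
  move=> A mA tA mUA; rewrite /f ge0_integral_bigcup//.
  - by apply: is_cvg_ereal_nneg_natsum_cond => n _ _; exact: f_ge0.
  - by apply/measurable_EFinP/measurable_funTS.
  - by move=> x _; rewrite lee_fin.
pose m1 := isMeasure.Build _ _ _ f f0 f_ge0 fs.
pose fm : {measure set T -> \bar R} := HB.pack f m1.
pose m2 := @Measure_isProbability.Build _ _ R fm w1.
pose fp : probability T R := HB.pack f m1 m2.
by exists fp.
Qed.

End density.

(** * Lebesgue measure on tuples and the laws of the weights *)

Section leb_tuple.
Context {R : realType}.

(** [leb_tuple] is a mere set function given by recursion. It is recognized as the image under
    [cons_tuple] of the product of Lebesgue measure with the measure found one dimension below.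
    Sigma-finiteness is carried along because the next product needs it, reflection invariance
    because it turns the symmetry of a weight into that of its law. *)
Lemma leb_tuple_measure n : exists mu : {sigma_finite_measure set (n.-tuple R) -> \bar R},
  (@leb_tuple R n = mu :> (set (n.-tuple R) -> \bar R)) /\
  (forall A, measurable A -> mu (@oppv R n @^-1` A) = mu A).
Proof.
elim: n => [|n [mu [muE muN]]].
  exists (dirac ([tuple] : 0.-tuple R)); split=> // A mA.
  by congr (\d_[tuple] _); apply/seteqP; split => t; rewrite /preimage/= (tuple0 (oppv t)) (tuple0 t).
pose c (z : measurableTypeR R * n.-tuple R) : n.+1.-tuple R := cons_tuple z.1 z.2.
have mc : measurable_fun setT c.
  exact: (measurable_cons measurable_fst measurable_snd).
pose u (t : n.+1.-tuple R) : measurableTypeR R * n.-tuple R :=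
  (thead t, [tuple of behead t]).
have mu_ : measurable_fun setT u.
  by apply: measurable_fun_pair; [exact: measurable_tnth | exact: measurable_behead].
have uc : cancel c u.
  by move=> [x t]; congr (_, _); apply: val_inj.
pose pm := [the {measure set _ -> \bar R} of (@lebesgue_measure R \x mu)%E].
pose pf (A : set (n.+1.-tuple R)) := pm (c @^-1` A).
have leE : @leb_tuple R n.+1 = pf.
  apply/funext => A; rewrite /= /pf /pm /product_measure1.
  apply: eq_integral => x _; rewrite muE/=; congr (mu _).
  by apply/seteqP; split => t; rewrite /xsection/= inE.
have fin_sigma : sigma_finite setT pf.
  have /sigma_finiteP[F [FT ndF Foo]] := sigma_finiteT (@lebesgue_measure R).
  have /sigma_finiteP[G [GT ndG Goo]] := sigma_finiteT mu.
  exists (fun k => u @^-1` (F k `*` G k)).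
    rewrite -preimage_bigcup -[LHS](preimage_setT u); congr (_ @^-1` _).
    apply/esym/seteqP; split => // -[x t] _.
    have [k _ Fk] : (\bigcup_k F k) x by rewrite -FT.
    have [l _ Gl] : (\bigcup_k G k) t by rewrite -GT.
    exists (maxn k l) => //; split=> /=.
    - by move: x Fk; exact/subsetPset/ndF/leq_maxl.
    - by move: t Gl; exact/subsetPset/ndG/leq_maxr.
  move=> k; have [mF Fk] := Foo k; have [mG Gk] := Goo k; split.
    by rewrite -[X in measurable X]setTI; apply: mu_ => //; exact: measurableX.
  rewrite /pf (_ : c @^-1` _ = F k `*` G k).
    by rewrite [ltLHS]product_measure1E// lte_mul_pinfty// ge0_fin_numE.
  rewrite -comp_preimage (_ : u \o c = id) ?preimage_id//.
  exact/funext/uc.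
have pf0 : pf set0 = 0%E by rewrite /pf preimage_set0 measure0.
have pf_ge0 A : (0 <= pf A)%E by exact: measure_ge0.
have pf_sa : semi_sigma_additive pf.
  move=> F mF tF mUF; rewrite /pf preimage_bigcup.
  apply: measure_semi_sigma_additive.
  - by move=> k; rewrite -[X in measurable X]setTI; exact: mc.
  - apply/trivIsetP => /= i j _ _ ij; rewrite -preimage_setI.
    by move/trivIsetP : tF => /(_ _ _ _ _ ij) ->//; rewrite preimage_set0.
  - by rewrite -preimage_bigcup -[X in measurable X]setTI; exact: mc.
pose m1 := isMeasure.Build _ _ _ _ pf0 pf_ge0 pf_sa.
pose nu : {measure set (n.+1.-tuple R) -> \bar R} := HB.pack pf m1.
pose m2 := @Measure_isSigmaFinite.Build _ _ _ nu fin_sigma.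
pose nus : {sigma_finite_measure set (n.+1.-tuple R) -> \bar R} :=
  HB.pack pf m1 m2.
exists nus; split=> // A mA.
have mcA : measurable (c @^-1` A) by rewrite -[X in measurable X]setTI; exact: mc.
pose h (x : measurableTypeR R) := mu (xsection (c @^-1` A) x).
have mh : measurable_fun setT h by exact: measurable_fun_xsection.
have moppR : measurable_fun setT (-%R : measurableTypeR R -> measurableTypeR R).
  exact: oppr_measurable.
(* The tail is reflected by the induction hypothesis, then the head by the symmetry of Lebesgue
   measure on the line. *)
transitivity (\int[@lebesgue_measure R]_x h (- x)%R)%E.
  apply: eq_integral => x _; rewrite /h -[RHS]muN; last exact: measurable_xsection.
  congr (mu _); apply/seteqP; split => t; rewrite /xsection/= !inE /=;
    congr A; apply: eq_from_tnth => i; rewrite tnth_mktuple /c/=;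
    by case: (unliftP ord0 i) => [j|] ->; rewrite ?tnthS ?tnth0 ?tnth_mktuple.
transitivity (\int[@lebesgue_measure R]_x h x)%E; last by [].
have -> : (\int[lebesgue_measure]_x h (- x)%R)%E =
    (\int[pushforward (@lebesgue_measure R) (-%R : measurableTypeR R -> measurableTypeR R)]_x h x)%E.
  by rewrite ge0_integral_pushforward.
by apply: eq_measure_integral => B mB _; exact: lebesgue_measureN.
Qed.

Lemma measurable_dotv n (s : n.-tuple R) : measurable_fun setT (dotv s).
Proof.
apply: measurable_sum => i; apply: measurable_funM => //; exact: measurable_tnth.
Qed.

Lemma measurable_oppv n : measurable_fun setT (@oppv R n).
Proof.
apply/measurable_fun_tnthP => i.
rewrite (_ : _ \o _ = fun s => - tnth s i).
  by apply: measurableT_comp => //; exact: measurable_tnth.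
by apply/funext => s /=; rewrite tnth_mktuple.
Qed.

Lemma dotvN n (s t : n.-tuple R) : dotv s (oppv t) = - dotv s t.
Proof.
by rewrite /dotv -sumrN; apply: eq_bigr => i _; rewrite tnth_mktuple mulrN.
Qed.

Lemma dotvC n (s t : n.-tuple R) : dotv s t = dotv t s.
Proof. by apply: eq_bigr => i _; rewrite mulrC. Qed.

Lemma dotvBl n (s t u : n.-tuple R) : dotv (subv s t) u = dotv s u - dotv t u.
Proof.
by rewrite /dotv -sumrB; apply: eq_bigr => i _; rewrite tnth_mktuple mulrBl.
Qed.

(** The three properties are what the sequel uses of a weight: the first rewrites [indep_dist], the
    second cancels sine integrals, the third makes [charw] a mean of cosines. *)
Lemma assumptionA_probability n (w : n.-tuple R -> R) : assumptionA w ->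
  exists nu : probability (n.-tuple R) R,
  [/\ forall f : n.-tuple R -> \bar R, measurable_fun setT f ->
        (forall x, 0 <= f x)%E ->
        (\int[@leb_tuple R n]_x (f x * (w x)%:E) = \int[nu]_x f x)%E,
      forall f : n.-tuple R -> R, bm f ->
        \int[nu]_x f (oppv x) = \int[nu]_x f x &
      forall t, charw w t = \int[nu]_s cos (dotv t s)].
Proof.
have [mu [muE muN]] := leb_tuple_measure n.
rewrite /assumptionA /charw muE => -[mw w0 w1 wN].
have [nu nuE] := density_probability mw w0 w1.
have nuI := ge0_integral_density mw w0 nuE.
exists nu; split.
- by move=> f mf f0; rewrite nuI.
- move=> f bf.
  have nuN A : measurable A -> nu (@oppv R n @^-1` A) = nu A.
    move=> mA; rewrite !nuE//; last first.
      by rewrite -[X in measurable X]setTI; exact: measurable_oppv.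
    rewrite integral_mkcond [RHS]integral_mkcond.
    transitivity (\int[pushforward mu (@oppv R n)]_x ((EFin \o w) \_ A) x)%E.
      rewrite ge0_integral_pushforward//=.
      - apply: eq_integral => x _; rewrite /= !patchE /= wN.
        by congr (if _ then _ else _); apply/idP/idP; rewrite !inE.
      - exact: measurable_oppv.
      - by apply/measurable_restrict => //; apply/measurable_funTS/measurable_EFinP.
      - by move=> x _; rewrite patchE; case: ifP => // _; rewrite lee_fin.
    apply: eq_measure_integral; first exact: measurable_oppv.
    by move=> mo B mB _; exact: muN.
  pose o : {mfun n.-tuple R >-> n.-tuple R} :=
    HB.pack (@oppv R n) (isMeasurableFun.Build _ _ _ _ _ (@measurable_oppv n)).
  rewrite -(bm_Rintegral_distribution nu o)//.
  by congr fine; apply: eq_measure_integral => B mB _; exact: nuN.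
- move=> t; congr fine.
  have bc := bm_cos (measurable_dotv t); have [mc _] := bc.
  (* The cosine changes sign while the density formula is for nonnegative functions; the nonnegative
     [w] factors out of the positive and the negative part. *)
  rewrite [LHS]integralE [RHS]integralE; congr (_ - _)%E.
  + rewrite nuI//; last first.
      by apply: measurable_funepos; exact/measurable_EFinP.
    apply: eq_integral => s _; rewrite !funeposE muleC maxe_pMr ?lee_fin//.
    by rewrite mule0 muleC.
  + rewrite nuI//; last first.
      by apply: measurable_funeneg; exact/measurable_EFinP.
    apply: eq_integral => s _; rewrite !funenegE muleC maxe_pMr ?lee_fin//.
    by rewrite mule0 muleN muleC.
Qed.

End leb_tuple.

(** * Centred Gaussian laws *)

Section taylor.
Context {R : realType}.
Implicit Types f g : R -> R.

(** The bound on [g] is asked on a symmetric interval around 0, so that the inequality can be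
    iterated whatever the sign of [h]. *)
Lemma mvt_bound f g (h B : R) : (forall t : R, is_derive t 1 f (g t)) ->
  (forall t, `|t| <= `|h| -> `|g t| <= B) -> `|f h - f 0| <= B * `|h|.
Proof.
move=> fg gB.
have cf a b : {within `[a, b], continuous f}.
  apply: continuous_subspaceT => x.
  by apply: differentiable_continuous; apply/derivable1_diffP; case: (fg x).
have [h0|h0] := leP 0 h.
  have [c ch ->] := MVT_segment h0 (fun x _ => fg x) (cf _ _).
  rewrite subr0 normrM ler_wpM2r// gB//.
  by move: ch; rewrite in_itv/= => /andP[c0 ch]; rewrite !ger0_norm.
have [c ch e] := MVT_segment (ltW h0) (fun x _ => fg x) (cf _ _).
rewrite distrC e sub0r normrM normrN ler_wpM2r// gB//.
move: ch; rewrite in_itv/= => /andP[c0 ch].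
by rewrite ler0_norm// ltr0_norm// lerN2.
Qed.

(** Three uses of the mean value inequality, from the second derivative down to the function. Each
    one multiplies the bound by |h|, hence the constant [C] in place of [C / 6]. *)
Lemma taylor3 f0 f1 f2 f3 (x h C : R) :
  (forall t : R, is_derive t 1 f0 (f1 t)) ->
  (forall t : R, is_derive t 1 f1 (f2 t)) ->
  (forall t : R, is_derive t 1 f2 (f3 t)) ->
  (forall t, `|t| <= `|h| -> `|f3 (x + t)| <= C) ->
  `|f0 (x + h) - f0 x - h * f1 x - h ^+ 2 / 2 * f2 x| <= C * `|h| ^+ 3.
Proof.
move=> d0 d1 d2 f3C.
have dsh (g g' : R -> R) : (forall t : R, is_derive t 1 g (g' t)) ->
    forall t : R, is_derive t 1 (fun t => g (x + t)) (g' (x + t)).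
  move=> dg t; have dgt := dg (x + t).
  rewrite (_ : (fun t => _) = g \o (cst x + id))//.
  have dl : is_derive t (1 : R) (cst x + id) (0 + 1) by apply: is_deriveD.
  have := @is_derive1_comp _ g (cst x + id) t _ _ dgt dl.
  by rewrite add0r mulr1.
have dlin (a t : R) : is_derive t 1 (fun t : R => t * a) a.
  rewrite (_ : (fun t => _) = a \*: (id : R -> R)).
    by apply: is_derive_eq; rewrite /GRing.scale/= mulr1.
  by apply/funext => s /=; rewrite /GRing.scale/= mulrC.
have dsq (a t : R) : is_derive t 1 (fun t : R => t ^+ 2 / 2 * a) (t * a).
  rewrite (_ : (fun t => _) = (a / 2) \*: ((id : R -> R) ^+ 2)).
    by apply: is_derive_eq; rewrite /GRing.scale/= expr1; field.
  by apply/funext => s /=; rewrite /GRing.scale/= !fctE; field.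
have C0 : 0 <= C by rewrite (le_trans _ (f3C 0 _))// normr0.
have b2 t : `|t| <= `|h| -> `|f2 (x + t) - f2 x| <= C * `|h|.
  move=> th; have := @mvt_bound _ _ t C (dsh _ _ d2).
  rewrite addr0 => /(_ _)/le_trans; apply.
    by move=> s st; apply: f3C; exact: le_trans th.
  by rewrite ler_wpM2l.
have b1 t : `|t| <= `|h| -> `|f1 (x + t) - f1 x - t * f2 x| <= C * `|h| ^+ 2.
  move=> th.
  have d (t' : R) : is_derive t' 1 (fun t => f1 (x + t) - t * f2 x) (f2 (x + t') - f2 x).
    by apply: (is_deriveB (dsh _ _ d1 t') (dlin (f2 x) t')).
  have := @mvt_bound _ _ t (C * `|h|) d.
  rewrite addr0 mul0r subr0 addrAC => /(_ _)/le_trans; apply.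
    by move=> s st; apply: b2; exact: le_trans th.
  by rewrite expr2 mulrA ler_wpM2l// mulr_ge0.
have d (t' : R) : is_derive t' 1 (fun t => f0 (x + t) - t * f1 x - t ^+ 2 / 2 * f2 x)
    (f1 (x + t') - f1 x - t' * f2 x).
  exact: (is_deriveB (is_deriveB (dsh _ _ d0 t') (dlin (f1 x) t')) (dsq (f2 x) t')).
have := @mvt_bound _ _ h (C * `|h| ^+ 2) d b1.
rewrite addr0 expr0n/= !mul0r !subr0.
rewrite (_ : C * _ * _ = C * `|h| ^+ 3); last by ring.
by apply: le_trans; rewrite le_eqVlt; apply/orP; left; apply/eqP; congr (`|_|); ring.
Qed.
End taylor.

(** * Densities and moments of Gaussian laws *)

Section gauss_law.
Context {R : realType}.
Local Notation leb := (@lebesgue_measure R).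
Local Notation RT := (measurableTypeR R).
Implicit Types v : R.

(* [normal_prob] lives on [measurableTypeR R], whose display differs from that
   of [R]; the identity transports it. *)
Lemma measurable_idR : measurable_fun setT (id : RT -> R).
Proof. by move=> _ A mA; rewrite setTI. Qed.

Definition idRm : {mfun RT >-> R} :=
  HB.pack (id : RT -> R) (isMeasurableFun.Build _ _ _ _ _ measurable_idR).

(** The index is the variance, so that convolution adds indices; the Dirac mass at 0 is the neutral
    element. *)
Definition gauss_law (v : R) : probability R R :=
  if v == 0 then [the probability R R of dirac (0 : R)]
  else [the probability R R of distribution (normal_prob 0 (Num.sqrt v)) idRm].

Lemma normal_lawE v : normal_law v = gauss_law v :> (set R -> \bar R).
Proof. by rewrite /normal_law /gauss_law; case: ifP. Qed.

Lemma gauss_law0 : gauss_law 0 = dirac (0 : R) :> (set R -> \bar R).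
Proof. by rewrite /gauss_law eqxx. Qed.

Lemma ge0_integral_gauss v (f : R -> \bar R) : v != 0 ->
  measurable_fun setT f -> (forall x, 0 <= f x)%E ->
  (\int[gauss_law v]_x f x =
   \int[leb]_x (f x * (normal_pdf 0 (Num.sqrt v) x)%:E))%E.
Proof.
move=> v0 mf f0; rewrite /gauss_law (negbTE v0).
rewrite ge0_integral_distribution//.
rewrite (@ge0_integral_density _ _ _ leb _ (normal_pdf 0 (Num.sqrt v)))//.
- exact: measurable_normal_pdf.
- by move=> x; exact: normal_pdf_ge0.
Qed.

(** The translated measure has the right value on half-open intervals, and these determine Lebesgue
    measure. *)
Lemma ge0_integral_translation (f : R -> \bar R) (a : R) :
  measurable_fun setT f -> (forall x, 0 <= f x)%E ->
  (\int[leb]_x f (x + a)%R = \int[leb]_x f x)%E.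
Proof.
move=> mf f0.
pose sh (x : RT) : RT := x + a.
have msh : measurable_fun setT sh by apply: measurable_funD.
transitivity (\int[pushforward leb sh]_x f x)%E.
  by rewrite ge0_integral_pushforward.
apply: eq_measure_integral => A mA _; symmetry.
apply: lebesgue_measure_unique mA => _ [[x y] _ <-].
rewrite [RHS](_ : _ = leb `](x - a), (y - a)]%classic).
  rewrite !lebesgue_measure_itv/= !lte_fin ltrD2r.
  by case: ifP => // _; rewrite -!EFinB; congr (_%:E); ring.
congr (leb _); apply/seteqP.
by split => t; rewrite /preimage/sh/= !in_itv/= ltrBlDr lerBrDr.
Qed.

(** Completing the square: an exponential tilt shifts the mean by [s ^+ 2 * h]. *)
Lemma normal_pdf_tilt (s h y : R) : s != 0 ->
  expR (h * y) * normal_pdf 0 s y =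
  expR (s ^+ 2 * h ^+ 2 / 2) * normal_pdf (s ^+ 2 * h) s y.
Proof.
move=> s0; rewrite !normal_pdfE// !(mulrCA (expR _)) /normal_fun -!expRD.
by congr (_ * expR _); field.
Qed.

Lemma gauss_mgf v (h : R) : 0 < v ->
  (\int[gauss_law v]_y (expR (h * y))%:E = (expR (v * h ^+ 2 / 2))%:E)%E.
Proof.
move=> v0; have s0 : Num.sqrt v != 0 by rewrite gt_eqF// sqrtr_gt0.
have sv : Num.sqrt v ^+ 2 = v by rewrite sqr_sqrtr// ltW.
rewrite ge0_integral_gauss ?gt_eqF//.
- under eq_integral do rewrite -EFinM (normal_pdf_tilt _ _ s0) sv EFinM.
  rewrite ge0_integralZl_EFin//= ?integral_normal_pdf ?mule1//.
  + by move=> x _; rewrite lee_fin normal_pdf_ge0.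
  + by apply/measurable_EFinP; exact: measurable_normal_pdf.
- apply/measurable_EFinP; apply: measurableT_comp => //.
Qed.

(** The integrand is one of [expR (c * y)] and [expR (- c * y)], both integrable by the moment
    generating function. It dominates all the moments used below. *)
Lemma gauss_expabs_integrable v (c : R) : 0 < v ->
  (gauss_law v).-integrable setT (EFin \o (fun y => expR (c * `|y|))).
Proof.
move=> v0.
have ie h : (gauss_law v).-integrable setT (EFin \o (fun y => expR (h * y))).
  apply/integrableP; split.
    by apply/measurable_EFinP; apply: measurableT_comp.
  under eq_integral do rewrite /= ger0_norm ?expR_ge0//.
  by rewrite gauss_mgf// ltry.
apply: (le_integrable _ _ _ (integrableD _ (ie c) (ie (- c)))) => //.
  apply/measurable_EFinP; apply: measurableT_comp => //.
  by apply: measurable_funM => //; exact: measurableT_comp.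
move=> y _; rewrite /= lee_fin [leLHS]ger0_norm ?expR_ge0// [leRHS]ger0_norm ?addr_ge0 ?expR_ge0//.
have [y0|y0] := leP 0 y; first by rewrite (ger0_norm y0) lerDl expR_ge0.
by rewrite (ltr0_norm y0) mulrN mulNr lerDr expR_ge0.
Qed.

Lemma gauss_dom_integrable v (g : R -> R) (K c : R) : 0 < v ->
  measurable_fun setT g -> (forall y, `|g y| <= K * expR (c * `|y|)) ->
  (gauss_law v).-integrable setT (EFin \o g).
Proof.
move=> v0 mg gK.
apply: (le_integrable _ _ _ (integrableZl _ K (gauss_expabs_integrable c v0))) => //.
  exact/measurable_EFinP.
by move=> y _; rewrite /= lee_fin (le_trans (gK y))// ler_norm.
Qed.

Lemma small_eq0 (a K : R) : (forall h, 0 < h <= 1 -> `|a| <= K * h) -> a = 0.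
Proof.
move=> aK; apply/eqP; rewrite -normr_le0; apply/ler_addgt0Pr => e e0; rewrite add0r.
have K0 : 0 <= K by have := aK 1; rewrite ltr01 lexx mulr1 => /(_ isT); apply: le_trans.
pose h := Num.min 1 (e / (K + 1)).
have h0 : 0 < h <= 1.
  by rewrite /h lt_min ltr01 divr_gt0 ?ltr_wpDl//= ge_min lexx.
apply: (le_trans (aK h h0)); apply: (@le_trans _ _ (K * (e / (K + 1)))).
  by rewrite ler_wpM2l// /h ge_min lexx orbT.
rewrite mulrCA ger_pMr// ler_pdivrMr ?ltr_wpDl// mul1r lerDl//.
Qed.

Lemma expR_taylor2 (u : R) : `|expR u - 1 - u - u ^+ 2 / 2| <= expR `|u| * `|u| ^+ 3.
Proof.
have e t : is_derive t (1 : R) expR (expR t) by exact: is_derive_expR.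
have := @taylor3 _ expR expR expR expR 0 u (expR `|u|) e e e.
rewrite add0r expR0 !mulr1; apply=> t tu.
by rewrite add0r ger0_norm ?expR_ge0// ler_expR (le_trans (ler_norm _)).
Qed.

Lemma normX_le_expR (y : R) k : `|y| ^+ k <= expR (k%:R * `|y|).
Proof.
rewrite expRM_natl lerXn2r// ?nnegrE ?expR_ge0//.
by rewrite (le_trans _ (expR_ge1Dx _))// lerDr.
Qed.

Lemma gauss_monomial_integrable v k : 0 < v ->
  (gauss_law v).-integrable setT (EFin \o (fun y => y ^+ k)).
Proof.
move=> v0; apply: (@gauss_dom_integrable _ _ 1 k%:R) => //.
by move=> y; rewrite mul1r normrX; exact: normX_le_expR.
Qed.

Lemma gauss_absmonomial_integrable v k : 0 < v ->
  (gauss_law v).-integrable setT (EFin \o (fun y => `|y| ^+ k)).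
Proof.
move=> v0; apply: (@gauss_dom_integrable _ _ 1 k%:R) => //.
  by apply: measurable_funX; exact: normr_measurable.
by move=> y; rewrite mul1r normrX normr_id; exact: normX_le_expR.
Qed.

(* Both moments are read off the expansion of the moment generating function at 0. *)
Lemma gauss_mean_var v : 0 < v ->
  \int[gauss_law v]_y y = 0 /\ \int[gauss_law v]_y (y ^+ 2) = v.
Proof.
move=> v0; set m := \int[gauss_law v]_y y; set s2 := \int[gauss_law v]_y (y ^+ 2).
(* [K1] bounds the integrated Taylor remainder of [expR (h * y)]; 4 = 3 + 1, since |y|^3 is at most
   exp(3|y|) and the exponential factor of the remainder at most exp(|y|). [K2] bounds what
   [expR (v * h ^+ 2 / 2)] leaves beyond its first two terms when |h| is at most 1. *)
pose K1 := \int[gauss_law v]_y expR (4 * `|y|).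
pose K2 := v ^+ 2 / 8 + expR (v / 2) * (v / 2) ^+ 3.
have iy : (gauss_law v).-integrable setT (EFin \o (fun y : R => y)).
  exact: (gauss_monomial_integrable 1 v0).
have iy2 := gauss_monomial_integrable 2 v0.
have icst (c : R) : (gauss_law v).-integrable setT (EFin \o (fun y => c)).
  exact/bm_integrable/bm_cst.
have K10 : 0 <= K1 by apply: Rintegral_ge0 => y _; exact: expR_ge0.
have K20 : 0 <= K2 by rewrite addr_ge0 ?mulr_ge0 ?expR_ge0 ?exprn_ge0 ?divr_ge0 ?ltW.
have key h : `|h| <= 1 -> `|h * m + h ^+ 2 * ((s2 - v) / 2)| <= (K1 + K2) * `|h| ^+ 3.
  move=> h1.
  have hn : `|h| ^+ 2 = h ^+ 2 by rewrite real_normK ?num_real.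
  have ieh : (gauss_law v).-integrable setT (EFin \o (fun y => expR (h * y))).
    apply: (@gauss_dom_integrable _ _ 1 1) => //; first exact: measurableT_comp.
    move=> y; rewrite !mul1r ger0_norm ?expR_ge0// ler_expR.
    by rewrite (le_trans (ler_norm _))// normrM ler_piMl.
  have i1 : (gauss_law v).-integrable setT (EFin \o (fun y => h * y)) by exact: (integrableZl _ h iy).
  have i2 : (gauss_law v).-integrable setT (EFin \o (fun y => h ^+ 2 / 2 * y ^+ 2)).
    exact: (integrableZl _ (h ^+ 2 / 2) iy2).
  have i3 : (gauss_law v).-integrable setT (EFin \o (fun y => expR (h * y) - 1)).
    exact: (integrableB _ ieh (icst 1)).
  have i4 : (gauss_law v).-integrable setT (EFin \o (fun y => expR (h * y) - 1 - h * y)).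
    exact: (integrableB _ i3 i1).
  have i5 : (gauss_law v).-integrable setT
      (EFin \o (fun y => expR (h * y) - 1 - h * y - h ^+ 2 / 2 * y ^+ 2)).
    exact: (integrableB _ i4 i2).
  have e1 : \int[gauss_law v]_y (expR (h * y) - 1 - h * y - h ^+ 2 / 2 * y ^+ 2) =
      expR (v * h ^+ 2 / 2) - 1 - h * m - h ^+ 2 / 2 * s2.
    rewrite !RintegralB// !RintegralZl// Rintegral_probcst.
    by rewrite {1}/Rintegral gauss_mgf.
  have b1 : `|expR (v * h ^+ 2 / 2) - 1 - h * m - h ^+ 2 / 2 * s2| <= K1 * `|h| ^+ 3.
    rewrite -e1 (le_trans (le_normr_Rintegral _ _))//.
    have ie4 := gauss_expabs_integrable 4 v0.
    rewrite -RintegralZr//; apply: le_Rintegral => //.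
    - exact: (integrable_norm i5).
    - exact: (integrableZr _ (`|h| ^+ 3) ie4).
    move=> y _; rewrite (_ : h ^+ 2 / 2 * y ^+ 2 = (h * y) ^+ 2 / 2); last by field.
    rewrite (le_trans (expR_taylor2 _))// normrM exprMn mulrCA mulrC ler_wpM2r ?exprn_ge0//.
    rewrite mulrC (_ : 4 * `|y| = 3 * `|y| + `|y|); last by ring.
    rewrite expRD ler_pM ?exprn_ge0 ?expR_ge0//; first exact: normX_le_expR.
    by rewrite ler_expR ler_piMl.
  have b2 : `|expR (v * h ^+ 2 / 2) - 1 - v * h ^+ 2 / 2| <= K2 * `|h| ^+ 3.
    set u := v * h ^+ 2 / 2.
    have u0 : 0 <= u by rewrite divr_ge0// mulr_ge0 ?sqr_ge0// ltW.
    have h21 : `|h| ^+ 2 <= 1 by rewrite expr_le1.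
    have uv : u <= v / 2.
      by rewrite /u ler_wpM2r ?invr_ge0// -hn ler_piMr// ltW.
    have := expR_taylor2 u; rewrite (ger0_norm u0) => eu.
    rewrite (_ : _ - u = (expR u - 1 - u - u ^+ 2 / 2) + u ^+ 2 / 2); last by ring.
    rewrite (le_trans (ler_normD _ _))// (ger0_norm (_ : 0 <= u ^+ 2 / 2)); last first.
      by rewrite divr_ge0 ?sqr_ge0.
    rewrite addrC mulrDl lerD//.
      rewrite (_ : u ^+ 2 / 2 = v ^+ 2 / 8 * (`|h| ^+ 2) ^+ 2); last by rewrite /u hn; field.
      rewrite ler_wpM2l ?divr_ge0 ?sqr_ge0// -exprM.
      by rewrite ler_wiXn2l.
    rewrite (le_trans eu)// -mulrA ler_pM ?expR_ge0 ?exprn_ge0 ?ler_expR//.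
    rewrite (_ : u = v / 2 * `|h| ^+ 2); last by rewrite /u hn; field.
    rewrite exprMn ler_wpM2l ?exprn_ge0 ?divr_ge0 ?(ltW v0)// -exprM.
    by rewrite ler_wiXn2l.
  have -> : h * m + h ^+ 2 * ((s2 - v) / 2) =
    (expR (v * h ^+ 2 / 2) - 1 - v * h ^+ 2 / 2) -
    (expR (v * h ^+ 2 / 2) - 1 - h * m - h ^+ 2 / 2 * s2) by field.
  by rewrite (le_trans (ler_normB _ _))// addrC mulrDl lerD.
have K0 : 0 <= K1 + K2 by exact: addr_ge0.
(* Using both [h] and [- h] separates the odd coefficient [m] from the even coefficient
   [(s2 - v) / 2]. *)
have ab h : 0 < h <= 1 -> `|m| <= (K1 + K2) * h /\ `|(s2 - v) / 2| <= (K1 + K2) * h.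
  move=> /andP[h0 h1]; have h00 := ltW h0.
  have := key h; have := key (- h).
  rewrite normrN (ger0_norm h00) sqrrN => /(_ h1) k1 /(_ h1) k2.
  set b := (s2 - v) / 2 in k1 k2 *; set K := K1 + K2 in K0 k1 k2 *.
  have hh2 : 0 < h ^+ 2 by rewrite exprn_gt0.
  have hh : h ^+ 2 <= h by rewrite expr2 ler_piMr.
  have /andP[k1' k2'] : - (K * h ^+ 3) <= - h * m + h ^+ 2 * b <= K * h ^+ 3 by rewrite -ler_norml.
  have /andP[k3 k4] : - (K * h ^+ 3) <= h * m + h ^+ 2 * b <= K * h ^+ 3 by rewrite -ler_norml.
  have e3 : K * h ^+ 3 = h * (K * h ^+ 2) by ring.
  have e3' : K * h ^+ 3 = h ^+ 2 * (K * h) by ring.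
  have Kh : K * h ^+ 2 <= K * h by rewrite ler_wpM2l.
  split.
  - suff : `|h * m| <= h * (K * h ^+ 2).
      by rewrite normrM (ger0_norm h00) ler_pM2l// => k; exact: le_trans k Kh.
    by rewrite -e3 ler_norml; apply/andP; split; lra.
  - suff : `|h ^+ 2 * b| <= h ^+ 2 * (K * h).
      by rewrite normrM (ger0_norm (ltW hh2)) ler_pM2l.
    by rewrite -e3' ler_norml; apply/andP; split; lra.
split; first by apply: (@small_eq0 _ (K1 + K2)) => h /ab[].
have : (s2 - v) / 2 = 0 by apply: (@small_eq0 _ (K1 + K2)) => h /ab[].
by move=> e; lra.
Qed.

(* [|u|^3 <= exp (3 |u|) <= exp (3 u) + exp (- 3 u)] with [u = y / sqrt v]. *)
Lemma gauss_third v : 0 < v ->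
  \int[gauss_law v]_y (`|y| ^+ 3) <= 2 * expR (9 / 2) * Num.sqrt v ^+ 3.
Proof.
move=> v0; set s := Num.sqrt v.
have s0 : 0 < s by rewrite sqrtr_gt0.
have sv : s ^+ 2 = v by rewrite sqr_sqrtr// ltW.
have ie h : (gauss_law v).-integrable setT (EFin \o (fun y => expR (h * y))).
  apply: (@gauss_dom_integrable _ _ 1 `|h|) => //; first exact: measurableT_comp.
  move=> y; rewrite !mul1r ger0_norm ?expR_ge0// ler_expR.
  by rewrite (le_trans (ler_norm _))// normrM.
have ee h : \int[gauss_law v]_y expR (h * y) = expR (v * h ^+ 2 / 2).
  by rewrite /Rintegral gauss_mgf.
(* [9 / 2] is the exponent of the moment generating function at [3 / s], the same for every [v]. *)
have e1 : expR (9 / 2) = expR (v * (3 / s) ^+ 2 / 2).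
  by congr expR; rewrite -sv; field; rewrite gt_eqF.
have -> : 2 * expR (9 / 2) * s ^+ 3 =
    \int[gauss_law v]_y (s ^+ 3 * (expR (3 / s * y) + expR (- (3 / s) * y))).
  rewrite RintegralZl//; last by apply: (integrableD _ (ie _) (ie _)).
  by rewrite RintegralD// !ee sqrrN -e1; ring.
apply: le_Rintegral => //.
- exact: gauss_absmonomial_integrable.
- apply: (integrableZl _ (s ^+ 3) (integrableD _ (ie _) (ie _))) => //.
move=> y _; have -> : `|y| = s * (`|y| / s) by field; rewrite gt_eqF.
rewrite exprMn ler_wpM2l ?exprn_ge0 ?(ltW s0)//.
have := normX_le_expR (y / s) 3; rewrite normrM normfV (gtr0_norm s0) => /le_trans; apply.
have [y0|y0] := leP 0 y.
  rewrite (_ : 3 * (`|y| / s) = 3 / s * y) ?ler_wpDr ?expR_ge0//.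
  by rewrite (ger0_norm y0); field; rewrite gt_eqF.
rewrite (_ : 3 * (`|y| / s) = - (3 / s) * y) ?ler_wpDl ?expR_ge0//.
by rewrite (ltr0_norm y0); field; rewrite gt_eqF.
Qed.

Lemma Rintegral_gauss0 (f : R -> R) : measurable_fun setT f ->
  \int[gauss_law 0]_x f x = f 0.
Proof.
move=> mf; rewrite /Rintegral.
rewrite (eq_measure_integral (dirac (0 : R))); last first.
  by move=> A mA _; have := f_equal (fun m : set R -> \bar R => m A) gauss_law0.
rewrite integral_dirac//=; last exact/measurable_EFinP.
by rewrite indicE in_setT mul1r.
Qed.

(** Bayes' formula for a sum of independent Gaussians: the joint density of a summand [x] and the
    sum [z] is the density of the sum times the conditional density of the summand. *)
Lemma normal_pdf_conv (s1 s2 s3 x z : R) :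
  0 < s1 -> 0 < s2 -> 0 < s3 -> s3 ^+ 2 = s1 ^+ 2 + s2 ^+ 2 ->
  normal_pdf 0 s1 x * normal_pdf 0 s2 (z - x) =
  normal_pdf 0 s3 z * normal_pdf (z * s1 ^+ 2 / s3 ^+ 2) (s1 * s2 / s3) x.
Proof.
move=> s10 s20 s30 s3E.
have n1 : s1 != 0 by rewrite gt_eqF.
have n2 : s2 != 0 by rewrite gt_eqF.
have n3 : s3 != 0 by rewrite gt_eqF.
have n0 : s1 ^+ 2 + s2 ^+ 2 != 0 by rewrite -s3E expf_neq0.
have n4 : s1 * s2 / s3 != 0 by rewrite !mulf_neq0 ?invr_neq0.
rewrite !normal_pdfE// mulrACA [RHS]mulrACA; congr (_ * _).
  rewrite /normal_peak -!invfM -!sqrtrM; last 2 first.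
  - by rewrite mulrn_wge0// mulr_ge0 ?sqr_ge0 ?pi_ge0.
  - by rewrite mulrn_wge0// mulr_ge0 ?sqr_ge0 ?pi_ge0.
  congr (_^-1); congr Num.sqrt; rewrite !exprMn exprVn.
  by move: (s3 ^+ 2) (expf_neq0 2 n3) (s1 ^+ 2) (s2 ^+ 2) => c c0 a b; field.
rewrite /normal_fun -!expRD; congr expR.
have {}n1 := expf_neq0 2 n1; have {}n2 := expf_neq0 2 n2.
rewrite !exprMn exprVn s3E.
by move: (s1 ^+ 2) (s2 ^+ 2) n1 n2 n0 => a b a0 b0 ab0; field; rewrite a0 b0 ab0.
Qed.

End gauss_law.

(** * Convolution of Gaussian laws *)

Section gauss_law.
Context {R : realType}.
Local Notation leb := (@lebesgue_measure R).
Local Notation RT := (measurableTypeR R).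
Implicit Types v : R.

(** After the substitution [z = x + y], Tonelli lets [x] be integrated first, and the conditional
    density of [normal_pdf_conv] has mass 1. *)
Lemma gauss_conv_measure v1 v2 A : 0 < v1 -> 0 < v2 -> measurable A ->
  (\int[gauss_law v1]_x gauss_law v2 [set y | (x + y)%R \in A])%E =
  gauss_law (v1 + v2) A.
Proof.
move=> v10 v20 mA; have v30 : 0 < v1 + v2 by exact: addr_gt0.
set s1 := Num.sqrt v1; set s2 := Num.sqrt v2; set s3 := Num.sqrt (v1 + v2).
have s10 : 0 < s1 by rewrite sqrtr_gt0.
have s20 : 0 < s2 by rewrite sqrtr_gt0.
have s30 : 0 < s3 by rewrite sqrtr_gt0.
have s3E : s3 ^+ 2 = s1 ^+ 2 + s2 ^+ 2 by rewrite !sqr_sqrtr// ltW.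
have indicG v B : v != 0 -> measurable B ->
    gauss_law v B = (\int[leb]_x (\1_B x * normal_pdf 0 (Num.sqrt v) x)%:E)%E.
  move=> v0 mB; rewrite -[B in LHS]setIT -integral_indic// ge0_integral_gauss//.
  by apply/measurable_EFinP; exact: measurable_indic.
pose F (z : RT * RT) : \bar R :=
  (normal_pdf 0 s1 z.1 * (\1_A z.2 * normal_pdf 0 s2 (z.2 - z.1)))%:E.
have mF : measurable_fun setT F.
  apply/measurable_EFinP; apply: measurable_funM.
    by apply: measurableT_comp; first exact: measurable_normal_pdf.
  apply: measurable_funM.
    by apply: measurableT_comp; first exact: measurable_indic.
  apply: measurableT_comp; first exact: measurable_normal_pdf.
  by apply: measurable_funB; [exact: measurable_snd|exact: measurable_fst].
have F0 z : (0 <= F z)%E by rewrite lee_fin !mulr_ge0// normal_pdf_ge0.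
have shm (x : R) : measurable [set y | x + y \in A].
  rewrite (_ : [set _ | _] = (fun y => x + y) @^-1` A).
    by rewrite -[X in measurable X]setTI; apply: (measurable_funD _ _ measurableT).
  by apply/seteqP; split => y /=; rewrite inE.
have inner (x : R) : (gauss_law v2 [set y | (x + y)%R \in A] * (normal_pdf 0 s1 x)%:E =
    \int[leb]_z F (x, z))%E.
  pose f (z : R) := (\1_A z * normal_pdf 0 s2 (z - x))%:E.
  have mf : measurable_fun setT f.
    apply/measurable_EFinP; apply: measurable_funM; first exact: measurable_indic.
    apply: measurableT_comp; first exact: measurable_normal_pdf.
    exact: measurable_funB.
  have f0 z : (0 <= f z)%E by rewrite lee_fin mulr_ge0// normal_pdf_ge0.
  have -> : gauss_law v2 [set y | (x + y)%R \in A] = (\int[leb]_z f z)%E.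
    rewrite -[RHS](ge0_integral_translation x mf f0) (indicG _ _ (lt0r_neq0 v20) (shm x)).
    apply: eq_integral => y _; rewrite /f addrK; congr (_ * _)%:E.
    rewrite !indicE (addrC y) (_ : (y \in _) = (x + y \in A))//.
    by apply/idP/idP => [/set_mem//|yA]; exact/mem_set.
  rewrite muleC -ge0_integralZl_EFin ?normal_pdf_ge0//.
transitivity (\int[leb]_x \int[leb]_z F (x, z))%E.
  rewrite ge0_integral_gauss ?gt_eqF//.
    by apply: eq_integral => x _; exact: inner.
  pose h (z : R * R) := z.1 + z.2.
  have mh : measurable_fun setT h by exact: measurable_funD.
  have mhA : measurable (h @^-1` A) by rewrite -[X in measurable X]setTI; exact: mh.
  have := measurable_fun_xsection (gauss_law v2) mhA.
  congr (measurable_fun _ _); apply/funext => x /=; congr (gauss_law v2 _).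
rewrite (fubini_tonelli F)// indicG ?gt_eqF//.
apply: eq_integral => z _; rewrite /F/=.
under eq_integral do rewrite mulrCA (normal_pdf_conv _ _ s10 s20 s30 s3E) mulrA EFinM.
rewrite ge0_integralZl_EFin//.
- by rewrite integral_normal_pdf mule1.
- by move=> x _; rewrite lee_fin normal_pdf_ge0.
- by apply/measurable_EFinP; exact: measurable_normal_pdf.
- by rewrite mulr_ge0// normal_pdf_ge0.
Qed.

Lemma gauss_conv v1 v2 (f : R -> R) : 0 <= v1 -> 0 <= v2 -> bm f ->
  \int[gauss_law v1]_x \int[gauss_law v2]_y f (x + y) = \int[gauss_law (v1 + v2)]_x f x.
Proof.
move=> v10 v20 bf.
pose h : R * R -> R := fun z => z.1 + z.2.
have mh : measurable_fun setT h by exact: measurable_funD.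
have bfh : bm (fun z => f (h z)) by exact: bm_comp.
have bi : bm (fun x : R => \int[gauss_law v2]_y f (x + y)).
  exact: (bm_Rintegral2 (gauss_law v1) (gauss_law v2) bfh).
(* The density computation requires positive variances; a zero variance is a Dirac mass and is
   treated directly. *)
have [v1E|n1] := eqVneq v1 0.
  rewrite v1E add0r; apply: etrans; first exact: (Rintegral_gauss0 (proj1 bi)).
  by apply: eq_Rintegral => y _; rewrite add0r.
have [v2E|n2] := eqVneq v2 0.
  rewrite v2E addr0; apply: eq_Rintegral => x _.
  apply: etrans; first exact: (Rintegral_gauss0 (proj1 (bm_pair2 x bfh))).
  by rewrite /h/= addr0.
apply: etrans; first exact: (esym (bm_Rintegral_prod (gauss_law v1) (gauss_law v2) bfh)).
pose hm : {mfun (R * R)%type >-> R} := HB.pack h (isMeasurableFun.Build _ _ _ _ _ mh).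
apply: etrans.
  exact: (esym (bm_Rintegral_distribution (gauss_law v1 \x gauss_law v2)%E hm bf)).
congr fine; apply: eq_measure_integral => A mA _.
have v10' : 0 < v1 by rewrite lt_def n1.
have v20' : 0 < v2 by rewrite lt_def n2.
apply: etrans; last exact: (gauss_conv_measure v10' v20' mA).
apply: eq_integral => x _; congr (gauss_law v2 _).
Qed.

End gauss_law.

(** * Partial sums of independent variables *)

Section independence.
Context {d d1 d2} {T : measurableType d} {T1 : measurableType d1}
  {T2 : measurableType d2} {R : realType}.

(** Rectangles are stable under intersection, generate the product sigma-algebra and include the
    whole space, which has finite mass. *)
Lemma rectangle_measure_unique (m m' : {measure set (T1 * T2)%type -> \bar R}) :
  (m setT < +oo)%E ->
  (forall A B, measurable A -> measurable B -> m (A `*` B) = m' (A `*` B)) ->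
  forall X, measurable X -> m X = m' X.
Proof.
move=> moo mm' X mX.
pose C : set (set (T1 * T2)) := [set A `*` B | A in measurable & B in measurable].
apply: (measure_unique C (fun=> setT)) => //.
- by rewrite measurable_prod_measurableType.
- move=> /= _ _ [X1 mX1 [X2 mX2 <-]] [Y1 mY1 [Y2 mY2 <-]].
  rewrite -setXI; exists (X1 `&` Y1); first exact: measurableI.
  by exists (X2 `&` Y2) => //; exact: measurableI.
- by move=> n; exists setT => //; exists setT => //; rewrite setXTT.
- by rewrite bigcup_const.
- by move=> _ [A mA [B mB <-]]; exact: mm'.
Qed.

(** Stated for measures of any mass, because it is applied to the restriction of [P] to an event and
    to a multiple of [P]. *)
Lemma preimage_measure (mu : {measure set T -> \bar R}) (f : T -> T1) :
  measurable_fun setT f ->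
  exists nu : {measure set T1 -> \bar R}, forall A, nu A = mu (f @^-1` A).
Proof.
move=> mf; pose nu A := mu (f @^-1` A).
have mpre A : measurable A -> measurable (f @^-1` A).
  by move=> mA; rewrite -[X in measurable X]setTI; exact: mf.
have nu0 : nu set0 = 0%E by rewrite /nu preimage_set0 measure0.
have nu_ge0 A : (0 <= nu A)%E by exact: measure_ge0.
have nu_sa : semi_sigma_additive nu.
  move=> F mF tF mUF; rewrite /nu preimage_bigcup.
  apply: measure_semi_sigma_additive.
  - by move=> k; exact: mpre.
  - apply/trivIsetP => /= i j _ _ ij; rewrite -preimage_setI.
    by move/trivIsetP : tF => /(_ _ _ _ _ ij) ->//; rewrite preimage_set0.
  - by rewrite -preimage_bigcup; exact: mpre.
pose m := isMeasure.Build _ _ _ nu nu0 nu_ge0 nu_sa.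
pose num : {measure set T1 -> \bar R} := HB.pack nu m.
by exists num.
Qed.

(** The joint law agrees with the product law on rectangles, hence everywhere, and Fubini applies.
    The independent copy of [V] on the right is a second integration over the same space. *)
Lemma indep_Rintegral (P : probability T R) (U : T -> T1) (V : T -> T2)
    (F : T1 * T2 -> R) :
  measurable_fun setT U -> measurable_fun setT V ->
  (forall A B, measurable A -> measurable B ->
    P (U @^-1` A `&` V @^-1` B) = (P (U @^-1` A) * P (V @^-1` B))%E) ->
  bm F ->
  \int[P]_x F (U x, V x) = \int[P]_x \int[P]_y F (U x, V y).
Proof.
move=> mU mV iUV bF.
pose Um : {mfun T >-> T1} := HB.pack U (isMeasurableFun.Build _ _ _ _ _ mU).
pose Vm : {mfun T >-> T2} := HB.pack V (isMeasurableFun.Build _ _ _ _ _ mV).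
pose W x := (U x, V x).
have mW : measurable_fun setT W by exact: measurable_fun_pair.
pose Wm : {mfun T >-> (T1 * T2)%type} := HB.pack W (isMeasurableFun.Build _ _ _ _ _ mW).
apply: etrans; first exact: (esym (bm_Rintegral_distribution P Wm bF)).
transitivity (\int[(distribution P Um \x distribution P Vm)%E]_z F z).
  congr fine; apply: eq_measure_integral => A mA _.
  apply/esym; apply: product_measure_unique mA => B C mB mC.
  exact: iUV.
apply: etrans; first exact: (bm_Rintegral_prod (distribution P Um) (distribution P Vm) bF).
apply: etrans.
  apply: (bm_Rintegral_distribution P Um (f := fun x => \int[distribution P Vm]_y F (x, y))).
  exact: (bm_Rintegral2 (distribution P Um)).
apply: eq_Rintegral => x _.
exact: (bm_Rintegral_distribution P Vm (bm_pair2 (U x) bF)).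
Qed.

End independence.

Section partial_sums.
Context {d d'} {T : measurableType d} {E : measurableType d'} {R : realType}.
Variables (P : probability T R) (Z : nat -> T -> E) (g : E -> R).
Hypothesis mZ : forall i, measurable_fun setT (Z i).
Hypothesis iZ : mutually_independent P Z.
Hypothesis mg : measurable_fun setT g.

Definition psum n (x : T) : R := \sum_(i < n) g (Z i x).

Lemma measurable_psum n : measurable_fun setT (psum n).
Proof. by apply: measurable_sum => i; exact: measurableT_comp. Qed.

Let cyl (s : seq nat) (A : nat -> set E) := \bigcap_(i in [set` s]) Z i @^-1` A i.

Let mcyl s A : (forall i, measurable (A i)) -> measurable (cyl s A).
Proof.
move=> mA; apply: fin_bigcap_measurable => // i _.
by rewrite -[X in measurable X]setTI; exact: mZ.
Qed.

(* The induction on [n] needs the factorization for all cylinders over indices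
   [>= n], not just for [Z n]. *)
Lemma psum_indep_cyl n s A B : uniq s -> all (leq n) s ->
  (forall i, measurable (A i)) -> measurable B ->
  P (psum n @^-1` B `&` cyl s A) = (P (psum n @^-1` B) * P (cyl s A))%E.
Proof.
elim: n s A B => [|n IH] s A B us sn mA mB.
  have psum0 : psum 0 = cst 0 by apply/funext => x; rewrite /psum big_ord0.
  rewrite psum0 preimage_cst; case: ifPn => _.
    by rewrite setTI probability_setT mul1e.
  by rewrite set0I measure0 mul0e.
pose pr x := (psum n x, Z n x).
have mpr : measurable_fun setT pr by apply: measurable_fun_pair => //; exact: measurable_psum.
pose C := [set z : R * E | B (z.1 + g z.2)].
have mC : measurable C.
  rewrite (_ : C = (fun z : R * E => z.1 + g z.2) @^-1` B)//.
  rewrite -[X in measurable X]setTI.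
  suff: measurable_fun setT (fun z : R * E => z.1 + g z.2) by apply.
  by apply: measurable_funD => //; exact: measurableT_comp.
have SC : psum n.+1 @^-1` B = pr @^-1` C.
  by apply/seteqP; split => x; rewrite /preimage/C/pr/= /psum big_ord_recr.
have ns : n \notin s.
  by apply/negP => /(allP sn); rewrite ltnn.
have sn' : all (leq n) s by apply/allP => i /(allP sn) /ltnW.
have mD := mcyl s mA.
(* As functions of a set of values of the pair ([psum n], [Z n]), both sides are measures, so
   rectangles suffice. On a rectangle the condition on [Z n] joins the cylinder, and the induction
   hypothesis is used for the indices [n :: s] and for [n] alone. *)
have [m1 m1E] := preimage_measure (mrestr P mD) mpr.
pose r : {nonneg R} := NngNum (fine_ge0 (measure_ge0 P (cyl s A))).
have [m2 m2E] := preimage_measure (mscale r P) mpr.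
have rE : (r%:num)%:E = P (cyl s A) by rewrite /= fineK// fin_num_measure.
have {}m1E X : m1 X = P (pr @^-1` X `&` cyl s A) := m1E X.
have {}m2E X : m2 X = (P (cyl s A) * P (pr @^-1` X))%E by rewrite -rE; exact: m2E.
suff m1m2 X : measurable X -> m1 X = m2 X.
  by rewrite SC muleC -m1E -m2E; exact: m1m2.
apply: rectangle_measure_unique.
  rewrite m1E preimage_setT setTI (le_lt_trans (probability_le1 _ _)) ?ltry//.
move=> B' K mB' mK; rewrite m1E m2E.
pose A' i := if i == n then K else A i.
have mA' i : measurable (A' i) by rewrite /A'; case: ifP.
have cylE s' : n \notin s' -> cyl s' A' = cyl s' A.
  move=> ns'; apply: eq_bigcapr => i /= is'.
  by rewrite /A' ifF//; apply: contraNF ns' => /eqP <-.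
have cylS : cyl (n :: s) A' = Z n @^-1` K `&` cyl s A.
  by rewrite -(cylE s ns) /cyl !bigcap_seq big_cons {1}/A' eqxx.
have cyl1 : cyl [:: n] A' = Z n @^-1` K.
  by rewrite /cyl set_cons1 bigcap_set1 /A' eqxx.
have pcyl : P (cyl (n :: s) A') = (P (Z n @^-1` K) * P (cyl s A))%E.
  rewrite -(cylE s ns) /cyl !iZ//= ?ns// big_cons.
  by rewrite /A' eqxx.
have prE : pr @^-1` (B' `*` K) = psum n @^-1` B' `&` Z n @^-1` K by [].
rewrite prE -setIA -cylS IH ?pcyl//=; last 2 first.
- by rewrite ns.
- by rewrite leqnn.
rewrite -cyl1 IH//= ?leqnn// cyl1.
by rewrite muleA muleC.
Qed.

Lemma psum_indep n A B : measurable A -> measurable B ->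
  P (psum n @^-1` A `&` Z n @^-1` B) = (P (psum n @^-1` A) * P (Z n @^-1` B))%E.
Proof.
move=> mA mB; have := @psum_indep_cyl n [:: n] (fun=> B) A isT.
by rewrite /cyl set_cons1 bigcap_set1 /= leqnn => /(_ isT (fun=> mB) mA).
Qed.

Lemma indep_pair i j A B : i != j -> measurable A -> measurable B ->
  P (Z i @^-1` A `&` Z j @^-1` B) = (P (Z i @^-1` A) * P (Z j @^-1` B))%E.
Proof.
move=> ij mA mB; pose F k := if k == i then A else B.
have mF k : measurable (F k) by rewrite /F; case: ifP.
have := @iZ [:: i; j] F; rewrite /= inE ij => /(_ isT mF).
rewrite bigcap_seq !big_cons !big_nil mule1 setIT.
by rewrite /F eqxx eq_sym (negbTE ij).
Qed.

End partial_sums.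

(** * Lindeberg's replacement argument *)

Section taylor_class.
Context {R : realType}.
Implicit Types (f : R -> R) (C : R).

(* Second-order Taylor expansions with a uniform cubic remainder; unlike a
   differentiability class, this is visibly stable under convolution. *)
Definition taylor_class (C : R) f : Prop := bm f /\
  exists f1 f2, [/\ bm f1, bm f2 & forall x h,
    `|f (x + h) - f x - h * f1 x - h ^+ 2 / 2 * f2 x| <= C * `|h| ^+ 3].

(** The expansion is averaged over [Y] together with its coefficients, so the constant [C] does not
    grow. This is what allows an induction over the summands. *)
Lemma taylor_class_conv C f d (T : measurableType d) (mu : probability T R)
    (Y : T -> R) : measurable_fun setT Y -> taylor_class C f ->
  taylor_class C (fun x : R => \int[mu]_y f (x + Y y)).
Proof.
move=> mY [bf [f1 [f2 [bf1 bf2 fC]]]].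
have mxY : measurable_fun setT (fun z : R * T => z.1 + Y z.2).
  by apply: measurable_funD => //; exact: measurableT_comp.
have bp (g : R -> R) : bm g -> bm (fun z : R * T => g (z.1 + Y z.2)).
  by move=> bg; exact: (bm_comp mxY bg).
have bI (g : R -> R) : bm g -> bm (fun x : R => \int[mu]_y g (x + Y y)).
  (* Any probability on [R] would do for the outer variable; it enters through the measurability of
     a partial integral. *)
  by move=> /bp bg; exact: (bm_Rintegral2 (gauss_law 0) mu bg).
split; first exact: bI.
exists (fun x : R => \int[mu]_y f1 (x + Y y)), (fun x : R => \int[mu]_y f2 (x + Y y)).
split; [exact: bI|exact: bI|move=> x h].
have bs (g : R -> R) x' : bm g -> bm (fun y => g (x' + Y y)).
  by move=> /bp bg; exact: (bm_pair2 x' bg).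
have -> : \int[mu]_y f (x + h + Y y) - \int[mu]_y f (x + Y y) -
    h * \int[mu]_y f1 (x + Y y) - h ^+ 2 / 2 * \int[mu]_y f2 (x + Y y) =
  \int[mu]_y (f (x + h + Y y) - f (x + Y y) - h * f1 (x + Y y) -
    h ^+ 2 / 2 * f2 (x + Y y)).
  have b1 := bs f (x + h) bf; have b2 := bs f x bf; have b3 := bmZ h (bs f1 x bf1).
  have b4 := bmZ (h ^+ 2 / 2) (bs f2 x bf2).
  rewrite bm_RintegralB// ?bm_RintegralB// ?bm_RintegralB// ?bm_RintegralZl//.
  - exact: bs.
  - exact: bs.
  - exact: bmB.
  - by apply: bmB => //; exact: bmB.
apply: norm_Rintegral_le.
  by apply: bmB; [apply: bmB; [apply: bmB|apply: bmZ]|apply: bmZ]; exact: bs.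
by move=> y; rewrite (addrAC x h).
Qed.

(** In the averaged expansion the mean of [Y] vanishes and only its variance remains, so two laws of
    equal variance have the same main term. Moments are assumed integrable, not bounded, to cover
    the Gaussian case. *)
Lemma taylor_step C f f1 f2 (x v : R) d (T : measurableType d) (mu : probability T R)
    (Y : T -> R) :
  bm f -> (forall h,
    `|f (x + h) - f x - h * f1 x - h ^+ 2 / 2 * f2 x| <= C * `|h| ^+ 3) ->
  measurable_fun setT Y ->
  mu.-integrable setT (EFin \o Y) ->
  mu.-integrable setT (EFin \o (fun y => Y y ^+ 2)) ->
  mu.-integrable setT (EFin \o (fun y => `|Y y| ^+ 3)) ->
  \int[mu]_y Y y = 0 -> \int[mu]_y (Y y ^+ 2) = v ->
  `|\int[mu]_y f (x + Y y) - f x - v / 2 * f2 x| <= C * \int[mu]_y (`|Y y| ^+ 3).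
Proof.
move=> bf fC mY i1 i2 i3 e1 e2.
have i0 : mu.-integrable setT (EFin \o (fun y => f (x + Y y))).
  apply: bm_integrable; apply: (bm_comp (h := fun y => x + Y y)) => //.
  exact: measurable_funD.
have ic : mu.-integrable setT (EFin \o (fun y => f x)).
  by apply/bm_integrable/bm_cst.
have i1' : mu.-integrable setT (EFin \o (fun y => Y y * f1 x)).
  exact: (integrableZr _ (f1 x) i1).
have i2' : mu.-integrable setT (EFin \o (fun y => Y y ^+ 2 * (2^-1 * f2 x))).
  exact: (integrableZr _ (2^-1 * f2 x) i2).
have j1 : mu.-integrable setT (EFin \o (fun y => f (x + Y y) - f x)).
  exact: (integrableB _ i0 ic).
have j2 : mu.-integrable setT (EFin \o (fun y => f (x + Y y) - f x - Y y * f1 x)).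
  exact: (integrableB _ j1 i1').
have j3 : mu.-integrable setT (EFin \o (fun y => f (x + Y y) - f x - Y y * f1 x
    - Y y ^+ 2 * (2^-1 * f2 x))).
  exact: (integrableB _ j2 i2').
have -> : \int[mu]_y f (x + Y y) - f x - v / 2 * f2 x =
  \int[mu]_y (f (x + Y y) - f x - Y y * f1 x - Y y ^+ 2 * (2^-1 * f2 x)).
  rewrite !RintegralB// Rintegral_probcst !RintegralZr// e1 e2.
  by rewrite mul0r subr0 mulrA.
rewrite (le_trans (le_normr_Rintegral _ _))// -RintegralZl//.
apply: le_Rintegral => //.
- exact: (integrable_norm j3).
- exact: (integrableZl _ C i3).
by move=> y _; have := fC (Y y); rewrite -(mulrA _ _ (f2 x)).
Qed.

Lemma gauss_step C f f1 f2 (x v : R) : 0 <= v ->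
  bm f -> (forall h,
    `|f (x + h) - f x - h * f1 x - h ^+ 2 / 2 * f2 x| <= C * `|h| ^+ 3) ->
  `|\int[gauss_law v]_y f (x + y) - f x - v / 2 * f2 x| <=
    C * (2 * expR (9 / 2) * Num.sqrt v ^+ 3).
Proof.
move=> v0 bf fC.
have [vE|nv] := eqVneq v 0.
  have mf : measurable_fun setT (fun y => f (x + y)).
    have mx : measurable_fun setT (fun y : R => x + y) by exact: measurable_funD.
    by case: (bm_comp mx bf).
  rewrite vE (_ : \int[_]_y f (x + y) = f x).
    by rewrite subrr !mul0r subrr normr0 sqrtr0 expr0n/= !mulr0.
  by apply: etrans; [exact: (Rintegral_gauss0 mf)|rewrite addr0].
have {}v0 : 0 < v by rewrite lt_def nv.
have C0 : 0 <= C by have := fC 1; rewrite normr1 !expr1n mulr1; exact: le_trans.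
have [g1 g2] := gauss_mean_var v0.
have := @taylor_step C f f1 f2 x v _ _ (gauss_law v) id bf fC.
move=> /(_ (@measurable_id _ _ setT) (gauss_monomial_integrable 1 v0)
  (gauss_monomial_integrable 2 v0) (gauss_absmonomial_integrable 3 v0) g1 g2).
by move=> /le_trans; apply; rewrite ler_wpM2l// gauss_third.
Qed.

End taylor_class.

Section lindeberg.
Context {d d'} {T : measurableType d} {E : measurableType d'} {R : realType}.
Variables (P : probability T R) (Z : nat -> T -> E) (g : E -> R).
Hypothesis mZ : forall i, measurable_fun setT (Z i).
Hypothesis iidZ : iid P Z.
Hypothesis bg : bm g.
Hypothesis g0 : \int[P]_x g (Z 0%N x) = 0.

Let v := \int[P]_x g (Z 0%N x) ^+ 2.
Let rho := \int[P]_x (`|g (Z 0%N x)| ^+ 3).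

Lemma identically_distributed_Rintegral (f : E -> R) n : bm f ->
  \int[P]_x f (Z n x) = \int[P]_x f (Z 0%N x).
Proof.
move=> bf.
pose Zm k : {mfun T >-> E} := HB.pack (Z k) (isMeasurableFun.Build _ _ _ _ _ (mZ k)).
apply: etrans; first exact: (esym (bm_Rintegral_distribution P (Zm n) bf)).
apply: etrans; last exact: (bm_Rintegral_distribution P (Zm 0%N) bf).
congr fine; apply: eq_measure_integral => A mA _.
by case: iidZ => _; apply.
Qed.

(* The Gaussian law is infinitely divisible, so the summands can be replaced by
   Gaussians one at a time, each at the cost of two third moments. *)
Lemma lindeberg_iter (C h : R) n f : 0 <= h -> taylor_class C f ->
  `|\int[P]_x f (h * psum Z g n x) - \int[gauss_law (n%:R * (h ^+ 2 * v))]_y f y| <=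
  n%:R * (C * h ^+ 3 * (rho + 2 * expR (9 / 2) * Num.sqrt v ^+ 3)).
Proof.
move=> h0; have v0 : 0 <= v by apply: Rintegral_ge0 => x _; exact: sqr_ge0.
have hv0 : 0 <= h ^+ 2 * v by rewrite mulr_ge0 ?sqr_ge0.
elim: n f => [|n IH] f tf.
  rewrite !mul0r.
  rewrite (_ : \int[P]_x _ = f 0); last first.
    under eq_Rintegral do rewrite /psum big_ord0 mulr0.
    by rewrite Rintegral_probcst.
  rewrite (_ : \int[gauss_law 0]_y f y = f 0) ?subrr ?normr0//.
  by apply: Rintegral_gauss0; case: tf => -[].
have [bf [f1 [f2 [bf1 bf2 fC]]]] := tf.
(* [Tf] averages [f] over one true summand, [Gf] over a Gaussian one of the same variance
   [h ^+ 2 * v]. *)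
pose Tf x := \int[P]_y f (x + h * g (Z 0%N y)).
pose Gf x := \int[gauss_law (h ^+ 2 * v)]_y f (x + y).
have mgZ i : measurable_fun setT (fun x => g (Z i x)).
  by apply: measurableT_comp => //; case: bg.
have mY : measurable_fun setT (fun y => h * g (Z 0%N y)).
  exact: measurable_funM.
have tT : taylor_class C Tf by exact: (taylor_class_conv P mY tf).
have tG : taylor_class C Gf.
  exact: (taylor_class_conv (gauss_law (h ^+ 2 * v)) (@measurable_id _ _ setT) tf).
have [bT _] := tT; have [bG _] := tG.
set K := 2 * expR (9 / 2).
have bgZ : bm (fun x => g (Z 0%N x)) by exact: (bm_comp (mZ 0%N) bg).
have key x : `|Tf x - Gf x| <= C * h ^+ 3 * (rho + K * Num.sqrt v ^+ 3).
  have bY := bmZ h bgZ.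
  have e1 : \int[P]_y (h * g (Z 0%N y)) = 0 by rewrite bm_RintegralZl// g0 mulr0.
  have e2 : \int[P]_y ((h * g (Z 0%N y)) ^+ 2) = h ^+ 2 * v.
    under eq_Rintegral do rewrite exprMn.
    by rewrite bm_RintegralZl//; exact: bmX.
  have e3 : \int[P]_y (`|h * g (Z 0%N y)| ^+ 3) = h ^+ 3 * rho.
    under eq_Rintegral do rewrite normrM exprMn (ger0_norm h0).
    by rewrite bm_RintegralZl//; apply: bmX; exact: bm_norm.
  have s1 := taylor_step bf (fC x) mY (bm_integrable P bY)
    (bm_integrable P (bmX 2 bY)) (bm_integrable P (bmX 3 (bm_norm bY))) e1 e2.
  have s2 := gauss_step hv0 bf (fC x).
  have -> : Tf x - Gf x = (Tf x - f x - h ^+ 2 * v / 2 * f2 x) -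
    (Gf x - f x - h ^+ 2 * v / 2 * f2 x) by ring.
  rewrite (le_trans (ler_normB _ _))// mulrDr lerD//.
    by rewrite (le_trans s1)// e3 mulrA.
  rewrite (le_trans s2)// sqrtrM ?sqr_ge0// sqrtr_sqr (ger0_norm h0).
  by rewrite le_eqVlt; apply/orP; left; apply/eqP; rewrite -/K; ring.
have mps := measurable_psum mZ (proj1 bg).
have bhp (f' : R -> R) : bm f' -> bm (fun x => f' (h * psum Z g n x)).
  move=> bf'; apply: (bm_comp (h := fun x => h * psum Z g n x)) => //.
  by apply: measurable_funM.
have E1 : \int[P]_x f (h * psum Z g n.+1 x) = \int[P]_x Tf (h * psum Z g n x).
  pose F (z : R * E) := f (h * z.1 + h * g z.2).
  have bF : bm F.
    apply: (bm_comp (h := fun z : R * E => h * z.1 + h * g z.2)) => //.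
    apply: measurable_funD; apply: measurable_funM => //.
    by apply: measurableT_comp => //; case: bg.
  have iUV A B := @psum_indep _ _ _ _ _ P Z g mZ (proj1 iidZ) (proj1 bg) n A B.
  have e := indep_Rintegral (mps n) (mZ n) iUV bF.
  transitivity (\int[P]_x F (psum Z g n x, Z n x)).
    by apply: eq_Rintegral => x _; rewrite /F /psum big_ord_recr/= mulrDr.
  rewrite e; apply: eq_Rintegral => x _.
  exact: (identically_distributed_Rintegral n (bm_pair2 (psum Z g n x) bF)).
have E2 : \int[gauss_law (n.+1%:R * (h ^+ 2 * v))]_y f y =
    \int[gauss_law (n%:R * (h ^+ 2 * v))]_y Gf y.
  have e := @gauss_conv _ (n%:R * (h ^+ 2 * v)) (h ^+ 2 * v) f.
  have -> : n.+1%:R * (h ^+ 2 * v) = n%:R * (h ^+ 2 * v) + h ^+ 2 * v.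
    by rewrite -natr1 mulrDl mul1r.
  have nhv0 : 0 <= n%:R * (h ^+ 2 * v) by rewrite mulr_ge0 ?ler0n.
  exact: (esym (e nhv0 hv0 bf)).
have n1E : n.+1%:R = 1 + n%:R :> R by rewrite -natr1 addrC.
rewrite E1 E2 n1E mulrDl mul1r.
(* The last summand is exchanged at the cost [key]; the others are left to the induction hypothesis
   for [Gf], which has the same constant [C]. *)
have -> : \int[P]_x Tf (h * psum Z g n x) - \int[gauss_law (n%:R * (h ^+ 2 * v))]_y Gf y =
  (\int[P]_x Tf (h * psum Z g n x) - \int[P]_x Gf (h * psum Z g n x)) +
  (\int[P]_x Gf (h * psum Z g n x) - \int[gauss_law (n%:R * (h ^+ 2 * v))]_y Gf y).
  by ring.
apply: (le_trans (ler_normD _ _)); apply: lerD; last exact: (IH Gf tG).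
rewrite -(bm_RintegralB P (bhp Tf bT) (bhp Gf bG)).
apply: norm_Rintegral_le; first exact: (bmB (bhp Tf bT) (bhp Gf bG)).
by move=> x; exact: key.
Qed.

(** With [h] the inverse of the square root of [n], the Gaussian variance is exactly [v] and the [n]
    errors of order [h ^+ 3] add up to order [h]. *)
Lemma lindeberg C n f : taylor_class C f -> (0 < n)%N ->
  `|\int[P]_x f ((Num.sqrt n%:R)^-1 * psum Z g n x) - \int[gauss_law v]_y f y| <=
  C * (rho + 2 * expR (9 / 2) * Num.sqrt v ^+ 3) * (Num.sqrt n%:R)^-1.
Proof.
move=> tf n0; have n0' : 0 < n%:R :> R by rewrite ltr0n.
set s := Num.sqrt n%:R; have s0 : 0 < s by rewrite sqrtr_gt0.
have sn : n%:R = s ^+ 2 by rewrite sqr_sqrtr// ltW.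
have si0 : 0 <= s^-1 by rewrite invr_ge0 ltW.
have := @lindeberg_iter C s^-1 n f si0 tf.
have -> : n%:R * (s^-1 ^+ 2 * v) = v.
  by rewrite mulrA sn -exprMn divff ?gt_eqF// expr1n mul1r.
have -> : n%:R * (C * s^-1 ^+ 3 * (rho + 2 * expR (9 / 2) * Num.sqrt v ^+ 3)) =
    C * (rho + 2 * expR (9 / 2) * Num.sqrt v ^+ 3) * s^-1.
  by rewrite sn; move: (rho + _) => r; field; rewrite gt_eqF.
exact: id.
Qed.

End lindeberg.

(** * Reduction of weak convergence to smooth test functions *)

Section smoothing.
Context {R : realType}.
Local Notation leb := (@lebesgue_measure R).
Implicit Types f g : R -> R.

(** An integral from a base point is differentiable only to the right of that point. In [F] the base
    point moves so as to stay to the left of both 0 and [y]; by [FG] the choice does not affect the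
    value. *)
Lemma antiderivative_exists f : continuous f ->
  exists F : R -> R, forall x : R, is_derive x 1 F (f x).
Proof.
move=> cf.
have itf a b : leb.-integrable `[a, b] (EFin \o f).
  apply: continuous_compact_integrable; first exact: segment_compact.
  exact: continuous_subspaceT.
pose G a y := \int[leb]_(t in `[a, y]) f t.
have GB a c y : a <= c -> c <= y -> G a y = G a c + \int[leb]_(t in `]c, y]) f t.
  move=> ac cy; have := @Rintegral_itvB _ f (BLeft a) (BRight y) c (itf a y).
  by rewrite !bnd_simp => /(_ ac cy) <-; rewrite addrC subrK.
have Gc a c x y : a <= c -> c <= x -> c <= y -> G a y - G a x = G c y - G c x.
  move=> ac cx cy; rewrite (GB a c y)// (GB a c x)// (GB c c y)// (GB c c x)//.
  by ring.
pose F y := G (Num.min 0 y - 1) y - G (Num.min 0 y - 1) 0.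
have FG c y : c <= 0 -> c <= y -> F y = G c y - G c 0.
  move=> c0 cy; rewrite /F; set a := _ - 1.
  have a0 : a <= 0 by rewrite /a lerBlDr add0r ge_min ler01.
  have ay : a <= y by rewrite /a lerBlDr ge_min lerDl ler01 orbT.
  have [ac|/ltW ca] := leP a c; first exact: Gc.
  by apply/esym; exact: Gc.
exists F => x; pose c := Num.min 0 x - 2.
have cx : c < x by rewrite /c ltrBlDr gt_min ltrDl ltr0n orbT.
have c0 : c <= 0 by rewrite /c lerBlDr add0r ge_min ler0n.
have xx1 : x < x + 1 by rewrite ltrDl.
have [dG eG] := @continuous_FTC1 _ f (BLeft c) x (x + 1) xx1 (itf _ _) cx (cf x).
have dG' : is_derive x 1 (fun y => G c y - G c 0) (f x).
  have dGc : is_derive x 1 (G c) (f x) by apply: (DeriveDef dG); rewrite -derive1E; exact: eG.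
  by have := is_deriveB dGc (is_derive_cst (G c 0) x 1); rewrite subr0.
apply: near_eq_is_derive dG'; near=> y; apply: (esym (FG c y c0 _)).
by apply: ltW; near: y; exact: lt_nbhsr.
Unshelve. all: by end_near. Qed.

Lemma is_derive_continuous f g : (forall x : R, is_derive x 1 f (g x)) -> continuous f.
Proof.
move=> fg x; apply: differentiable_continuous; apply/derivable1_diffP.
by case: (fg x).
Qed.

(** [g x] is the mean of [f] over [[x, x + eta]]. Recording that it is a value of [f] in the window
    makes bounds and closeness to [f] survive repeated averaging. *)
Lemma window_average f (eta : R) : continuous f -> 0 < eta ->
  exists g, (forall x : R, is_derive x 1 g ((f (x + eta) - f x) / eta)) /\
  forall x, exists2 c, x <= c <= x + eta & g x = f c.
Proof.
move=> cf eta0; have [F dF] := antiderivative_exists cf.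
exists (fun x => (F (x + eta) - F x) / eta); split=> x.
  have d1 : is_derive x 1 (fun y => F (y + eta)) (f (x + eta)).
    rewrite (_ : (fun y => _) = F \o (id + cst eta))//.
    have dl : is_derive x (1 : R) (id + cst eta) (1 + 0) by apply: is_deriveD.
    have := @is_derive1_comp _ F (id + cst eta) x _ _ (dF (x + eta)) dl.
    by rewrite addr0 mulr1.
  rewrite (_ : (fun y => _) = eta^-1 \*: ((fun y => F (y + eta)) - F)).
    by apply: is_derive_eq; rewrite /GRing.scale/= mulrC.
  by apply/funext => y; rewrite /GRing.scale/= mulrC.
have := @MVT_segment _ F f x (x + eta).
rewrite lerDl => /(_ (ltW eta0) (fun y _ => dF y)).
have cF : continuous F by exact: is_derive_continuous dF.
move=> /(_ (continuous_subspaceT cF))[c]; rewrite in_itv/= => xc ->.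
by exists c => //; rewrite addrAC subrr add0r mulfK// gt_eqF.
Qed.

(** Each point of the segment has a neighbourhood and a range of window lengths that work;
    compactness makes the range uniform. The point [c] may lie outside the segment. *)
Lemma continuous_window f (K e : R) : continuous f -> 0 < e ->
  exists2 eta : R, 0 < eta & forall x c, `|x| <= K -> x <= c <= x + eta -> `|f c - f x| <= e.
Proof.
move=> cf e0.
have cK : compact `[- K, K] by exact: segment_compact.
have := (compact_near_coveringP `[- K, K]).1 cK.
move=> /(_ R (0^'+) (fun eta x => forall c, x <= c <= x + eta -> `|f c - f x| <= e) _).
case=> [x _|eta /= eta0 H].
  have e20 : 0 < e / 2 by rewrite divr_gt0.
  have /cvgrPdist_le /(_ _ e20) /nbhs_ballP[r /= r0 fr] := cf x.
  have r20 : 0 < r / 2 by rewrite divr_gt0.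
  near=> x' i => c /andP[xc cx].
  have xx' : `|x - x'| < r / 2 by near: x'; apply/nbhs_ballP; exists (r / 2) => //.
  have ir : i < r / 2 by near: i; exact: nbhs_right_lt.
  have f1 : `|f x - f x'| <= e / 2.
    by apply: fr; rewrite /ball/= (lt_trans xx')// ltr_pdivrMr// ltr_pMr// ltr1n.
  have f2 : `|f x - f c| <= e / 2.
    apply: fr; rewrite /ball/= (_ : x - c = (x - x') - (c - x')); last by ring.
    rewrite (le_lt_trans (ler_normB _ _))// [ltRHS](splitr r) ltr_leD//.
    rewrite ger0_norm ?subr_ge0// lerBlDl (le_trans cx)// lerD2l ltW//.
  rewrite (_ : f c - f x' = (f x - f x') - (f x - f c)); last by ring.
  by rewrite (le_trans (ler_normB _ _))// [leRHS](splitr e) lerD.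
(* Half of [eta] is strictly inside the neighbourhood of 0 given by compactness. *)
exists (eta / 2) => [|x c xK]; first by rewrite divr_gt0.
apply: H.
- by rewrite /ball_/= sub0r normrN gtr0_norm ?divr_gt0// ltr_pdivrMr// ltr_pMr// ltr1n.
- by rewrite divr_gt0.
- by rewrite /= in_itv/= -ler_norml.
Unshelve. all: by end_near. Qed.

Lemma continuous_bm f (M : R) : continuous f -> (forall x, `|f x| <= M) -> bm f.
Proof.
by move=> cf fM; split; [exact: continuous_measurable_fun|exists M].
Qed.

(* Three successive averages over windows of length [eta] make [f] three times
   differentiable and move each value by at most three windows. *)
Lemma taylor_class_dense f (M K e : R) : continuous f -> (forall x, `|f x| <= M) -> 0 < e ->
  exists C L fe, [/\ taylor_class C fe, forall x y, `|fe x - fe y| <= L * `|x - y|,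
    forall x, `|fe x| <= M & forall x, `|x| <= K -> `|fe x - f x| <= e].
Proof.
move=> cf fM e0; have [eta0 eta00 fe] := continuous_window K cf e0.
pose eta := eta0 / 3; have eta_gt0 : 0 < eta by rewrite divr_gt0.
pose D (u : R -> R) (x : R) := (u (x + eta) - u x) / eta.
have DN (u : R -> R) N : (forall x, `|u x| <= N) -> forall x, `|D u x| <= 2 * N / eta.
  move=> uN x; rewrite /D normrM normfV (gtr0_norm eta_gt0) ler_wpM2r ?invr_ge0 ?(ltW eta_gt0)//.
  by rewrite (le_trans (ler_normB _ _))// mulrDl !mul1r lerD.
have dD (u u' : R -> R) : (forall x : R, is_derive x 1 u (u' x)) ->
    forall x : R, is_derive x 1 (D u) (D u' x).
  move=> du x.
  have d1 : is_derive x 1 (fun y => u (y + eta)) (u' (x + eta)).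
    rewrite (_ : (fun y => _) = u \o (id + cst eta))//.
    have dl : is_derive x (1 : R) (id + cst eta) (1 + 0) by apply: is_deriveD.
    have := @is_derive1_comp _ u (id + cst eta) x _ _ (du (x + eta)) dl.
    by rewrite addr0 mulr1.
  have := is_deriveZ eta^-1 (is_deriveB d1 (du x)).
  rewrite (_ : eta^-1 \*: _ = D u).
    by rewrite /GRing.scale/= mulrC.
  by apply/funext => y; rewrite /D/= mulrC.
have [g1 [d1 a1]] := window_average cf eta_gt0.
have c1 := is_derive_continuous d1.
have [g2 [d2 a2]] := window_average c1 eta_gt0.
have c2 := is_derive_continuous d2.
have [g3 [d3 a3]] := window_average c2 eta_gt0.
have c3 := is_derive_continuous d3.
have M1 x : `|g1 x| <= M by have [c _ ->] := a1 x.
have M2 x : `|g2 x| <= M by have [c _ ->] := a2 x.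
have M3 x : `|g3 x| <= M by have [c _ ->] := a3 x.
have e2 := dD _ _ d2; have e1 := dD _ _ (dD _ _ d1).
have b1 := DN _ _ M2; have b2 := DN _ _ (DN _ _ M1).
have b3 := DN _ _ (DN _ _ (DN _ _ fM)).
(* Each difference quotient [D] multiplies a bound by [2 / eta]: three of them make up the third
   derivative of [g3], one its first derivative. *)
exists (2 * (2 * (2 * M / eta) / eta) / eta), (2 * M / eta), g3; split=> //.
- split; first exact: continuous_bm M3.
  exists (D g2), (D (D g1)); split.
  + exact: (continuous_bm (is_derive_continuous e2) b1).
  + exact: (continuous_bm (is_derive_continuous e1) b2).
  + by move=> x h; apply: (taylor3 d3 e2 e1) => t _; exact: b3.
- move=> x y.
  have dsh (t : R) : is_derive t 1 (fun t => g3 (t + y)) (D g2 (t + y)).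
    rewrite (_ : (fun y => _) = g3 \o (id + cst y))//.
    have dl : is_derive t (1 : R) (id + cst y) (1 + 0) by apply: is_deriveD.
    have := @is_derive1_comp _ g3 (id + cst y) t _ _ (d3 (t + y)) dl.
    by rewrite addr0 mulr1.
  have := @mvt_bound _ _ _ (x - y) (2 * M / eta) dsh.
  by rewrite subrK add0r; apply => t _; exact: b1.
- move=> x xK; have [c /andP[xc cx] ->] := a3 x; have [c' /andP[xc' cx'] ->] := a2 c.
  have [c'' /andP[xc'' cx''] ->] := a1 c'.
  apply: fe => //; apply/andP; split.
    by rewrite (le_trans xc)// (le_trans xc').
  have -> : eta0 = eta + eta + eta by rewrite /eta; field.
  by lra.
Qed.

End smoothing.

(** * From smooth Lipschitz test functions to bounded continuous ones *)

Section weak_convergence.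
Context {d} {T : measurableType d} {R : realType}.
Variables (P : probability T R) (mu : probability R R).
Variables (W : nat -> T -> R) (B : R).
Hypothesis bW : forall n, bm (W n).
Hypothesis WB : forall n, \int[P]_x `|W n x| <= B.
Hypothesis imu : mu.-integrable setT (EFin \o (fun y : R => `|y|)).

(* Bounded first absolute moments provide the tightness needed to compare a
   test function with a smooth one that is close to it on a compact set only. *)
Lemma weak_cvg_taylor_class :
  (forall (C L : R) f, taylor_class C f -> (forall x y, `|f x - f y| <= L * `|x - y|) ->
    (\int[P]_x f (W n x) @[n --> \oo] --> \int[mu]_y f y)) ->
  forall f M, continuous f -> (forall x, `|f x| <= M) ->
    (\int[P]_x f (W n x) @[n --> \oo] --> \int[mu]_y f y).
Proof.
move=> H f M cf fM; have bf := continuous_bm cf fM.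
have M0 : 0 <= M by exact: le_trans (fM 0).
pose B' := Num.max B (\int[mu]_y `|y|).
have B'0 : 0 <= B'.
  by rewrite le_max; apply/orP; right; apply: Rintegral_ge0 => y _.
apply/cvgrPdist_le => e e0.
(* 5 = 1 + 2 + 2: one share for the convergence tested on [g], two for replacing [f] by [g] under
   each of the two laws. *)
pose e' := e / 5; have e'0 : 0 < e' by rewrite divr_gt0.
(* Large enough for the tail term [2 * M / K * B'] to be at most [e']; adding 1 keeps [K]
   positive. *)
pose K := 2 * M * B' / e' + 1.
have K0 : 0 < K.
  by rewrite ltr_wpDl// divr_ge0 ?(ltW e'0)// !mulr_ge0.
have [C [L [g [tg Lg gM gf]]]] := taylor_class_dense K cf fM e'0.
have [bg _] := tg.
(* Markov's inequality in pointwise form: beyond [K] the crude bound [2 * M] is at most [2 * M / K]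
   times |x|. *)
have ptw x : `|g x - f x| <= e' + 2 * M / K * `|x|.
  have [xK|Kx] := leP `|x| K.
    by rewrite (le_trans (gf x xK))// lerDl mulr_ge0// divr_ge0 ?mulr_ge0// ltW.
  rewrite (le_trans (ler_normB _ _))// (@le_trans _ _ (2 * M))//.
    by rewrite mulrDl !mul1r lerD.
  rewrite ler_wpDl ?(ltW e'0)// -mulrA ler_peMr ?mulr_ge0//.
  by rewrite mulrC ler_pdivlMr// mul1r ltW.
have BK : 2 * M / K * B' <= e'.
  rewrite mulrAC ler_pdivrMr// /K mulrDr mulr1 mulrCA divff ?gt_eqF// mulr1.
  by rewrite lerDl ltW.
have gfmu : `|\int[mu]_y g y - \int[mu]_y f y| <= 2 * e'.
  rewrite -bm_RintegralB// (le_trans (bm_norm_Rintegral_le _ (bmB bg bf)))//.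
  have ic : mu.-integrable setT (EFin \o (fun y : R => e')).
    by apply/bm_integrable/bm_cst.
  have il : mu.-integrable setT (EFin \o (fun y : R => 2 * M / K * `|y|)).
    exact: (integrableZl _ _ imu).
  apply: (@le_trans _ _ (\int[mu]_y (e' + 2 * M / K * `|y|))).
    apply: le_Rintegral => //.
    - by apply/bm_integrable/bm_norm/bmB.
    - exact: (integrableD _ ic il).
  rewrite RintegralD// Rintegral_probcst RintegralZl// (_ : 2 * e' = e' + e') ?lerD2l; last by ring.
  apply: le_trans BK; rewrite ler_wpM2l ?divr_ge0 ?mulr_ge0 ?(ltW K0)//.
  by rewrite le_max lexx orbT.
have gfW n : `|\int[P]_x g (W n x) - \int[P]_x f (W n x)| <= 2 * e'.
  have bgW := bm_comp (proj1 (bW n)) bg; have bfW := bm_comp (proj1 (bW n)) bf.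
  rewrite -bm_RintegralB// (le_trans (bm_norm_Rintegral_le _ (bmB bgW bfW)))//.
  have b1 := bmZ (2 * M / K) (bm_norm (bW n)); have b2 := bm_cst (T := T) e'.
  apply: (@le_trans _ _ (\int[P]_y (e' + 2 * M / K * `|W n y|))).
    apply: bm_le_Rintegral => //.
    - exact/bm_norm/bmB.
    - exact: bmD.
  rewrite bm_RintegralD// Rintegral_probcst bm_RintegralZl; last exact: bm_norm.
  rewrite (_ : 2 * e' = e' + e') ?lerD2l; last by ring.
  apply: le_trans BK; rewrite ler_wpM2l ?divr_ge0 ?mulr_ge0 ?(ltW K0)//.
  by rewrite le_max WB.
have /cvgrPdist_le/(_ _ e'0) := H C L g tg Lg.
apply: filterS => n gn.
have -> : \int[mu]_y f y - \int[P]_x f (W n x) =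
  (\int[mu]_y g y - \int[P]_x g (W n x)) - (\int[mu]_y g y - \int[mu]_y f y) +
  (\int[P]_x g (W n x) - \int[P]_x f (W n x)) by ring.
rewrite (le_trans (ler_normD _ _))//.
have -> : e = (e' + 2 * e') + 2 * e' by rewrite /e'; field.
by rewrite lerD// (le_trans (ler_normB _ _))// lerD.
Qed.

End weak_convergence.

(** * Second moment of a centred sum *)

Section sample_mean.
Context {d d'} {T : measurableType d} {E : measurableType d'} {R : realType}.
Variables (P : probability T R) (Z : nat -> T -> E).
Hypothesis mZ : forall i, measurable_fun setT (Z i).
Hypothesis iidZ : iid P Z.

(** Off-diagonal products have mean zero by pairwise independence and centring. *)
Lemma psum_sqr (g : E -> R) n : bm g -> \int[P]_x g (Z 0%N x) = 0 ->
  \int[P]_x (psum Z g n x ^+ 2) = n%:R * \int[P]_x (g (Z 0%N x) ^+ 2).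
Proof.
move=> bg g0.
have bgZ i : bm (fun x => g (Z i x)) by exact: (bm_comp (mZ i) bg).
transitivity (\int[P]_x \sum_(i < n) \sum_(j < n) g (Z i x) * g (Z j x)).
  by apply: eq_Rintegral => x _; rewrite expr2 /psum big_distrlr.
rewrite bm_Rintegral_sum; last by move=> i; apply: bm_sum => j; exact: bmM.
transitivity (\sum_(i < n) \int[P]_x (g (Z 0%N x) ^+ 2)); last first.
  by rewrite sumr_const card_ord mulr_natl.
apply: eq_bigr => i _; rewrite bm_Rintegral_sum; last by move=> j; exact: bmM.
rewrite (bigD1 i)//= big1 ?addr0.
  rewrite -(identically_distributed_Rintegral mZ iidZ i (bmX 2 bg)).
  by apply: eq_Rintegral => x _; rewrite expr2.
move=> j ji; pose F (z : E * E) := g z.1 * g z.2.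
have bF : bm F.
  apply: bmM; first exact: (bm_comp measurable_fst bg).
  exact: (bm_comp measurable_snd bg).
have ij : (i : nat) != j by rewrite eq_sym.
have iUV A B := @indep_pair _ _ _ _ _ P Z (proj1 iidZ) i j A B ij.
have e := indep_Rintegral (mZ i) (mZ j) iUV bF.
rewrite [LHS]e /F/=.
under eq_Rintegral do rewrite bm_RintegralZl// (identically_distributed_Rintegral mZ iidZ _ bg) g0 mulr0.
exact: Rintegral_probcst.
Qed.

End sample_mean.

(** * The independence distance as a function of means *)

Lemma measurable_dotv2 {R : realType} n d (T : measurableType d) (f g : T -> n.-tuple R) :
  measurable_fun setT f -> measurable_fun setT g ->
  measurable_fun setT (fun x => dotv (f x) (g x)).
Proof.
move=> mf mg; apply: measurable_sum => i; apply: measurable_funM.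
  exact: (measurableT_comp (measurable_tnth i) mf).
exact: (measurableT_comp (measurable_tnth i) mg).
Qed.

(** * The kernels as means of cosines *)

Section characteristic_kernel.
Context {R : realType} {n : nat}.
Variables (w : n.-tuple R -> R) (nu : probability (n.-tuple R) R).
Hypothesis wE : forall t, charw w t = \int[nu]_s cos (dotv t s).
Hypothesis nuN : forall f : n.-tuple R -> R, bm f ->
  \int[nu]_x f (oppv x) = \int[nu]_x f x.

Lemma charw_subv x x' : charw w (subv x x') = \int[nu]_s cos (dotv s x - dotv s x').
Proof.
by rewrite wE; apply: eq_Rintegral => s _; rewrite dotvBl (dotvC x) (dotvC x').
Qed.

Lemma charw_subvC x x' : charw w (subv x x') = charw w (subv x' x).
Proof. by rewrite !charw_subv; apply: eq_Rintegral => s _; rewrite -cosN opprB. Qed.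

Lemma measurable_dotvB x x' : measurable_fun setT (fun s : n.-tuple R => dotv s x - dotv s x').
Proof.
under eq_fun do rewrite (dotvC _ x) (dotvC _ x').
by apply: measurable_funB; exact: measurable_dotv.
Qed.

Lemma charw_subv_le1 x x' : `|charw w (subv x x')| <= 1.
Proof.
rewrite charw_subv; apply: norm_Rintegral_le; first exact: (bm_cos (measurable_dotvB x x')).
by move=> s; rewrite ler_norml cos_geN1 cos_le1.
Qed.

Lemma bm_charw_subv : bm (fun v : n.-tuple R * n.-tuple R => charw w (subv v.1 v.2)).
Proof.
pose F (v : (n.-tuple R * n.-tuple R) * n.-tuple R) :=
  cos (dotv v.2 v.1.1 - dotv v.2 v.1.2).
have bF : bm F.
  apply: bm_cos; apply: measurable_funB.
    apply: measurable_dotv2; first exact: measurable_snd.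
    exact: (measurableT_comp measurable_fst measurable_fst).
  apply: measurable_dotv2; first exact: measurable_snd.
  exact: (measurableT_comp measurable_snd measurable_fst).
have := bm_Rintegral2 (nu \x nu)%E nu bF.
by congr bm; apply/funext => v; rewrite charw_subv.
Qed.

(** The sine is odd and [nu] is symmetric. *)
Lemma Rintegral_sin_dotvB x x' : \int[nu]_s sin (dotv s x - dotv s x') = 0.
Proof.
pose f (s : n.-tuple R) := sin (dotv s x - dotv s x').
have bf : bm f by exact: (bm_sin (measurable_dotvB x x')).
have fN s : f (oppv s) = -1 * f s.
  by rewrite /f !(dotvC (oppv s)) !dotvN mulN1r -sinN opprD !opprK !(dotvC s).
have e1 : \int[nu]_s f (oppv s) = \int[nu]_s (-1 * f s).
  by apply: eq_Rintegral => s _; exact: fN.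
have := nuN bf; rewrite e1 bm_RintegralZl// -/f => e; lra.
Qed.

End characteristic_kernel.

Section features.
Context {R : realType} {p q : nat}.
Local Notation E := (p.-tuple R * q.-tuple R)%type.
Implicit Types (w z : E).

(* The frequency [w] tests the observation [z] through the real and imaginary
   parts of the joint exponential (0, 1), of the first-marginal one (2, 3) and
   of the second-marginal one (4, 5). *)
Definition feat (k : nat) w z : R :=
  match k with
  | 0 => cos (dotv w.1 z.1 + dotv w.2 z.2)
  | 1 => sin (dotv w.1 z.1 + dotv w.2 z.2)
  | 2 => cos (dotv w.1 z.1)
  | 3 => sin (dotv w.1 z.1)
  | 4 => cos (dotv w.2 z.2)
  | _ => sin (dotv w.2 z.2)
  end.

Lemma feat_le1 k w z : `|feat k w z| <= 1.
Proof.
by case: k => [|[|[|[|[|k]]]]] /=; rewrite ler_norml ?cos_geN1 ?cos_le1 ?sin_geN1 ?sin_le1.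
Qed.

Lemma bm_feat k : bm (fun v : E * E => feat k v.1 v.2).
Proof.
have m1 : measurable_fun setT (fun v : E * E => dotv v.1.1 v.2.1).
  apply: measurable_dotv2; first exact: (measurableT_comp measurable_fst measurable_fst).
  exact: (measurableT_comp measurable_fst measurable_snd).
have m2 : measurable_fun setT (fun v : E * E => dotv v.1.2 v.2.2).
  apply: measurable_dotv2; first exact: (measurableT_comp measurable_snd measurable_fst).
  exact: (measurableT_comp measurable_snd measurable_snd).
case: k => [|[|[|[|[|k]]]]] /=.
- by apply: bm_cos; exact: measurable_funD.
- by apply: bm_sin; exact: measurable_funD.
- exact: bm_cos.
- exact: bm_sin.
- exact: bm_cos.
- exact: bm_sin.
Qed.

Variables (wp : p.-tuple R -> R) (wq : q.-tuple R -> R).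
Variables (nup : probability (p.-tuple R) R) (nuq : probability (q.-tuple R) R).
Hypothesis wpE : forall t, charw wp t = \int[nup]_s cos (dotv t s).
Hypothesis wqE : forall t, charw wq t = \int[nuq]_s cos (dotv t s).
Hypothesis nupN : forall f : p.-tuple R -> R, bm f ->
  \int[nup]_x f (oppv x) = \int[nup]_x f x.

(** A product of cosines is the cosine of the sum plus a product of sines, and the latter integrates
    to zero by symmetry. Thus features 0 and 1 form a feature map for the product kernel. *)
Lemma charw_kernel (z z1 : E) :
  charw wp (subv z.1 z1.1) * charw wq (subv z.2 z1.2) =
  \int[(nup \x nuq)%E]_w (feat 0 w z * feat 0 w z1 + feat 1 w z * feat 1 w z1).
Proof.
have bF : bm (fun w => feat 0 w z * feat 0 w z1 + feat 1 w z * feat 1 w z1).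
  by apply: bmD; apply: bmM; exact: (bm_pair1 _ (bm_feat _)).
rewrite [RHS](bm_Rintegral_prod _ _ bF) (charw_subv wpE) (charw_subv wqE).
have bcp := bm_cos (measurable_dotvB z.1 z1.1).
have bsp := bm_sin (measurable_dotvB z.1 z1.1).
have bcq := bm_cos (measurable_dotvB z.2 z1.2).
have bsq := bm_sin (measurable_dotvB z.2 z1.2).
rewrite -bm_RintegralZr//.
transitivity (\int[nup]_s (cos (dotv s z.1 - dotv s z1.1) *
    (\int[nuq]_t cos (dotv t z.2 - dotv t z1.2)) -
    sin (dotv s z.1 - dotv s z1.1) * (\int[nuq]_t sin (dotv t z.2 - dotv t z1.2)))).
  rewrite bm_RintegralB; [|apply: bmM => //; exact: bm_cst..].
  by rewrite [X in _ = _ - X]bm_RintegralZr// (Rintegral_sin_dotvB nupN) mul0r subr0.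
apply: eq_Rintegral => s _; rewrite -!bm_RintegralZl// -bm_RintegralB; [|exact: bmZ..].
apply: eq_Rintegral => t _ /=.
rewrite -cosD -cosB; congr cos; ring.
Qed.

End features.

(** * Second-order expansion of the squared gap *)

Section gap_expansion.
Context {R : realType}.
Implicit Types f h : nat -> R.

(** With the indexing of [feat], [f] encodes three complex numbers (0, 1), (2, 3), (4, 5). [gap_re]
    and [gap_im] are the two parts of the first minus the product of the others; [dgap_re] and
    [dgap_im] are their differentials at [f] in the direction [h]. *)
Definition gap_re f : R := f 0%N - (f 2%N * f 4%N - f 3%N * f 5%N).
Definition gap_im f : R := f 1%N - (f 2%N * f 5%N + f 3%N * f 4%N).
Definition dgap_re f h : R :=
  h 0%N - (h 2%N * f 4%N + f 2%N * h 4%N - h 3%N * f 5%N - f 3%N * h 5%N).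
Definition dgap_im f h : R :=
  h 1%N - (h 2%N * f 5%N + f 2%N * h 5%N + h 3%N * f 4%N + f 3%N * h 4%N).

Lemma sqr_sum5 (a b c x y : R) :
  (a + b + c + x + y) ^+ 2 <= 5 * (a ^+ 2 + b ^+ 2 + c ^+ 2 + x ^+ 2 + y ^+ 2).
Proof.
rewrite -subr_ge0 [leRHS](_ : _ = (a - b) ^+ 2 + (a - c) ^+ 2 + (a - x) ^+ 2 + (a - y) ^+ 2 +
  (b - c) ^+ 2 + (b - x) ^+ 2 + (b - y) ^+ 2 + (c - x) ^+ 2 + (c - y) ^+ 2 + (x - y) ^+ 2).
  by rewrite !addr_ge0 ?sqr_ge0.
by ring.
Qed.

Lemma sqrM_le1 (a b : R) : `|b| <= 1 -> (a * b) ^+ 2 <= a ^+ 2.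
Proof.
move=> b1; rewrite exprMn ler_piMr ?sqr_ge0//.
by rewrite -real_normK ?num_real// expr_le1.
Qed.

Lemma normM_half_sqr (a b : R) : `|a * b| <= (a ^+ 2 + b ^+ 2) / 2.
Proof.
rewrite ler_pdivlMr// -subr_ge0 -(real_normK (num_real a)) -(real_normK (num_real b)).
by rewrite normrM [leRHS](_ : _ = (`|a| - `|b|) ^+ 2) ?sqr_ge0//; ring.
Qed.

(** Here [a] is a gap, [l] its linear increment and [r] the bilinear rest. The constant is 21 = 10 +
    8 + 3, from [2 * l ^+ 2], [2 * r ^+ 2] and [2 * a * r]. *)
Lemma quadratic_remainder (a l r S : R) :
  `|a| <= 3 -> l ^+ 2 <= 5 * S -> `|r| <= S / 2 -> `|r| <= 8 ->
  `|(a + l - r) ^+ 2 - a ^+ 2 - 2 * a * l| <= 21 * S.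
Proof.
move=> a3 lS rS r8.
have -> : (a + l - r) ^+ 2 - a ^+ 2 - 2 * a * l = (l - r) ^+ 2 - 2 * (a * r) by ring.
have e1 : (l - r) ^+ 2 <= 2 * l ^+ 2 + 2 * r ^+ 2.
  rewrite -subr_ge0 [leRHS](_ : _ = (l + r) ^+ 2) ?sqr_ge0//; ring.
have e2 : r ^+ 2 <= 8 * (S / 2).
  by rewrite -(real_normK (num_real r)) expr2 ler_pM.
have e3 : `|a * r| <= 3 * (S / 2) by rewrite normrM ler_pM.
have n1 : `|(l - r) ^+ 2| = (l - r) ^+ 2 by rewrite ger0_norm ?sqr_ge0.
have n2 : `|2 * (a * r)| = 2 * `|a * r| by rewrite normrM ger0_norm.
by rewrite (le_trans (ler_normB _ _))// n1 n2; lra.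
Qed.

(* Each of the two squares contributes [21 * S] by [quadratic_remainder]. *)
Lemma gap_expansion f h :
  (forall k, `|f k| <= 1) -> (forall k, `|h k| <= 2) ->
  `|gap_re (fun k => f k + h k) ^+ 2 + gap_im (fun k => f k + h k) ^+ 2
    - (gap_re f ^+ 2 + gap_im f ^+ 2)
    - (2 * gap_re f * dgap_re f h + 2 * gap_im f * dgap_im f h)|
  <= 42 * \sum_(k < 6) h k ^+ 2.
Proof.
move=> f1 h2; set S := \sum_(k < 6) _.
have SE : S = h 0%N ^+ 2 + h 1%N ^+ 2 + h 2%N ^+ 2 + h 3%N ^+ 2 + h 4%N ^+ 2 + h 5%N ^+ 2.
  by rewrite /S !big_ord_recr/= big_ord0 add0r.
have sq k : 0 <= h k ^+ 2 by exact: sqr_ge0.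
have fM i j : `|f i * f j| <= 1 by rewrite normrM mulr_ile1.
have hM i j : `|h i * h j| <= 4.
  by rewrite normrM (le_trans (ler_pM _ _ (h2 i) (h2 j)))// -natrM.
have a3 i j k l m : `|f i - (f j * f k - f l * f m)| <= 3.
  rewrite (le_trans (ler_normB _ _))// (_ : 3 = 1 + (1 + 1)); last by ring.
  by rewrite lerD// (le_trans (ler_normB _ _))// lerD.
have a3' i j k l m : `|f i - (f j * f k + f l * f m)| <= 3.
  rewrite (le_trans (ler_normB _ _))// (_ : 3 = 1 + (1 + 1)); last by ring.
  by rewrite lerD// (le_trans (ler_normD _ _))// lerD.
have sM i j := sqrM_le1 (h i) (f1 j).
have lre : dgap_re f h ^+ 2 <= 5 * S.
  have := sqr_sum5 (h 0%N) (- (h 2%N * f 4%N)) (- (h 4%N * f 2%N)) (h 3%N * f 5%N) (h 5%N * f 3%N).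
  rewrite !sqrrN (_ : _ + _ = dgap_re f h); last by rewrite /dgap_re; ring.
  have := sM 2%N 4%N; have := sM 4%N 2%N; have := sM 3%N 5%N; have := sM 5%N 3%N.
  by have := sq 1%N; rewrite SE; lra.
have lim : dgap_im f h ^+ 2 <= 5 * S.
  have := sqr_sum5 (h 1%N) (- (h 2%N * f 5%N)) (- (h 5%N * f 2%N)) (- (h 3%N * f 4%N))
    (- (h 4%N * f 3%N)).
  rewrite !sqrrN (_ : _ + _ = dgap_im f h); last by rewrite /dgap_im; ring.
  have := sM 2%N 5%N; have := sM 5%N 2%N; have := sM 3%N 4%N; have := sM 4%N 3%N.
  by have := sq 0%N; rewrite SE; lra.
have nh i j := normM_half_sqr (h i) (h j).
have rre : `|h 2%N * h 4%N - h 3%N * h 5%N| <= S / 2.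
  rewrite (le_trans (ler_normB _ _))//.
  by have := nh 2%N 4%N; have := nh 3%N 5%N; have := sq 0%N; have := sq 1%N; rewrite SE; lra.
have rim : `|h 2%N * h 5%N + h 3%N * h 4%N| <= S / 2.
  rewrite (le_trans (ler_normD _ _))//.
  by have := nh 2%N 5%N; have := nh 3%N 4%N; have := sq 0%N; have := sq 1%N; rewrite SE; lra.
have rre8 : `|h 2%N * h 4%N - h 3%N * h 5%N| <= 8.
  by rewrite (le_trans (ler_normB _ _))// (_ : 8 = 4 + 4) ?lerD//; ring.
have rim8 : `|h 2%N * h 5%N + h 3%N * h 4%N| <= 8.
  by rewrite (le_trans (ler_normD _ _))// (_ : 8 = 4 + 4) ?lerD//; ring.
have q1 := quadratic_remainder (a3 0%N 2%N 4%N 3%N 5%N) lre rre rre8.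
have q2 := quadratic_remainder (a3' 1%N 2%N 5%N 3%N 4%N) lim rim rim8.
(* The gap is quadratic in its argument, so beyond the differential there is exactly one bilinear
   term. *)
have -> : gap_re (fun k => f k + h k) =
    gap_re f + dgap_re f h - (h 2%N * h 4%N - h 3%N * h 5%N).
  by rewrite /gap_re /dgap_re; ring.
have -> : gap_im (fun k => f k + h k) =
    gap_im f + dgap_im f h - (h 2%N * h 5%N + h 3%N * h 4%N).
  by rewrite /gap_im /dgap_im; ring.
rewrite -/(gap_re f) in q1; rewrite -/(gap_im f) in q2.
move: q1 q2; set r1 := _ - h 3%N * _; set r2 := _ + h 3%N * _ => q1 q2.
rewrite [X in `|X|](_ : _ =
  ((gap_re f + dgap_re f h - r1) ^+ 2 - gap_re f ^+ 2 - 2 * gap_re f * dgap_re f h) +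
  ((gap_im f + dgap_im f h - r2) ^+ 2 - gap_im f ^+ 2 - 2 * gap_im f * dgap_im f h)).
  by rewrite (le_trans (ler_normD _ _))// (_ : 42 * S = 21 * S + 21 * S) ?lerD//; ring.
by ring.
Qed.

End gap_expansion.

(** * From U-statistics to V-statistics *)

Section diagonal_terms.
Context {R : realType}.

(** [S] is a full sum with normalization [N], [S'] the restricted sum with normalization [N']. The
    two terms of the bound pay for the omitted summands and for the change of normalization. *)
Lemma normalization_change (S S' N N' c : R) : 0 < N' -> N' <= N ->
  `|S| <= N -> `|S - S'| <= c -> `|N'^-1 * S' - N^-1 * S| <= c / N' + (N / N' - 1).
Proof.
move=> N'0 N'N SN SS'; have N0 : 0 < N by exact: lt_le_trans N'N.
have -> : N'^-1 * S' - N^-1 * S = - ((S - S') / N') + S * (N'^-1 - N^-1) by ring.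
rewrite (le_trans (ler_normD _ _))// normrN lerD//.
  by rewrite normrM normfV (gtr0_norm N'0) ler_wpM2r// invr_ge0 ltW.
have d0 : 0 <= N'^-1 - N^-1 by rewrite subr_ge0 lef_pV2.
rewrite normrM (ger0_norm d0) (@le_trans _ _ (N * (N'^-1 - N^-1)))//.
  by rewrite ler_wpM2r.
by rewrite mulrBr divff ?gt_eqF.
Qed.

Lemma sum_norm_le n (a : 'I_n -> R) (c : R) :
  (forall i, `|a i| <= c) -> `|\sum_(i < n) a i| <= n%:R * c.
Proof.
move=> ac; rewrite (le_trans (ler_norm_sum _ _ _))//.
apply: (@le_trans _ _ (\sum_(i < n) c)); first by apply: ler_sum => i _.
by rewrite sumr_const card_ord mulr_natl.
Qed.

Lemma natr_ge3 n : (3 <= n)%N -> 3 <= n%:R :> R.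
Proof. by move=> n3; rewrite ler_nat. Qed.

(** Dropping [n] diagonal terms and renormalizing costs [2 / (n - 1)], which is at most [3 / n] from
    [n = 3] on. *)
Lemma pair_diagonal n (a : 'I_n -> 'I_n -> R) : (3 <= n)%N ->
  (forall i j, `|a i j| <= 1) ->
  `|(n * (n - 1))%:R^-1 * \sum_(i < n) \sum_(j < n | i != j) a i j
    - (n%:R ^+ 2)^-1 * \sum_(i < n) \sum_(j < n) a i j| <= 3 / n%:R.
Proof.
move=> n3 a1; have := natr_ge3 n3.
rewrite natrM natrB ?(leq_trans _ n3)//; set N : R := n%:R => N3.
have N0 : 0 < N by lra.
have N10 : 0 < N - 1 by lra.
have sN : `|\sum_(i < n) \sum_(j < n) a i j| <= N ^+ 2.
  rewrite expr2; apply: sum_norm_le => i.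
  by rewrite -[leRHS]mulr1; exact: sum_norm_le.
have dN : `|\sum_(i < n) \sum_(j < n) a i j - \sum_(i < n) \sum_(j < n | i != j) a i j| <= N.
  rewrite -sumrB -[leRHS]mulr1; apply: sum_norm_le => i.
  rewrite (bigD1 i)//= (eq_bigl (fun j => i != j)); last by move=> j; rewrite eq_sym.
  by rewrite addrK.
have NN : N * (N - 1) <= N ^+ 2 by rewrite expr2 ler_wpM2l ?(ltW N0)// gerBl.
have NN0 : 0 < N * (N - 1) by exact: mulr_gt0.
rewrite (le_trans (normalization_change NN0 NN sN dN))//.
have -> : N / (N * (N - 1)) + (N ^+ 2 / (N * (N - 1)) - 1) = 2 / (N - 1).
  by field; rewrite !gt_eqF.
by rewrite ler_pdivrMr// mulrAC ler_pdivlMr//; lra.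
Qed.

(** The cost is [(6 * n - 2) / ((n - 1) * (n - 2))], at most [27 / n] from [n = 3] on. *)
Lemma triple_diagonal n (a : 'I_n -> 'I_n -> 'I_n -> R) : (3 <= n)%N ->
  (forall i j k, `|a i j k| <= 1) ->
  `|(n * (n - 1) * (n - 2))%:R^-1 *
      \sum_(i < n) \sum_(j < n) \sum_(k < n | [&& i != j, i != k & j != k]) a i j k
    - (n%:R ^+ 3)^-1 * \sum_(i < n) \sum_(j < n) \sum_(k < n) a i j k| <= 27 / n%:R.
Proof.
move=> n3 a1; have := natr_ge3 n3.
rewrite !natrM !natrB ?(leq_trans _ n3)//; set N : R := n%:R => N3.
have N0 : 0 < N by lra.
have N10 : 0 < N - 1 by lra.
have N20 : 0 < N - 2 by lra.
have sN : `|\sum_(i < n) \sum_(j < n) \sum_(k < n) a i j k| <= N ^+ 3.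
  rewrite exprS; apply: sum_norm_le => i; rewrite expr2; apply: sum_norm_le => j.
  by rewrite -[leRHS]mulr1; exact: sum_norm_le.
(* Counts coincidences among the three indices; it is at least 1 on every omitted triple. *)
pose chi (i j k : 'I_n) : R := (i == j)%:R + (i == k)%:R + (j == k)%:R.
have sumd (i : 'I_n) : \sum_(j < n) (i == j)%:R = 1 :> R.
  by rewrite (bigD1 i)//= eqxx big1 ?addr0// => j /negbTE; rewrite eq_sym => ->.
have schi : \sum_(i < n) \sum_(j < n) \sum_(k < n) chi i j k = 3 * N ^+ 2.
  transitivity (\sum_(i < n) \sum_(j < n) (N * (i == j)%:R + 2)).
    apply: eq_bigr => i _; apply: eq_bigr => j _.
    rewrite !big_split/= !sumd sumr_const card_ord -mulr_natl -/N; ring.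
  transitivity (\sum_(i < n) (3 * N)).
    apply: eq_bigr => i _; rewrite big_split/= -mulr_sumr sumd sumr_const card_ord.
    by rewrite -mulr_natl -/N; ring.
  by rewrite sumr_const card_ord -mulr_natl -/N; ring.
have dN : `|\sum_(i < n) \sum_(j < n) \sum_(k < n) a i j k -
  \sum_(i < n) \sum_(j < n) \sum_(k < n | [&& i != j, i != k & j != k]) a i j k| <= 3 * N ^+ 2.
  rewrite -schi -sumrB (le_trans (ler_norm_sum _ _ _))//; apply: ler_sum => i _.
  rewrite -sumrB (le_trans (ler_norm_sum _ _ _))//; apply: ler_sum => j _.
  rewrite [X in _ - X]big_mkcond -sumrB (le_trans (ler_norm_sum _ _ _))//.
  apply: ler_sum => k _; rewrite /chi.
  have := a1 i j k.
  case: eqP => _; case: eqP => _; case: eqP => _ /=; rewrite ?subr0 ?subrr ?normr0//; lra.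
have NN0 : 0 < N * (N - 1) * (N - 2) by rewrite !mulr_gt0.
have NN : N * (N - 1) * (N - 2) <= N ^+ 3.
  by rewrite exprS expr2 mulrA !ler_pM ?mulr_ge0 ?(ltW N0) ?(ltW N10) ?(ltW N20) ?gerBl.
rewrite (le_trans (normalization_change NN0 NN sN dN))//.
have -> : 3 * N ^+ 2 / (N * (N - 1) * (N - 2)) + (N ^+ 3 / (N * (N - 1) * (N - 2)) - 1) =
    (6 * N - 2) / ((N - 1) * (N - 2)).
  by field; rewrite !gt_eqF.
rewrite ler_pdivrMr ?mulr_gt0// mulrAC ler_pdivlMr//; nra.
Qed.

End diagonal_terms.

(** * The V-statistic as the squared gap of the empirical law *)

Section empirical_gap.
Context {R : realType} {p q : nat}.
Local Notation E := (p.-tuple R * q.-tuple R)%type.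
Variables (wp : p.-tuple R -> R) (wq : q.-tuple R -> R).
Variables (nup : probability (p.-tuple R) R) (nuq : probability (q.-tuple R) R).
Hypothesis wpE : forall t, charw wp t = \int[nup]_s cos (dotv t s).
Hypothesis wqE : forall t, charw wq t = \int[nuq]_s cos (dotv t s).
Hypothesis nupN : forall f : p.-tuple R -> R, bm f ->
  \int[nup]_x f (oppv x) = \int[nup]_x f x.
Local Notation m := (nup \x nuq)%E.
Local Notation Cp z z1 := (charw wp (subv z.1 z1.1)).
Local Notation Cq z z1 := (charw wq (subv z.2 z1.2)).

Lemma bm_featl k (z : E) : bm (fun w : E => feat k w z).
Proof. exact: (bm_pair1 z (bm_feat k)). Qed.

Lemma charw_kernel_sum (I J : finType) (e : I -> E) (e' : J -> E) :
  \int[m]_w ((\sum_a feat 0 w (e a)) * (\sum_b feat 0 w (e' b)) +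
             (\sum_a feat 1 w (e a)) * (\sum_b feat 1 w (e' b))) =
  \sum_a \sum_b Cp (e a) (e' b) * Cq (e a) (e' b).
Proof.
have bab a b : bm (fun w => feat 0 w (e a) * feat 0 w (e' b) + feat 1 w (e a) * feat 1 w (e' b)).
  by apply: bmD; apply: bmM; exact: bm_featl.
transitivity (\int[m]_w \sum_a \sum_b
    (feat 0 w (e a) * feat 0 w (e' b) + feat 1 w (e a) * feat 1 w (e' b))).
  apply: eq_Rintegral => w _; rewrite !big_distrlr/= -big_split/=.
  by apply: eq_bigr => a _; rewrite -big_split.
rewrite bm_Rintegral_sum; last by move=> a; apply: bm_sum => b; exact: bab.
apply: eq_bigr => a _; rewrite bm_Rintegral_sum; last by move=> b; exact: bab.
by apply: eq_bigr => b _; rewrite (charw_kernel wpE wqE nupN).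
Qed.

Definition emean n (z : 'I_n -> E) (w : E) k : R := n%:R^-1 * \sum_(i < n) feat k w (z i).

(** By the addition formulas, the product of the empirical marginals is the mean of the joint
    features over the [n ^ 2] recombined points [e2]. Expanding the square with [charw_kernel_sum]
    pairs the sample with itself, the recombined points with themselves, and the two with each
    other. *)
Lemma empirical_gapE n (z : 'I_n -> E) :
  \int[m]_w (gap_re (emean z w) ^+ 2 + gap_im (emean z w) ^+ 2) =
  (n%:R ^+ 2)^-1 * (\sum_(i < n) \sum_(j < n) Cp (z i) (z j) * Cq (z i) (z j)) +
  ((n%:R ^+ 2)^-1 * (\sum_(i < n) \sum_(j < n) Cp (z i) (z j))) *
  ((n%:R ^+ 2)^-1 * (\sum_(i < n) \sum_(j < n) Cq (z i) (z j))) -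
  2 * ((n%:R ^+ 3)^-1 * (\sum_(i < n) \sum_(j < n) \sum_(k < n)
     Cp (z i) (z j) * Cq (z i) (z k))).
Proof.
set N : R := n%:R.
pose e2 (a : 'I_n * 'I_n) : E := ((z a.1).1, (z a.2).2).
pose cc k w := \sum_i feat k w (z i).
pose uu k w := \sum_a feat k w (e2 a).
pose Q k l w := cc k w * cc l w.
have bcc k : bm (cc k) by apply: bm_sum => i; exact: bm_featl.
have buu k : bm (uu k) by apply: bm_sum => i; exact: bm_featl.
have hN a b : N^-1 * a * (N^-1 * b) = (N ^+ 2)^-1 * (a * b).
  by rewrite mulrACA -invfM -expr2.
have reE w : gap_re (emean z w) = N^-1 * cc 0%N w - (N ^+ 2)^-1 * uu 0%N w.
  rewrite /gap_re /emean -/N; congr (_ - _).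
  rewrite /uu -(pair_big xpredT xpredT (fun i j => feat 0 w ((z i).1, (z j).2)))/=.
  rewrite !hN -mulrBr !big_distrlr/= -sumrB; congr (_ * _).
  by apply: eq_bigr => i _; rewrite -sumrB; apply: eq_bigr => j _; rewrite cosD.
have imE w : gap_im (emean z w) = N^-1 * cc 1%N w - (N ^+ 2)^-1 * uu 1%N w.
  rewrite /gap_im /emean -/N; congr (_ - _).
  rewrite /uu -(pair_big xpredT xpredT (fun i j => feat 1 w ((z i).1, (z j).2)))/=.
  rewrite !hN -mulrDr !big_distrlr/= -big_split; congr (_ * _).
  by apply: eq_bigr => i _; rewrite -big_split; apply: eq_bigr => j _; rewrite /= sinD addrC.
pose q1 w := cc 0%N w * cc 0%N w + cc 1%N w * cc 1%N w.
pose q2 w := uu 0%N w * uu 0%N w + uu 1%N w * uu 1%N w.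
pose q3 w := cc 0%N w * uu 0%N w + cc 1%N w * uu 1%N w.
have bq1 : bm q1 by apply: bmD; apply: bmM.
have bq2 : bm q2 by apply: bmD; apply: bmM.
have bq3 : bm q3 by apply: bmD; apply: bmM.
transitivity (\int[m]_w ((N ^+ 2)^-1 * q1 w + (N ^+ 4)^-1 * q2 w - 2 * (N ^+ 3)^-1 * q3 w)).
  apply: eq_Rintegral => w _; rewrite reE imE /q1 /q2 /q3.
  by move: N^-1 (exprVn N) => M MV; rewrite -!MV; ring.
rewrite bm_RintegralB ?bm_RintegralD ?bm_RintegralZl//; [|exact: bmZ..|apply: bmD; exact: bmZ|exact: bmZ].
rewrite /q1 charw_kernel_sum /q2 charw_kernel_sum /q3 charw_kernel_sum.
congr (_ + _ - _).
- rewrite mulrACA -invfM -exprD; congr (_ * _).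
  rewrite big_distrlr/= [RHS]pair_big/=; apply: eq_bigr => a _.
  by rewrite big_distrlr/= pair_big/=; apply: eq_bigr => b _.
- rewrite mulrA; congr (_ * _); apply: eq_bigr => a _.
  by rewrite pair_big/=; apply: eq_bigr => b _.
Qed.

End empirical_gap.

Section dgap_linearity.
Context {R : realType}.
Implicit Types f : nat -> R.

Lemma dgap_re_sum f n (h : 'I_n -> nat -> R) (a : R) :
  dgap_re f (fun k => a * \sum_(i < n) h i k) = a * \sum_(i < n) dgap_re f (h i).
Proof.
rewrite /dgap_re !(sumrB, big_split)/= -!mulr_suml -!mulr_sumr; ring.
Qed.

Lemma dgap_im_sum f n (h : 'I_n -> nat -> R) (a : R) :
  dgap_im f (fun k => a * \sum_(i < n) h i k) = a * \sum_(i < n) dgap_im f (h i).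
Proof.
rewrite /dgap_im !(sumrB, big_split)/= -!mulr_suml -!mulr_sumr; ring.
Qed.

Context {d} {T : measurableType d} (P : probability T R).
Variables (f : nat -> R) (h : T -> nat -> R).
Hypothesis bh : forall k, bm (h^~ k).

Let bl a k : bm (fun x => h x k * a). Proof. by apply: bmM => //; exact: bm_cst. Qed.
Let br a k : bm (fun x => a * h x k). Proof. exact: bmZ. Qed.

Lemma Rintegral_dgap_re :
  \int[P]_x dgap_re f (h x) = dgap_re f (fun k => \int[P]_x h x k).
Proof.
rewrite /dgap_re !(bm_RintegralB, bm_RintegralD, bm_RintegralZl, bm_RintegralZr)//.
all: by do ?[apply: bmB|apply: bmD|by []].
Qed.

Lemma Rintegral_dgap_im :
  \int[P]_x dgap_im f (h x) = dgap_im f (fun k => \int[P]_x h x k).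
Proof.
rewrite /dgap_im !(bm_RintegralB, bm_RintegralD, bm_RintegralZl, bm_RintegralZr)//.
all: by do ?[apply: bmB|apply: bmD|by []].
Qed.

End dgap_linearity.

(** * Linearization of the empirical distance *)

Section independence_gap.
Context {R : realType} {d} {T : measurableType d} (P : probability T R) {p q : nat}.
Local Notation E := (p.-tuple R * q.-tuple R)%type.
Variables (Z : nat -> T -> E).
Hypothesis mZ : forall i, measurable_fun setT (Z i).
Hypothesis iidZ : iid P Z.
Variables (nup : probability (p.-tuple R) R) (nuq : probability (q.-tuple R) R).
Local Notation m := (nup \x nuq)%E.

Definition fmean (w : E) (k : nat) : R := \int[P]_x feat k w (Z 0%N x).
Definition fdev (w z : E) (k : nat) : R := feat k w z - fmean w k.
Definition gap2 : R := \int[m]_w (gap_re (fmean w) ^+ 2 + gap_im (fmean w) ^+ 2).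
(** The derivative of the functional [gap2] at the law of the data, in the direction of a unit mass
    at [z]. *)
Definition influence (z : E) : R :=
  \int[m]_w (2 * gap_re (fmean w) * dgap_re (fmean w) (fdev w z) +
             2 * gap_im (fmean w) * dgap_im (fmean w) (fdev w z)).

Lemma bm_featZ k i : bm (fun v : E * T => feat k v.1 (Z i v.2)).
Proof.
apply: (bm_comp (h := fun v : E * T => (v.1, Z i v.2)) _ (bm_feat k)).
by apply: measurable_fun_pair => //; exact: (measurableT_comp (mZ i) measurable_snd).
Qed.

Lemma bm_fmean k : bm (fmean^~ k).
Proof. exact: (bm_Rintegral2 m P (bm_featZ k 0)). Qed.

Lemma fmean_le1 w k : `|fmean w k| <= 1.
Proof.
apply: norm_Rintegral_le; last by move=> x; exact: feat_le1.
exact: (bm_pair2 w (bm_featZ k 0)).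
Qed.

Lemma fdev_le2 w z k : `|fdev w z k| <= 2.
Proof. by rewrite (le_trans (ler_normB _ _))// lerD ?feat_le1 ?fmean_le1. Qed.

Lemma bm_gap_re d' (T' : measurableType d') (f : T' -> nat -> R) :
  (forall k, bm (f^~ k)) -> bm (fun x => gap_re (f x)).
Proof. by move=> bf; apply: bmB => //; apply: bmB; exact: bmM. Qed.

Lemma bm_gap_im d' (T' : measurableType d') (f : T' -> nat -> R) :
  (forall k, bm (f^~ k)) -> bm (fun x => gap_im (f x)).
Proof. by move=> bf; apply: bmB => //; apply: bmD; exact: bmM. Qed.

Lemma bm_dgap_re d' (T' : measurableType d') (f h : T' -> nat -> R) :
  (forall k, bm (f^~ k)) -> (forall k, bm (h^~ k)) -> bm (fun x => dgap_re (f x) (h x)).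
Proof.
move=> bf bh; apply: bmB => //; apply: bmB; last exact: bmM.
by apply: bmB; [apply: bmD|]; exact: bmM.
Qed.

Lemma bm_dgap_im d' (T' : measurableType d') (f h : T' -> nat -> R) :
  (forall k, bm (f^~ k)) -> (forall k, bm (h^~ k)) -> bm (fun x => dgap_im (f x) (h x)).
Proof.
move=> bf bh; apply: bmB => //; apply: bmD; last exact: bmM.
by apply: bmD; [apply: bmD|]; exact: bmM.
Qed.

Let score (v : E * E) : R :=
  2 * gap_re (fmean v.1) * dgap_re (fmean v.1) (fdev v.1 v.2) +
  2 * gap_im (fmean v.1) * dgap_im (fmean v.1) (fdev v.1 v.2).

Let bm_fmean1 k : bm (fun v : E * E => fmean v.1 k).
Proof. exact: (bm_comp measurable_fst (bm_fmean k)). Qed.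

Let bm_fdev k : bm (fun v : E * E => fdev v.1 v.2 k).
Proof. by apply: bmB => //; exact: bm_feat. Qed.

Let bm_score : bm score.
Proof.
apply: bmD; apply: bmM.
- by apply: bmZ; exact: bm_gap_re.
- exact: bm_dgap_re.
- by apply: bmZ; exact: bm_gap_im.
- exact: bm_dgap_im.
Qed.

Lemma bm_influence : bm influence.
Proof. exact: (bm_Rintegral2 m m (bm_swap bm_score)). Qed.

Let bm_gap2 : bm (fun w => gap_re (fmean w) ^+ 2 + gap_im (fmean w) ^+ 2).
Proof.
by apply: bmD; apply: bmX; [apply: bm_gap_re|apply: bm_gap_im] => k; exact: bm_fmean.
Qed.

(* The derivative of a sum of squares vanishes where the squares do. *)
Lemma gap2_0_influence z : gap2 = 0 -> influence z = 0.
Proof.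
move=> g0; have bs := bm_pair1 z bm_score.
apply/eqP; rewrite -sqrf_eq0 eq_le sqr_ge0 andbT.
rewrite (le_trans (bm_sqr_Rintegral_le _ bs))//.
(* 800 = 4 * 2 * 100: the factor 2 of the score squared, the square of a sum of two terms, and the
   bound 10 on each differential. *)
have -> : 0 = \int[m]_w (800 * (gap_re (fmean w) ^+ 2 + gap_im (fmean w) ^+ 2)).
  by rewrite bm_RintegralZl// -/gap2 g0 mulr0.
apply: bm_le_Rintegral; [exact: bmX|exact: bmZ|].
move=> w; rewrite /score/=.
set a := gap_re _; set b := gap_im _; set al := dgap_re _ _; set be := dgap_im _ _.
have fd k l : `|fdev w z k * fmean w l| <= 2.
  by rewrite normrM -[leRHS]mulr1 ler_pM ?fdev_le2 ?fmean_le1.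
have fd' k l : `|fmean w l * fdev w z k| <= 2 by rewrite mulrC.
have al10 : `|al| <= 10.
  rewrite (_ : 10 = 2 + (2 + 2 + 2 + 2)); last by ring.
  rewrite (le_trans (ler_normB _ _))// lerD ?fdev_le2//.
  rewrite (le_trans (ler_normB _ _))// lerD// (le_trans (ler_normB _ _))// lerD//.
  by rewrite (le_trans (ler_normD _ _))// lerD.
have be10 : `|be| <= 10.
  rewrite (_ : 10 = 2 + (2 + 2 + 2 + 2)); last by ring.
  rewrite (le_trans (ler_normB _ _))// lerD ?fdev_le2//.
  rewrite (le_trans (ler_normD _ _))// lerD// (le_trans (ler_normD _ _))// lerD//.
  by rewrite (le_trans (ler_normD _ _))// lerD.
have sq100 (c e : R) : `|e| <= 10 -> (c * e) ^+ 2 <= 100 * c ^+ 2.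
  move=> e10; rewrite exprMn mulrC ler_wpM2r ?sqr_ge0//.
  have : `|e| ^+ 2 <= 10 ^+ 2 by rewrite lerXn2r ?nnegrE.
  rewrite real_normK ?num_real// => /le_trans; apply.
  by rewrite le_eqVlt; apply/orP; left; apply/eqP; ring.
have h1 := sq100 a al al10; have h2 := sq100 b be be10.
have : 0 <= (a * al - b * be) ^+ 2 by exact: sqr_ge0.
rewrite -!mulrA -mulrDr exprMn.
move: (a * al) (b * be) h1 h2 => u v h1 h2.
have -> : (u - v) ^+ 2 = 2 * u ^+ 2 + 2 * v ^+ 2 - (u + v) ^+ 2 by ring.
have -> : (2 : R) ^+ 2 = 4 by ring.
by lra.
Qed.

Lemma Rintegral_fdev w k : \int[P]_x fdev w (Z 0%N x) k = 0.
Proof.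
have bf := bm_pair2 w (bm_featZ k 0).
rewrite bm_RintegralB//; last exact: bm_cst.
by rewrite Rintegral_probcst /fmean subrr.
Qed.

Let bm_fdevZ w k i : bm (fun x => fdev w (Z i x) k).
Proof. exact: (bm_comp (mZ i) (bm_pair2 w (bm_fdev k))). Qed.

(** At a fixed frequency the score is linear in the deviation, which is centred; Fubini does the
    rest. *)
Lemma Rintegral_influence : \int[P]_x influence (Z 0%N x) = 0.
Proof.
have bs : bm (fun v : E * T => score (v.1, Z 0%N v.2)).
  apply: (bm_comp (h := fun v : E * T => (v.1, Z 0%N v.2)) _ bm_score).
  by apply: measurable_fun_pair => //; exact: (measurableT_comp (mZ 0%N) measurable_snd).
apply: etrans; first exact: (esym (bm_Fubini m P bs)).
transitivity (\int[m]_w (0 : R)); last exact: Rintegral_probcst.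
apply: eq_Rintegral => w _; rewrite /score/=.
have b0 k := bm_fdevZ w k 0.
have br : bm (fun x => dgap_re (fmean w) (fdev w (Z 0%N x))).
  by apply: bm_dgap_re => // k; exact: bm_cst.
have bi : bm (fun x => dgap_im (fmean w) (fdev w (Z 0%N x))).
  by apply: bm_dgap_im => // k; exact: bm_cst.
rewrite bm_RintegralD; [|exact: bmZ..].
rewrite !bm_RintegralZl// Rintegral_dgap_re// Rintegral_dgap_im//.
by rewrite /dgap_re /dgap_im !Rintegral_fdev; ring.
Qed.

Let pmean n (w : E) (x : T) k := n%:R^-1 * psum Z (fun z => fdev w z k) n x.

Let bm_psum n k : bm (fun v : E * T => psum Z (fun z => fdev v.1 z k) n v.2).
Proof.
apply: bm_sum => i; apply: bmB; first exact: bm_featZ.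
exact: (bm_comp measurable_fst (bm_fmean k)).
Qed.

Lemma emean_fmean n (w : E) (x : T) k : (0 < n)%N ->
  emean (fun i : 'I_n => Z i x) w k = fmean w k + pmean n w x k.
Proof.
move=> n0; have nn0 : n%:R != 0 :> R by rewrite pnatr_eq0 -lt0n.
rewrite /emean /pmean /psum sumrB sumr_const card_ord mulrBr -(mulr_natl (fmean w k) n) mulKf//.
by rewrite addrC subrK.
Qed.

Lemma Rintegral_pmean_sqr n w k : (0 < n)%N ->
  \int[P]_x (pmean n w x k ^+ 2) <= 4 / n%:R.
Proof.
move=> n0; have nn0 : 0 < n%:R :> R by rewrite ltr0n.
have bk := bm_pair2 w (bm_fdev k).
have bp : bm (psum Z (fun z => fdev w z k) n) by exact: (bm_pair2 w (bm_psum n k)).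
under eq_Rintegral do rewrite /pmean exprMn.
rewrite bm_RintegralZl; last exact: bmX.
have := @psum_sqr _ _ _ _ _ P Z mZ iidZ (fun z => fdev w z k) n bk (Rintegral_fdev w k).
move=> ->; set I := \int[P]_x _.
have -> : n%:R^-1 ^+ 2 * (n%:R * I) = I / n%:R by field; rewrite gt_eqF.
rewrite ler_wpM2r ?invr_ge0 ?ler0n//.
rewrite -[leRHS](Rintegral_probcst P); apply: bm_le_Rintegral => //.
- by apply: bmX; exact: bm_fdevZ.
- exact: bm_cst.
move=> x; rewrite -real_normK ?num_real//.
by rewrite (_ : (4 : R) = 2 ^+ 2) ?lerXn2r ?nnegrE ?fdev_le2//; ring.
Qed.

Definition empirical_gap2 n (x : T) : R :=
  \int[m]_w (gap_re (emean (fun i : 'I_n => Z i x) w) ^+ 2 +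
             gap_im (emean (fun i : 'I_n => Z i x) w) ^+ 2).

Let bm_emean n k : bm (fun v : E * T => emean (fun i : 'I_n => Z i v.2) v.1 k).
Proof. by apply: bmZ; apply: bm_sum => i; exact: bm_featZ. Qed.

Let bm_egap n : bm (fun v : E * T => gap_re (emean (fun i : 'I_n => Z i v.2) v.1) ^+ 2 +
             gap_im (emean (fun i : 'I_n => Z i v.2) v.1) ^+ 2).
Proof.
by apply: bmD; apply: bmX; [apply: bm_gap_re|apply: bm_gap_im] => k; exact: bm_emean.
Qed.

Lemma bm_empirical_gap2 n : bm (empirical_gap2 n).
Proof. exact: (bm_Rintegral2 P m (bm_swap (bm_egap n))). Qed.

(* 1008 = 42 * 6 * 4: six empirical means of functions bounded by 2. *)
Lemma empirical_gap2_linearization n : (0 < n)%N ->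
  \int[P]_x `|empirical_gap2 n x - gap2 - n%:R^-1 * psum Z influence n x| <= 1008 / n%:R.
Proof.
move=> n0; have nn0 : 0 < n%:R :> R by rewrite ltr0n.
pose S (v : E * T) := 42 * \sum_(k < 6) pmean n v.1 v.2 k ^+ 2.
have bS : bm S by apply: bmZ; apply: bm_sum => k; apply: bmX; apply: bmZ; exact: bm_psum.
have bI := bm_influence.
have bp : bm (psum Z influence n) by apply: bm_sum => i; exact: (bm_comp (mZ i) bI).
have ptw x : `|empirical_gap2 n x - gap2 - n%:R^-1 * psum Z influence n x| <=
    \int[m]_w S (w, x).
  (* By linearity of the differentials, the first-order term at the mean deviation is the average of
     the influences. *)
  have e1 : n%:R^-1 * psum Z influence n x =
    \int[m]_w (2 * gap_re (fmean w) * dgap_re (fmean w) (pmean n w x) +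
               2 * gap_im (fmean w) * dgap_im (fmean w) (pmean n w x)).
    have bsx i : bm (fun w => score (w, Z i x)) by exact: (bm_pair1 (Z i x) bm_score).
    transitivity (n%:R^-1 * \int[m]_w \sum_(i < n) score (w, Z i x)).
      by rewrite bm_Rintegral_sum.
    rewrite -bm_RintegralZl; last exact: bm_sum.
    apply: eq_Rintegral => w _; rewrite /pmean /psum dgap_re_sum dgap_im_sum.
    by rewrite big_split/= -!mulr_sumr; ring.
  have bpm k : bm (fun w => pmean n w x k) by apply: bmZ; exact: (bm_pair1 x (bm_psum n k)).
  have b1 := bm_pair1 x (bm_egap n).
  have b3 : bm (fun w => 2 * gap_re (fmean w) * dgap_re (fmean w) (pmean n w x) +
               2 * gap_im (fmean w) * dgap_im (fmean w) (pmean n w x)).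
    have bf := bm_fmean.
    apply: bmD; apply: bmM.
    - by apply: bmZ; exact: bm_gap_re.
    - exact: bm_dgap_re.
    - by apply: bmZ; exact: bm_gap_im.
    - exact: bm_dgap_im.
  rewrite e1 /empirical_gap2 /gap2 -bm_RintegralB// -bm_RintegralB//; last exact: bmB.
  have b4 := bmB (bmB b1 bm_gap2) b3.
  rewrite (le_trans (bm_norm_Rintegral_le _ b4))//.
  apply: bm_le_Rintegral; [exact: bm_norm|exact: (bm_pair1 x bS)|].
  move=> w; rewrite /S/=.
  have -> : emean (fun i : 'I_n => Z i x) w = (fun k => fmean w k + pmean n w x k).
    by apply/funext => k; exact: emean_fmean.
  apply: gap_expansion => k; first exact: fmean_le1.
  rewrite /pmean normrM normfV (gtr0_norm nn0) mulrC ler_pdivrMr// mulrC.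
  by apply: sum_norm_le => i; exact: fdev_le2.
(* The integrals are exchanged so that, at each frequency, the remainder becomes a sum of six
   variances. *)
apply: (@le_trans _ _ (\int[P]_x \int[m]_w S (w, x))).
  apply: bm_le_Rintegral => //.
  - apply: bm_norm; apply: bmB; last exact: bmZ.
    by apply: bmB; [exact: bm_empirical_gap2|exact: bm_cst].
  - exact: (bm_Rintegral2 P m (bm_swap bS)).
apply: (@le_trans _ _ (\int[m]_w \int[P]_x S (w, x))).
  by have := bm_Fubini m P bS => ->.
rewrite -[leRHS](Rintegral_probcst m); apply: bm_le_Rintegral.
- exact: (bm_Rintegral2 m P bS).
- exact: bm_cst.
move=> w; rewrite /S/=.
have bpk k : bm (fun x => pmean n w x k ^+ 2).
  by apply: bmX; apply: bmZ; exact: (bm_pair2 w (bm_psum n k)).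
rewrite bm_RintegralZl; last by apply: bm_sum => k.
rewrite bm_Rintegral_sum//.
apply: (@le_trans _ _ (42 * \sum_(k < 6) (4 / n%:R))).
  by rewrite ler_wpM2l// ler_sum// => k _; exact: Rintegral_pmean_sqr.
by rewrite sumr_const card_ord le_eqVlt; apply/orP; left; apply/eqP; ring.
Qed.

End independence_gap.

(** * The influence function and the kernel projections *)

Lemma ErealE {R : realType} {d} {T : measurableType d} (P : probability T R) (f : T -> R) :
  Ereal P f = \int[P]_x f x.
Proof. by rewrite /Ereal unlock. Qed.

Section influence_projection.
Context {R : realType} {d} {T : measurableType d} (P : probability T R) {p q : nat}.
Local Notation E := (p.-tuple R * q.-tuple R)%type.
Variables (X : nat -> T -> p.-tuple R) (Y : nat -> T -> q.-tuple R).
Hypothesis mX : forall i, measurable_fun setT (X i).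
Hypothesis mY : forall i, measurable_fun setT (Y i).
Local Notation Z := (fun i x => (X i x, Y i x)).
Hypothesis iidZ : iid P Z.
Variables (wp : p.-tuple R -> R) (wq : q.-tuple R -> R).
Variables (nup : probability (p.-tuple R) R) (nuq : probability (q.-tuple R) R).
Hypothesis wpE : forall t, charw wp t = \int[nup]_s cos (dotv t s).
Hypothesis wqE : forall t, charw wq t = \int[nuq]_s cos (dotv t s).
Hypothesis nupN : forall f : p.-tuple R -> R, bm f ->
  \int[nup]_x f (oppv x) = \int[nup]_x f x.
Local Notation m := (nup \x nuq)%E.
Local Notation Cp x x1 := (charw wp (subv x x1)).
Local Notation Cq y y1 := (charw wq (subv y y1)).
Local Notation F w k := (fmean P Z w k).

Let mZ i : measurable_fun setT (fun x => (X i x, Y i x)).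
Proof. exact: measurable_fun_pair. Qed.

Let bmCp d' (T' : measurableType d') (f g : T' -> p.-tuple R) :
  measurable_fun setT f -> measurable_fun setT g -> bm (fun v => Cp (f v) (g v)).
Proof.
move=> mf mg; apply: (bm_comp (h := fun v => (f v, g v)) _ (bm_charw_subv wpE)).
exact: measurable_fun_pair.
Qed.

Let bmCq d' (T' : measurableType d') (f g : T' -> q.-tuple R) :
  measurable_fun setT f -> measurable_fun setT g -> bm (fun v => Cq (f v) (g v)).
Proof.
move=> mf mg; apply: (bm_comp (h := fun v => (f v, g v)) _ (bm_charw_subv wqE)).
exact: measurable_fun_pair.
Qed.

Let bm_feat2 d' (T' : measurableType d') (f : T' -> E) (g : T' -> E) k :
  measurable_fun setT f -> measurable_fun setT g -> bm (fun v => feat k (f v) (g v)).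
Proof.
move=> mf mg; apply: (bm_comp (h := fun v => (f v, g v)) _ (bm_feat k)).
exact: measurable_fun_pair.
Qed.

Let mX1 : measurable_fun setT (fun v : T * T => X 0%N v.1).
Proof. exact: (measurableT_comp (mX 0%N) measurable_fst). Qed.
Let mX2 : measurable_fun setT (fun v : T * T => X 0%N v.2).
Proof. exact: (measurableT_comp (mX 0%N) measurable_snd). Qed.
Let mY1 : measurable_fun setT (fun v : T * T => Y 0%N v.1).
Proof. exact: (measurableT_comp (mY 0%N) measurable_fst). Qed.
Let mY2 : measurable_fun setT (fun v : T * T => Y 0%N v.2).
Proof. exact: (measurableT_comp (mY 0%N) measurable_snd). Qed.

Let bf k w : bm (fun x => feat k w (X 0%N x, Y 0%N x)).
Proof. by apply: bm_feat2. Qed.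

Let bfM k w c : bm (fun x => c * feat k w (X 0%N x, Y 0%N x)).
Proof. exact: bmZ. Qed.

(** Averaging one coordinate of the joint exponential turns its factor into a marginal
    characteristic function. Here [y] completes the pair at which features 2 and 3 are taken. *)
Let marginal0 w (x : p.-tuple R) (y : q.-tuple R) :
  \int[P]_b feat 0 w (x, Y 0%N b) = feat 2 w (x, y) * F w 4 - feat 3 w (x, y) * F w 5.
Proof.
rewrite /fmean -!bm_RintegralZl// -bm_RintegralB//.
by apply: eq_Rintegral => b _; rewrite /= cosD.
Qed.

Let marginal1 w (x : p.-tuple R) (y : q.-tuple R) :
  \int[P]_b feat 1 w (x, Y 0%N b) = feat 2 w (x, y) * F w 5 + feat 3 w (x, y) * F w 4.
Proof.
rewrite /fmean -!bm_RintegralZl// -bm_RintegralD//.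
by apply: eq_Rintegral => b _; rewrite /= sinD addrC.
Qed.

Let marginal0' w (x : p.-tuple R) (y : q.-tuple R) :
  \int[P]_b feat 0 w (X 0%N b, y) = F w 2 * feat 4 w (x, y) - F w 3 * feat 5 w (x, y).
Proof.
rewrite /fmean ![\int[P]_x _ * _]mulrC -!bm_RintegralZl// -bm_RintegralB//.
by apply: eq_Rintegral => b _; rewrite /= cosD ![_ * cos (dotv w.1 _)]mulrC ![_ * sin (dotv w.1 _)]mulrC.
Qed.

Let marginal1' w (x : p.-tuple R) (y : q.-tuple R) :
  \int[P]_b feat 1 w (X 0%N b, y) = F w 2 * feat 5 w (x, y) + F w 3 * feat 4 w (x, y).
Proof.
rewrite /fmean ![\int[P]_x _ * _]mulrC -!bm_RintegralZl// -bm_RintegralD//.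
apply: eq_Rintegral => b _; rewrite /= sinD; ring.
Qed.

(** The gap compares the mean of the joint exponential under the joint law with its mean under the
    product of the marginals, where [a] and [b] give independent coordinates. *)
Let gap_reE w : gap_re (fmean P Z w) =
  \int[P]_a \int[P]_b (feat 0 w (Z 0%N a) - feat 0 w (X 0%N a, Y 0%N b)).
Proof.
transitivity (\int[P]_a (feat 0 w (Z 0%N a) -
    (feat 2 w (Z 0%N a) * F w 4 - feat 3 w (Z 0%N a) * F w 5))).
  have b2 : bm (fun a => feat 2 w (Z 0%N a) * F w 4) by apply: bmM => //; exact: bm_cst.
  have b3 : bm (fun a => feat 3 w (Z 0%N a) * F w 5) by apply: bmM => //; exact: bm_cst.
  by rewrite bm_RintegralB ?bm_RintegralB ?bm_RintegralZr//; exact: bmB.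
apply: eq_Rintegral => a _; rewrite -marginal0 bm_RintegralB ?Rintegral_probcst//.
  exact: bm_cst.
by apply: bm_feat2 => //; exact: measurable_fun_pair.
Qed.

Let gap_imE w : gap_im (fmean P Z w) =
  \int[P]_a \int[P]_b (feat 1 w (Z 0%N a) - feat 1 w (X 0%N a, Y 0%N b)).
Proof.
transitivity (\int[P]_a (feat 1 w (Z 0%N a) -
    (feat 2 w (Z 0%N a) * F w 5 + feat 3 w (Z 0%N a) * F w 4))).
  have b2 : bm (fun a => feat 2 w (Z 0%N a) * F w 5) by apply: bmM => //; exact: bm_cst.
  have b3 : bm (fun a => feat 3 w (Z 0%N a) * F w 4) by apply: bmM => //; exact: bm_cst.
  by rewrite bm_RintegralB ?bm_RintegralD ?bm_RintegralZr//; exact: bmD.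
apply: eq_Rintegral => a _; rewrite -marginal1 bm_RintegralB ?Rintegral_probcst//.
  exact: bm_cst.
by apply: bm_feat2 => //; exact: measurable_fun_pair.
Qed.

Let A w := gap_re (fmean P Z w).
Let B w := gap_im (fmean P Z w).
(** The real part of the gap times the conjugate of the joint exponential at [z]. *)
Let Dw w z := A w * feat 0 w z + B w * feat 1 w z.
Let D z := \int[m]_w Dw w z.

Let bF k : bm (fun w => F w k). Proof. exact: bm_fmean. Qed.
Let bA : bm A. Proof. by apply: bm_gap_re => k; exact: bF. Qed.
Let bB : bm B. Proof. by apply: bm_gap_im => k; exact: bF. Qed.

Let bDw : bm (fun v : E * E => Dw v.1 v.2).
Proof.
by apply: bmD; apply: bmM; try exact: bm_feat;
  [exact: (bm_comp measurable_fst bA) | exact: (bm_comp measurable_fst bB)].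
Qed.

Let D_marginal (f : T -> E) : measurable_fun setT f ->
  \int[m]_w \int[P]_b Dw w (f b) = \int[P]_b D (f b).
Proof.
move=> mf; have bDf : bm (fun v : E * T => Dw v.1 (f v.2)).
  apply: (bm_comp (h := fun v : E * T => (v.1, f v.2)) _ bDw).
  by apply: measurable_fun_pair => //; exact: (measurableT_comp mf measurable_snd).
exact: (bm_Fubini m P bDf).
Qed.

(** In the differentials, each product of a marginal feature with a marginal mean is the average of
    a joint feature over the other coordinate, so the influence is expressed through [D] alone. *)
Lemma influence_marginals : exists c, forall z : E, influence P Z nup nuq z =
  2 * (D z - \int[P]_b D (z.1, Y 0%N b) - \int[P]_b D (X 0%N b, z.2)) + c.
Proof.
(* [c0] and [c1] collect what is free of [z] in the differentials; it stems from the centring in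
   [fdev]. *)
pose c0 w := - F w 0 + 2 * (F w 2 * F w 4 - F w 3 * F w 5).
pose c1 w := - F w 1 + 2 * (F w 2 * F w 5 + F w 3 * F w 4).
pose cw w := 2 * (A w * c0 w + B w * c1 w).
have bc : bm cw.
  apply: bmZ; apply: bmD; apply: bmM => //; apply: bmD; try exact: bmN;
    apply: bmZ; [apply: bmB|apply: bmD]; exact: bmM.
exists (\int[m]_w cw w) => z.
have m1 : measurable_fun setT (fun b => (z.1, Y 0%N b)) by exact: measurable_fun_pair.
have m2 : measurable_fun setT (fun b => (X 0%N b, z.2)) by exact: measurable_fun_pair.
have bDf (f : T -> E) : measurable_fun setT f -> bm (fun w => \int[P]_b Dw w (f b)).
  move=> mf; have b : bm (fun v : E * T => Dw v.1 (f v.2)).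
    apply: (bm_comp (h := fun v : E * T => (v.1, f v.2)) _ bDw).
    by apply: measurable_fun_pair => //; exact: (measurableT_comp mf measurable_snd).
  exact: (bm_Rintegral2 m P b).
have b0 : bm (fun w => Dw w z) by exact: (bm_pair1 z bDw).
have b1 := bDf _ m1; have b2 := bDf _ m2.
rewrite -!D_marginal// /D -bm_RintegralB// -bm_RintegralB//; last exact: bmB.
have b3 : bm (fun w => Dw w z - \int[P]_b Dw w (z.1, Y 0%N b) - \int[P]_b Dw w (X 0%N b, z.2)).
  by apply: bmB => //; exact: bmB.
rewrite -bm_RintegralZl// -bm_RintegralD//; last exact: bmZ.
apply: eq_Rintegral => w _.
have bfm k (f : T -> E) : measurable_fun setT f -> bm (fun b => feat k w (f b)).
  by move=> mf; apply: bm_feat2.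
have e (f : T -> E) : measurable_fun setT f -> \int[P]_b Dw w (f b) =
    A w * \int[P]_b feat 0 w (f b) + B w * \int[P]_b feat 1 w (f b).
  move=> mf; rewrite /Dw bm_RintegralD ?bm_RintegralZl//; try exact: bfm.
    by apply: bmZ; exact: bfm.
  by apply: bmZ; exact: bfm.
rewrite !e// (marginal0 w z.1 z.2) (marginal1 w z.1 z.2) (marginal0' w z.1 z.2) (marginal1' w z.1 z.2).
rewrite /cw /c0 /c1 /Dw -/(A w) -/(B w) /dgap_re /dgap_im /fdev -!surjective_pairing; ring.
Qed.

Let K (z z1 : E) := Cp z.1 z1.1 * Cq z.2 z1.2.

(* [D] is the difference of the kernel mean embeddings of the joint law and of
   the product of the marginals. *)
Let D_kernel z : D z =
  \int[P]_a K z (Z 0%N a) - (\int[P]_a Cp z.1 (X 0%N a)) * (\int[P]_a Cq z.2 (Y 0%N a)).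
Proof.
pose G k (v : E * (T * T)) := feat k v.1 z *
  (feat k v.1 (X 0%N v.2.1, Y 0%N v.2.1) - feat k v.1 (X 0%N v.2.1, Y 0%N v.2.2)).
have m1 : measurable_fun setT (fun v : T * T => (X 0%N v.1, Y 0%N v.1)) by exact: measurable_fun_pair.
have m2 : measurable_fun setT (fun v : T * T => (X 0%N v.1, Y 0%N v.2)) by exact: measurable_fun_pair.
have bG k : bm (G k).
  apply: bmM; first by apply: bm_feat2 => //; exact: measurable_fst.
  by apply: bmB; apply: bm_feat2; first [exact: measurable_fst |
    exact: (measurableT_comp m1 measurable_snd) | exact: (measurableT_comp m2 measurable_snd)].
have bG2 : bm (fun v => G 0%N v + G 1%N v) by apply: bmD.
have GA w : A w * feat 0 w z = \int[(P \x P)%E]_v G 0%N (w, v).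
  rewrite (bm_Rintegral_prod P P (bm_pair2 w (bG 0%N))) /A gap_reE mulrC -bm_RintegralZl.
    apply: eq_Rintegral => a _; rewrite -bm_RintegralZl//.
    by apply: bmB; [exact: bm_cst|apply: bm_feat2 => //; exact: measurable_fun_pair].
  have b : bm (fun v : T * T => feat 0 w (X 0%N v.1, Y 0%N v.1) - feat 0 w (X 0%N v.1, Y 0%N v.2)).
    by apply: bmB; exact: bm_feat2.
  exact: (bm_Rintegral2 P P b).
have GB w : B w * feat 1 w z = \int[(P \x P)%E]_v G 1%N (w, v).
  rewrite (bm_Rintegral_prod P P (bm_pair2 w (bG 1%N))) /B gap_imE mulrC -bm_RintegralZl.
    apply: eq_Rintegral => a _; rewrite -bm_RintegralZl//.
    by apply: bmB; [exact: bm_cst|apply: bm_feat2 => //; exact: measurable_fun_pair].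
  have b : bm (fun v : T * T => feat 1 w (X 0%N v.1, Y 0%N v.1) - feat 1 w (X 0%N v.1, Y 0%N v.2)).
    by apply: bmB; exact: bm_feat2.
  exact: (bm_Rintegral2 P P b).
transitivity (\int[m]_w \int[(P \x P)%E]_v (G 0%N (w, v) + G 1%N (w, v))).
  apply: eq_Rintegral => w _; rewrite /Dw GA GB.
  by rewrite bm_RintegralD//; exact: (bm_pair2 w (bG _)).
apply: etrans; first exact: (bm_Fubini m (P \x P)%E bG2).
have bK1 : bm (fun v : T * T => K z (X 0%N v.1, Y 0%N v.1)) by apply: bmM; [exact: bmCp|exact: bmCq].
have bK2 : bm (fun v : T * T => K z (X 0%N v.1, Y 0%N v.2)) by apply: bmM; [exact: bmCp|exact: bmCq].
transitivity (\int[(P \x P)%E]_v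
    (K z (X 0%N v.1, Y 0%N v.1) - K z (X 0%N v.1, Y 0%N v.2))).
  apply: eq_Rintegral => v _.
  rewrite /K !(charw_kernel wpE wqE nupN) -bm_RintegralB; last 2 first.
  - by apply: bmD; apply: bmM; apply: bm_feat2.
  - by apply: bmD; apply: bmM; apply: bm_feat2.
  by apply: eq_Rintegral => w _; rewrite /G/=; ring.
rewrite bm_RintegralB//; congr (_ - _).
  apply: etrans; first exact: (bm_Rintegral_prod P P bK1).
  by apply: eq_Rintegral => a _; exact: (Rintegral_probcst P (K z (X 0%N a, Y 0%N a))).
apply: etrans; first exact: (bm_Rintegral_prod P P bK2).
have bq : bm (fun b => Cq z.2 (Y 0%N b)) by exact: bmCq.
have bp : bm (fun b => Cp z.1 (X 0%N b)) by exact: bmCp.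
transitivity (\int[P]_a (Cp z.1 (X 0%N a) * \int[P]_b Cq z.2 (Y 0%N b))).
  by apply: eq_Rintegral => a _; rewrite /K/= bm_RintegralZl.
by rewrite bm_RintegralZr.
Qed.

Let iid_pair_Rintegral (f : E * E -> R) i j : i != j -> bm f ->
  \int[P]_x f (Z i x, Z j x) = \int[P]_a \int[P]_b f (Z 0%N a, Z 0%N b).
Proof.
move=> ij bfE.
have iUV A1 B1 := @indep_pair _ _ _ _ _ P Z (proj1 iidZ) i j A1 B1 ij.
apply: etrans; first exact: (indep_Rintegral (mZ i) (mZ j) iUV bfE).
transitivity (\int[P]_a \int[P]_b f (Z i a, Z 0%N b)).
  apply: eq_Rintegral => a _.
  exact: (identically_distributed_Rintegral mZ iidZ j (bm_pair2 (Z i a) bfE)).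
pose g z := \int[P]_b f (z, Z 0%N b).
have bg : bm g.
  have b : bm (fun v : E * T => f (v.1, Z 0%N v.2)).
    apply: (bm_comp (h := fun v : E * T => (v.1, Z 0%N v.2)) _ bfE).
    apply: measurable_fun_pair => //.
    exact: (measurableT_comp (mZ 0%N) measurable_snd).
  exact: (bm_Rintegral2 m P b).
exact: (identically_distributed_Rintegral mZ iidZ i bg).
Qed.

(** The delta-method linearization of [Delta_n]: first-order Hoeffding projections weighted by the
    gradient, not yet centred. *)
Definition hoeffding (z : E) : R :=
  \sum_(k < 4) mdeg k * hgrad P wp wq X Y k * psi1 P wp wq X Y k z.1 z.2.

(** Up to a constant both sides are twice [kap - a * b - n1 - n2 + S3 * a + S2 * b]. The six terms
    of the fourth kernel project in pairs onto [a * b], [n1] and [n2], and the weight [3 * -2 / 6]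
    gives each pair the coefficient -2. *)
Lemma influence_hoeffding : exists c, forall z, influence P Z nup nuq z = hoeffding z + c.
Proof.
have [c0 c0E] := influence_marginals.
pose a x := \int[P]_b Cp x (X 0%N b); pose b y := \int[P]_a Cq y (Y 0%N a).
pose kap z := \int[P]_a K z (Z 0%N a).
pose n1 x := \int[P]_a \int[P]_b (Cp x (X 0%N b) * Cq (Y 0%N a) (Y 0%N b)).
pose n2 y := \int[P]_a \int[P]_b (Cp (X 0%N a) (X 0%N b) * Cq y (Y 0%N b)).
have mp1 : measurable_fun setT (fun v : E * E => v.1.1) by exact: (measurableT_comp measurable_fst measurable_fst).
have mp2 : measurable_fun setT (fun v : E * E => v.2.1) by exact: (measurableT_comp measurable_fst measurable_snd).
have mq1 : measurable_fun setT (fun v : E * E => v.1.2) by exact: (measurableT_comp measurable_snd measurable_fst).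
have mq2 : measurable_fun setT (fun v : E * E => v.2.2) by exact: (measurableT_comp measurable_snd measurable_snd).
have s2 : S2 P wp X = \int[P]_a \int[P]_b Cp (X 0%N a) (X 0%N b).
  rewrite /S2 ErealE.
  by apply: (@iid_pair_Rintegral (fun v => Cp v.1.1 v.2.1) 0%N 1%N) => //; exact: bmCp.
have s3 : S3 P wq Y = \int[P]_a \int[P]_b Cq (Y 0%N a) (Y 0%N b).
  rewrite /S3 ErealE.
  by apply: (@iid_pair_Rintegral (fun v => Cq v.1.2 v.2.2) 0%N 1%N) => //; exact: bmCq.
have bpf (f : T -> p.-tuple R) x : measurable_fun setT f -> bm (fun b => Cp x (f b)).
  by move=> mf; exact: bmCp.
have bqf (f : T -> q.-tuple R) x : measurable_fun setT f -> bm (fun b => Cq x (f b)).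
  by move=> mf; exact: bmCq.
have p0 z : psi1 P wp wq X Y 0 z.1 z.2 = kap z.
  rewrite /psi1 ErealE.
  apply: (identically_distributed_Rintegral mZ iidZ 1%N (f := fun z1 => K z z1)).
  by apply: bmM; [apply: bmCp => //; exact: measurable_fst|apply: bmCq => //; exact: measurable_snd].
have p1 (z : E) : psi1 P wp wq X Y 1 z.1 z.2 = a z.1.
  rewrite /psi1 ErealE.
  apply: (identically_distributed_Rintegral mZ iidZ 1%N (f := fun z1 => Cp z.1 z1.1)).
  by apply: bmCp => //; exact: measurable_fst.
have p2 (z : E) : psi1 P wp wq X Y 2 z.1 z.2 = b z.2.
  rewrite /psi1 ErealE.
  apply: (identically_distributed_Rintegral mZ iidZ 1%N (f := fun z1 => Cq z.2 z1.2)).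
  by apply: bmCq => //; exact: measurable_snd.
(* Going through an existential makes the double integral an opaque atom for the rewrites below. *)
have [I2 I2E] : exists I2 : (T * T -> R) -> R,
    forall f, I2 f = \int[P]_a \int[P]_b f (a, b).
  by exists (fun f => \int[P]_a \int[P]_b f (a, b)) => f; exact: erefl.
have i2D (f g : T * T -> R) : bm f -> bm g -> I2 (fun v => f v + g v) = I2 f + I2 g.
  move=> bf' bg; rewrite !I2E.
  rewrite -bm_RintegralD; [|exact: (bm_Rintegral2 P P bf')|exact: (bm_Rintegral2 P P bg)].
  by apply: eq_Rintegral => x _; rewrite bm_RintegralD//; [exact: (bm_pair2 x bf')|exact: (bm_pair2 x bg)].
have p3 (z : E) : psi1 P wp wq X Y 3 z.1 z.2 =
    6^-1 * (a z.1 * b z.2 + a z.1 * b z.2 + n1 z.1 + n2 z.2 + n1 z.1 + n2 z.2).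
  pose t1 (v : T * T) := Cp z.1 (X 0%N v.1) * Cq z.2 (Y 0%N v.2).
  pose t2 (v : T * T) := Cp z.1 (X 0%N v.2) * Cq z.2 (Y 0%N v.1).
  pose t3 (v : T * T) := Cp z.1 (X 0%N v.1) * Cq (Y 0%N v.1) (Y 0%N v.2).
  pose t4 (v : T * T) := Cp (X 0%N v.1) (X 0%N v.2) * Cq z.2 (Y 0%N v.1).
  pose t5 (v : T * T) := Cp z.1 (X 0%N v.2) * Cq (Y 0%N v.1) (Y 0%N v.2).
  pose t6 (v : T * T) := Cp (X 0%N v.1) (X 0%N v.2) * Cq z.2 (Y 0%N v.2).
  have b1 : bm t1 by apply: bmM; [exact: bmCp|exact: bmCq].
  have b2 : bm t2 by apply: bmM; [exact: bmCp|exact: bmCq].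
  have b3 : bm t3 by apply: bmM; [exact: bmCp|exact: bmCq].
  have b4 : bm t4 by apply: bmM; [exact: bmCp|exact: bmCq].
  have b5 : bm t5 by apply: bmM; [exact: bmCp|exact: bmCq].
  have b6 : bm t6 by apply: bmM; [exact: bmCp|exact: bmCq].
  have b12 := bmD b1 b2; have b13 := bmD b12 b3; have b14 := bmD b13 b4.
  have b15 := bmD b14 b5; have b16 := bmD b15 b6.
  transitivity (6^-1 * I2 (fun v => t1 v + t2 v + t3 v + t4 v + t5 v + t6 v)).
    rewrite /psi1 ErealE.
    apply: etrans.
      apply: (@iid_pair_Rintegral (fun v => psi wp wq 3 z.1 z.2 v.1.1 v.1.2 v.2.1 v.2.2) 1%N 2%N) => //.
      apply: bmZ; repeat apply: bmD; apply: bmM; by [exact: bmCp|exact: bmCq].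
    rewrite I2E -bm_RintegralZl; last exact: (bm_Rintegral2 P P b16).
    by apply: eq_Rintegral => x _; rewrite -bm_RintegralZl//; exact: (bm_pair2 x b16).
  rewrite (i2D _ _ b15 b6) (i2D _ _ b14 b5) (i2D _ _ b13 b4) (i2D _ _ b12 b3) (i2D _ _ b1 b2).
  congr (_ * (_ + _ + _ + _ + _ + _)); rewrite I2E.
  - rewrite /a -bm_RintegralZr; last exact: bpf.
    by apply: eq_Rintegral => x _; rewrite /t1/= bm_RintegralZl//; exact: bqf.
  - rewrite mulrC /b -bm_RintegralZr; last exact: bqf.
    by apply: eq_Rintegral => x _; rewrite /t2/= mulrC -bm_RintegralZr//; exact: bpf.
  - apply: etrans; first exact: (bm_Fubini P P b3).
    apply: eq_Rintegral => x _; apply: eq_Rintegral => y _.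
    by rewrite /t3/= (charw_subvC wqE).
  - apply: etrans; first exact: (bm_Fubini P P b4).
    apply: eq_Rintegral => x _; apply: eq_Rintegral => y _.
    by rewrite /t4/= (charw_subvC wpE).
  - exact: erefl.
  - exact: erefl.
have Dk : forall z1 : E, D z1 = kap z1 - a z1.1 * b z1.2 := D_kernel.
have bkY x : bm (fun y => kap (x, Y 0%N y)).
  have b0 : bm (fun v : T * T => K (x, Y 0%N v.1) (X 0%N v.2, Y 0%N v.2)).
    by apply: bmM; [exact: bmCp|exact: bmCq].
  exact: (bm_Rintegral2 P P b0).
have bkX y : bm (fun x => kap (X 0%N x, y)).
  have b0 : bm (fun v : T * T => K (X 0%N v.1, y) (X 0%N v.2, Y 0%N v.2)).
    by apply: bmM; [exact: bmCp|exact: bmCq].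
  exact: (bm_Rintegral2 P P b0).
have baX : bm (fun x => a (X 0%N x)).
  have b0 : bm (fun v : T * T => Cp (X 0%N v.1) (X 0%N v.2)) by exact: bmCp.
  exact: (bm_Rintegral2 P P b0).
have bbY : bm (fun x => b (Y 0%N x)).
  have b0 : bm (fun v : T * T => Cq (Y 0%N v.1) (Y 0%N v.2)) by exact: bmCq.
  exact: (bm_Rintegral2 P P b0).
have DY x : \int[P]_y D (x, Y 0%N y) = n1 x - a x * S3 P wq Y.
  transitivity (\int[P]_y (kap (x, Y 0%N y) - a x * b (Y 0%N y))).
    by apply: eq_Rintegral => y _; exact: Dk.
  by rewrite bm_RintegralB ?bm_RintegralZl// ?s3//; exact: bmZ.
have DX y : \int[P]_x D (X 0%N x, y) = n2 y - S2 P wp X * b y.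
  transitivity (\int[P]_x (kap (X 0%N x, y) - a (X 0%N x) * b y)).
    by apply: eq_Rintegral => x _; exact: Dk.
  have bab : bm (fun x => a (X 0%N x) * b y) by exact: (bmM baX (bm_cst (b y))).
  apply: etrans; first exact: (bm_RintegralB P (bkX y) bab).
  congr (_ - _); rewrite s2; exact: (bm_RintegralZr P (b y) baX).
exists c0 => z; rewrite c0E Dk DY DX; congr (_ + _).
rewrite /hoeffding !big_ord_recr big_ord0/= p0 p1 p2 p3 /mdeg/=.
by field.
Qed.

(** Since the influence is centred, the constant relating it to [hoeffding] must centre the
    projections. Expanding the square of their weighted sum yields the covariances [zeta1]. *)
Lemma sigma2E : sigma2 P wp wq X Y = \int[P]_x influence P Z nup nuq (X 0%N x, Y 0%N x) ^+ 2.
Proof.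
have bpsi k : bm (fun x => psi1 P wp wq X Y k (X 0%N x) (Y 0%N x)).
  have mXi i : measurable_fun setT (fun v : T * T => X i v.2).
    exact: (measurableT_comp (mX i) measurable_snd).
  have mYi i : measurable_fun setT (fun v : T * T => Y i v.2).
    exact: (measurableT_comp (mY i) measurable_snd).
  have b : bm (fun v : T * T => psi wp wq k (X 0%N v.1) (Y 0%N v.1)
      (X 1%N v.2) (Y 1%N v.2) (X 2%N v.2) (Y 2%N v.2)).
    case: k => [|[|[|k]]].
    - by apply: bmM; [exact: bmCp|exact: bmCq].
    - exact: bmCp.
    - exact: bmCq.
    - by apply: bmZ; repeat apply: bmD; apply: bmM; by [exact: bmCp|exact: bmCq].
  have := bm_Rintegral2 P P b; congr bm; apply/funext => x.
  exact: (esym (ErealE P _)).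
pose e k := \int[P]_x psi1 P wp wq X Y k (X 0%N x) (Y 0%N x).
pose h k x := mdeg k * hgrad P wp wq X Y k * (psi1 P wp wq X Y k (X 0%N x) (Y 0%N x) - e k).
have bh k : bm (h k) by apply: bmZ; apply: bmB => //; exact: bm_cst.
have [c cE] := influence_hoeffding.
have bpk k : bm (fun x => mdeg k * hgrad P wp wq X Y k *
    psi1 P wp wq X Y k (X 0%N x) (Y 0%N x)) by exact: bmZ.
have ce : c = - \sum_(k < 4) mdeg k * hgrad P wp wq X Y k * e k.
  have : \int[P]_x (hoeffding (X 0%N x, Y 0%N x) + c) = 0.
    rewrite -(@Rintegral_influence _ _ _ P _ _ Z mZ nup nuq).
    by apply: eq_Rintegral => x _; rewrite cE.
  rewrite bm_RintegralD; [|exact: bm_sum|exact: bm_cst].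
  rewrite Rintegral_probcst bm_Rintegral_sum// addrC => /eqP; rewrite addr_eq0 => /eqP ->.
  by congr (- _); apply: eq_bigr => k _; rewrite bm_RintegralZl.
have infE x : influence P Z nup nuq (X 0%N x, Y 0%N x) = \sum_(k < 4) h k x.
  rewrite cE ce /hoeffding/= -sumrB; apply: eq_bigr => k _; rewrite /h; ring.
transitivity (\int[P]_x \sum_(k < 4) \sum_(l < 4) h k x * h l x); last first.
  by apply: eq_Rintegral => x _; rewrite infE expr2 big_distrlr.
rewrite bm_Rintegral_sum; last by move=> k; apply: bm_sum => l; exact: bmM.
apply: eq_bigr => k _; rewrite bm_Rintegral_sum; last by move=> l; exact: bmM.
apply: eq_bigr => l _; rewrite /zeta1 unlock.
have eE j : fine ('E_P[fun x => psi1 P wp wq X Y j (X 0%N x) (Y 0%N x)])%E = e j.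
  exact: ErealE.
rewrite -[fine _]/(Ereal P _) ErealE -bm_RintegralZl; last first.
  by apply: bmM; apply: bmB => //; exact: bm_cst.
apply: eq_Rintegral => x _; rewrite /h !fctE /= !eE; ring.
Qed.

End influence_projection.

(** * The estimator *)

Section estimator_expansion.
Context {R : realType} {d} {T : measurableType d} (P : probability T R) {p q : nat}.
Local Notation E := (p.-tuple R * q.-tuple R)%type.
Variables (X : nat -> T -> p.-tuple R) (Y : nat -> T -> q.-tuple R).
Hypothesis mX : forall i, measurable_fun setT (X i).
Hypothesis mY : forall i, measurable_fun setT (Y i).
Local Notation Z := (fun i x => (X i x, Y i x)).
Hypothesis iidZ : iid P Z.
Variables (wp : p.-tuple R -> R) (wq : q.-tuple R -> R).
Variables (nup : probability (p.-tuple R) R) (nuq : probability (q.-tuple R) R).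
Hypothesis wpE : forall t, charw wp t = \int[nup]_s cos (dotv t s).
Hypothesis wqE : forall t, charw wq t = \int[nuq]_s cos (dotv t s).
Hypothesis nupN : forall f : p.-tuple R -> R, bm f ->
  \int[nup]_x f (oppv x) = \int[nup]_x f x.
Local Notation m := (nup \x nuq)%E.

Let mZ i : measurable_fun setT (fun x => (X i x, Y i x)).
Proof. exact: measurable_fun_pair. Qed.

(** The weights are absorbed into [nuq] and [nup] one at a time, the inner one first. In particular
    the distance is finite. *)
Lemma indep_dist_gap2 : (forall t, 0 <= wp t) -> (forall t, 0 <= wq t) ->
  (forall f : p.-tuple R -> \bar R, measurable_fun setT f -> (forall x, 0 <= f x)%E ->
    (\int[@leb_tuple R p]_x (f x * (wp x)%:E) = \int[nup]_x f x)%E) ->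
  (forall f : q.-tuple R -> \bar R, measurable_fun setT f -> (forall x, 0 <= f x)%E ->
    (\int[@leb_tuple R q]_x (f x * (wq x)%:E) = \int[nuq]_x f x)%E) ->
  indep_dist P wp wq (X 0%N) (Y 0%N) = (gap2 P Z nup nuq)%:E.
Proof.
move=> wp0 wq0 nupE nuqE.
pose G (w : E) := gap_re (fmean P Z w) ^+ 2 + gap_im (fmean P Z w) ^+ 2.
have bF k : bm (fun w => fmean P Z w k) by exact: bm_fmean.
have bG : bm G by apply: bmD; apply: bmX; [exact: bm_gap_re|exact: bm_gap_im].
have G0 w : 0 <= G w by rewrite addr_ge0 ?sqr_ge0.
have gapE t1 t2 : cf_gap2 P (X 0%N) (Y 0%N) t1 t2 = G (t1, t2).
  by rewrite /cf_gap2 /jcf_re /jcf_im /cf_re /cf_im !ErealE.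
have bG2 t1 : bm (fun t2 => G (t1, t2)) by exact: bm_pair2.
transitivity (\int[@leb_tuple R p]_t1 ((\int[nuq]_t2 G (t1, t2))%:E * (wp t1)%:E))%E.
  rewrite /indep_dist; congr (integral _ _ _); apply/funext => t1.
  have bGw : bm (fun t2 => G (t1, t2) * wp t1) by apply: bmM => //; exact: bm_cst.
  transitivity (\int[@leb_tuple R q]_t2 ((G (t1, t2) * wp t1)%:E * (wq t2)%:E))%E.
    by congr (integral _ _ _); apply/funext => t2; rewrite gapE EFinM.
  rewrite nuqE; last 2 first.
  - by apply/measurable_EFinP; case: bGw.
  - by move=> t2; rewrite lee_fin mulr_ge0.
  by rewrite EFin_Rintegral// bm_RintegralZr// EFinM.
have bI := bm_Rintegral2 nup nuq bG.
rewrite nupE; last 2 first.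
- by apply/measurable_EFinP; case: bI.
- by move=> t1; rewrite lee_fin; exact: Rintegral_ge0.
by rewrite EFin_Rintegral// /gap2 (bm_Rintegral_prod nup nuq bG).
Qed.

(* 66 = 3 + (3 * 2 + 3) + 2 * 27, one term for each U-statistic. *)
Lemma Delta_n_empirical_gap2 n x : (3 <= n)%N ->
  `|Delta_n wp wq X Y n x - empirical_gap2 Z nup nuq n x| <= 66 / n%:R.
Proof.
move=> n3; have N3 := natr_ge3 (R := R) n3; have N0 : 0 < n%:R :> R by lra.
have p1 a b : `|charw wp (subv a b)| <= 1 by exact: charw_subv_le1.
have q1 a b : `|charw wq (subv a b)| <= 1 by exact: charw_subv_le1.
have pq1 a b c e : `|charw wp (subv a b) * charw wq (subv c e)| <= 1.
  by rewrite normrM mulr_ile1.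
have d1 := pair_diagonal n3 (fun i j => pq1 (X i x) (X j x) (Y i x) (Y j x)).
have d2 := pair_diagonal n3 (fun i j => p1 (X i x) (X j x)).
have d3 := pair_diagonal n3 (fun i j => q1 (Y i x) (Y j x)).
have d4 := triple_diagonal n3 (fun i j k => pq1 (X i x) (X j x) (Y i x) (Y k x)).
rewrite /empirical_gap2 (empirical_gapE wpE wqE nupN)/= /Delta_n.
rewrite -/(U1 wp wq X Y n x) in d1; rewrite -/(U2 wp X n x) in d2.
rewrite -/(U3 wq Y n x) in d3; rewrite -/(U4 wp wq X Y n x) in d4.
have vb (a : 'I_n -> 'I_n -> R) : (forall i j, `|a i j| <= 1) ->
    `|(n%:R ^+ 2)^-1 * \sum_(i < n) \sum_(j < n) a i j| <= 1.
  move=> a1; rewrite normrM normfV normrX (gtr0_norm N0) mulrC ler_pdivrMr ?exprn_gt0// mul1r.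
  rewrite expr2; apply: sum_norm_le => i.
  by rewrite -[leRHS]mulr1; exact: sum_norm_le.
have v2 := vb _ (fun i j => p1 (X i x) (X j x)).
have v3 := vb _ (fun i j => q1 (Y i x) (Y j x)).
move: d1 d2 d3 d4 v2 v3.
move: (U1 _ _ _ _ _ _) (U2 _ _ _ _) (U3 _ _ _ _) (U4 _ _ _ _ _ _) => u1 u2 u3 u4.
set v1 := _^-1 * _; set v2 := _^-1 * _; set v3 := _^-1 * _; set v4 := _^-1 * _.
move=> d1 d2 d3 d4 b2 b3.
have i3 : 3 / n%:R <= 1 :> R by rewrite ler_pdivrMr// mul1r.
have e0 : 0 <= 1 / n%:R :> R by rewrite divr_ge0// ltW.
set e : R := 1 / n%:R in e0.
have E3 : 3 / n%:R = 3 * e :> R by rewrite /e mulrA mulr1.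
have E27 : 27 / n%:R = 27 * e :> R by rewrite /e mulrA mulr1.
have E66 : 66 / n%:R = 66 * e :> R by rewrite /e mulrA mulr1.
rewrite E3 in d1 d2 d3 i3; rewrite E27 in d4; rewrite E66.
(* [v3] is at most 1 in absolute value and [u3] is within [3 / n <= 1] of it. *)
have u3b : `|u3| <= 2.
  rewrite (_ : u3 = (u3 - v3) + v3); last by ring.
  by rewrite (le_trans (ler_normD _ _))//; lra.
have m1 : `|(u2 - v2) * u3| <= 3 * e * 2 by rewrite normrM ler_pM.
have m2 : `|v2 * (u3 - v3)| <= 1 * (3 * e) by rewrite normrM ler_pM.
have -> : u1 + u2 * u3 - 2 * u4 - (v1 + v2 * v3 - 2 * v4) =
  (u1 - v1) + (u2 - v2) * u3 + v2 * (u3 - v3) - 2 * (u4 - v4) by ring.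
rewrite (le_trans (ler_normB _ _))// normrM (ger0_norm (_ : 0 <= 2))//.
have := ler_normD (u1 - v1 + (u2 - v2) * u3) (v2 * (u3 - v3)).
have := ler_normD (u1 - v1) ((u2 - v2) * u3).
by lra.
Qed.

Lemma bm_Delta_n n : bm (Delta_n wp wq X Y n).
Proof.
have bp i j : bm (fun x => charw wp (subv (X i x) (X j x))).
  apply: (bm_comp (h := fun x => (X i x, X j x)) _ (bm_charw_subv wpE)).
  exact: measurable_fun_pair.
have bq i j : bm (fun x => charw wq (subv (Y i x) (Y j x))).
  apply: (bm_comp (h := fun x => (Y i x, Y j x)) _ (bm_charw_subv wqE)).
  exact: measurable_fun_pair.
apply: bmB; first apply: bmD; last first.
- apply: bmZ; apply: bmZ; apply: bm_sum => i; apply: bm_sum => j; apply: bm_sum => k.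
  exact: bmM.
- by apply: bmM; apply: bmZ; apply: bm_sum => i; apply: bm_sum => j.
- by apply: bmZ; apply: bm_sum => i; apply: bm_sum => j; exact: bmM.
Qed.

(* 1074 = 66 + 1008. *)
Lemma Delta_n_linearization n : (3 <= n)%N ->
  \int[P]_x `|Delta_n wp wq X Y n x - gap2 P Z nup nuq
    - n%:R^-1 * psum Z (influence P Z nup nuq) n x| <= 1074 / n%:R.
Proof.
move=> n3; have n0 : (0 < n)%N by exact: leq_trans n3.
have bD := bm_Delta_n n; have bE := bm_empirical_gap2 P mZ nup nuq n.
have bI := bm_influence P mZ nup nuq.
have bp : bm (psum Z (influence P Z nup nuq) n).
  by apply: bm_sum => i; exact: (bm_comp (mZ i) bI).
have bL : bm (fun x => empirical_gap2 Z nup nuq n x - gap2 P Z nup nuq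
    - n%:R^-1 * psum Z (influence P Z nup nuq) n x).
  by apply: bmB; [apply: bmB => //; exact: bm_cst|exact: bmZ].
apply: (@le_trans _ _ (\int[P]_x (66 / n%:R + `|empirical_gap2 Z nup nuq n x - gap2 P Z nup nuq
    - n%:R^-1 * psum Z (influence P Z nup nuq) n x|))).
  apply: bm_le_Rintegral.
  - apply: bm_norm; apply: bmB; [apply: bmB => //; exact: bm_cst|exact: bmZ].
  - by apply: bmD; [exact: bm_cst|exact: bm_norm].
  move=> x; set g := gap2 _ _ _ _; set s := n%:R^-1 * _.
  have := Delta_n_empirical_gap2 x n3.
  move: (Delta_n _ _ _ _ _ _) (empirical_gap2 _ _ _ _ _) => u v uv.
  rewrite (_ : u - g - s = (u - v) + (v - g - s)); last by ring.
  by rewrite (le_trans (ler_normD _ _))// lerD2r.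
rewrite bm_RintegralD; [|exact: bm_cst|exact: bm_norm].
rewrite Rintegral_probcst (_ : 1074 / n%:R = 66 / n%:R + 1008 / n%:R); last by ring.
by rewrite lerD2l; exact: empirical_gap2_linearization.
Qed.

End estimator_expansion.

(** * The scaled statistic and its two limits *)

Lemma cvg_div_sqrtn {R : realType} (c : R) : c / Num.sqrt n%:R @[n --> \oo] --> (0 : R).
Proof.
apply/cvgrPdist_le => e e0; near=> n.
have n0 : 0 < n%:R :> R by near: n; exact: nbhs_infty_gtr.
have cn : (c / e) ^+ 2 <= n%:R by near: n; exact: nbhs_infty_ger.
have s0 : 0 < Num.sqrt n%:R :> R by rewrite sqrtr_gt0.
rewrite sub0r normrN normrM normfV (gtr0_norm s0) ler_pdivrMr// -ler_pdivrMl//.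
have : Num.sqrt ((c / e) ^+ 2) <= Num.sqrt n%:R by rewrite ler_wsqrtr.
by rewrite sqrtr_sqr normrM normfV (gtr0_norm e0) mulrC.
Unshelve. all: by end_near. Qed.

Section limit.
Context {R : realType} {d} {T : measurableType d} (P : probability T R) {p q : nat}.
Local Notation E := (p.-tuple R * q.-tuple R)%type.
Variables (X : nat -> T -> p.-tuple R) (Y : nat -> T -> q.-tuple R).
Hypothesis mX : forall i, measurable_fun setT (X i).
Hypothesis mY : forall i, measurable_fun setT (Y i).
Local Notation Z := (fun i x => (X i x, Y i x)).
Hypothesis iidZ : iid P Z.
Variables (wp : p.-tuple R -> R) (wq : q.-tuple R -> R).
Variables (nup : probability (p.-tuple R) R) (nuq : probability (q.-tuple R) R).
Hypothesis wpE : forall t, charw wp t = \int[nup]_s cos (dotv t s).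
Hypothesis wqE : forall t, charw wq t = \int[nuq]_s cos (dotv t s).
Hypothesis nupN : forall f : p.-tuple R -> R, bm f ->
  \int[nup]_x f (oppv x) = \int[nup]_x f x.
Local Notation g := (influence P Z nup nuq).
Local Notation Delta := (gap2 P Z nup nuq).
Local Notation W n x := (Num.sqrt n%:R * (Delta_n wp wq X Y n x - Delta)).
Local Notation L n x := ((Num.sqrt n%:R)^-1 * psum Z g n x).

Let mZ i : measurable_fun setT (fun x => (X i x, Y i x)).
Proof. exact: measurable_fun_pair. Qed.

Lemma bm_scaled_gap n : bm (fun x => W n x).
Proof. by apply: bmZ; apply: bmB; [exact: (bm_Delta_n mX mY wpE wqE)|exact: bm_cst]. Qed.

Lemma bm_scaled_influence n : bm (fun x => L n x).
Proof.
apply: bmZ; apply: bm_sum => i.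
exact: (bm_comp (mZ i) (bm_influence P mZ nup nuq)).
Qed.

Lemma scaled_linearization n : (3 <= n)%N ->
  \int[P]_x `|W n x - L n x| <= 1074 / Num.sqrt n%:R.
Proof.
move=> n3; have N0 : 0 < n%:R :> R by rewrite ltr0n (leq_trans _ n3).
set s := Num.sqrt n%:R; have s0 : 0 < s by rewrite sqrtr_gt0.
have sn : n%:R = s ^+ 2 by rewrite sqr_sqrtr// ltW.
have b : bm (fun x => Delta_n wp wq X Y n x - Delta - n%:R^-1 * psum Z g n x).
  apply: bmB; first by apply: bmB; [exact: (bm_Delta_n mX mY wpE wqE)|exact: bm_cst].
  apply: bmZ; apply: bm_sum => i; exact: (bm_comp (mZ i) (bm_influence P mZ nup nuq)).
have e x : `|W n x - L n x| = s * `|Delta_n wp wq X Y n x - Delta - n%:R^-1 * psum Z g n x|.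
  rewrite -[in RHS](gtr0_norm s0) -normrM; congr (`|_|).
  rewrite -/s sn; move: (psum _ _ _ _) (Delta_n _ _ _ _ _ _ - Delta) => a b'.
  by field; rewrite gt_eqF.
under eq_Rintegral do rewrite e.
rewrite bm_RintegralZl; last exact: bm_norm.
rewrite mulrC -ler_pdivlMr//; have := Delta_n_linearization mX mY iidZ wpE wqE nupN n3.
by rewrite [X in _ <= _ / X]sn expr2 invfM mulrA.
Qed.

Let v := \int[P]_x g (X 0%N x, Y 0%N x) ^+ 2.

Let g0 : \int[P]_x g (X 0%N x, Y 0%N x) = 0.
Proof. exact: (Rintegral_influence P mZ nup nuq). Qed.

(** |u| is at most 1 + u^2, and the second moment of the scaled sum is [v] whatever [n]. *)
Let L_abs n : (0 < n)%N -> \int[P]_x `|L n x| <= 1 + v.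
Proof.
move=> n0; have N0 : 0 < n%:R :> R by rewrite ltr0n.
set s := Num.sqrt n%:R; have s0 : 0 < s by rewrite sqrtr_gt0.
have sn : n%:R = s ^+ 2 by rewrite sqr_sqrtr// ltW.
have bp : bm (psum Z g n).
  by apply: bm_sum => i; exact: (bm_comp (mZ i) (bm_influence P mZ nup nuq)).
have vE : v = \int[P]_x (s^-1 * psum Z g n x) ^+ 2.
  under eq_Rintegral do rewrite exprMn.
  rewrite bm_RintegralZl; last exact: bmX.
  have := @psum_sqr _ _ _ _ _ P Z mZ iidZ g n (bm_influence P mZ nup nuq) g0.
  by move=> ->; rewrite mulrA sn -exprMn mulVf ?gt_eqF// expr1n mul1r.
rewrite vE -[X in X + _](Rintegral_probcst P) -bm_RintegralD; [|exact: bm_cst|exact: bmX (bm_scaled_influence n)].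
apply: bm_le_Rintegral; [exact: bm_norm (bm_scaled_influence n)|by apply: bmD; [exact: bm_cst|exact: bmX (bm_scaled_influence n)]|].
move=> x; rewrite -/s; move: (s^-1 * _) => u.
rewrite -(real_normK (num_real u)); have := normr_ge0 u; move: `|u| => a a0; nra.
Qed.

(** Supplies the uniform first-moment bound that the tightness argument of [weak_cvg_taylor_class]
    requires. *)
Lemma Rintegral_norm_scaled_gap n : (3 <= n)%N -> \int[P]_x `|W n x| <= 1074 + (1 + v).
Proof.
move=> n3; have n0 : (0 < n)%N by exact: leq_trans n3.
have s1 : 1 <= Num.sqrt n%:R :> R by rewrite -[leLHS]sqrtr1 ler_wsqrtr// ler1n.
have bWL := bmB (bm_scaled_gap n) (bm_scaled_influence n).
apply: (@le_trans _ _ (\int[P]_x (`|W n x - L n x| + `|L n x|))).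
  apply: bm_le_Rintegral; first exact: bm_norm (bm_scaled_gap n).
    by apply: bmD; [exact: bm_norm bWL|exact: bm_norm (bm_scaled_influence n)].
  by move=> x; rewrite (le_trans _ (ler_normD _ _))// subrK.
rewrite bm_RintegralD; [|exact: bm_norm bWL|exact: bm_norm (bm_scaled_influence n)].
apply: lerD; last exact: L_abs.
apply: (le_trans (scaled_linearization n3)).
have : 0 <= 1074 :> R by rewrite ler0n.
move: (1074 : R) => c c0; rewrite ler_pdivrMr ?(lt_le_trans ltr01)//.
by rewrite -[leLHS]mulr1 ler_wpM2l.
Qed.

Lemma gap2_0_cvg_prob0 : Delta = 0 ->
  cvg_prob0 P (fun n x => Num.sqrt n%:R * Delta_n wp wq X Y n x).
Proof.
move=> D0 eps eps0.
have L0 n x : L n x = 0.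
  by rewrite /psum big1 ?mulr0// => i _; exact: gap2_0_influence.
have WE n x : W n x = Num.sqrt n%:R * Delta_n wp wq X Y n x by rewrite D0 subr0.
have bD n : bm (fun x => Num.sqrt n%:R * Delta_n wp wq X Y n x).
  by have := bm_scaled_gap n; under eq_fun do rewrite WE.
(* Markov's inequality: the linear part vanishes, so the linearization error is the first absolute
   moment itself. *)
have mark n : (3 <= n)%N ->
    (P [set x | (eps < `|Num.sqrt n%:R * Delta_n wp wq X Y n x|)%R] <=
     ((1074 / eps) / Num.sqrt n%:R)%:E)%E.
  move=> n3; set A := [set x | _].
  have mA : measurable A.
    rewrite (_ : A = (fun x => `|Num.sqrt n%:R * Delta_n wp wq X Y n x|) @^-1` `]eps, +oo[%classic).
      by rewrite -[X in measurable X]setTI; apply: (proj1 (bm_norm (bD n))).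
    by apply/seteqP; split => x; rewrite /A/preimage/= in_itv/= andbT.
  have bA : bm (\1_A : T -> R).
    split; first exact: measurable_indic.
    by exists 1 => x; rewrite indicE; case: (_ \in _); rewrite ?normr1 ?normr0.
  have -> : P A = (\int[P]_x (\1_A x))%:E.
    by rewrite -EFin_Rintegral// integral_indic// setIT.
  rewrite lee_fin -mulrAC ler_pdivlMr//.
  rewrite -bm_RintegralZr//; apply: le_trans (scaled_linearization n3).
  apply: bm_le_Rintegral.
  - by apply: bmM => //; exact: bm_cst.
  - exact: bm_norm (bmB (bm_scaled_gap n) (bm_scaled_influence n)).
  move=> x; rewrite L0 subr0 WE indicE; case: (boolP (x \in A)) => [/set_mem xA|_].
    by rewrite mul1r ltW.
  by rewrite mul0r.
apply: (@squeeze_cvge _ _ _ _ (fun=> 0%E) _ (fun n => ((1074 / eps) / Num.sqrt n%:R)%:E)).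
- near=> n; rewrite measure_ge0/=; apply: mark; near: n; exact: nbhs_infty_ge.
- exact: cvg_cst.
- by apply: cvg_EFin; [near=> n|exact: cvg_div_sqrtn].
Unshelve. all: by end_near. Qed.

End limit.

Lemma gauss_norm_integrable {R : realType} (v : R) : 0 <= v ->
  (gauss_law v).-integrable setT (EFin \o (fun y : R => `|y|)).
Proof.
rewrite le_eqVlt => /predU1P[<-|v0]; last exact: (gauss_absmonomial_integrable 1 v0).
apply/integrableP; split.
  by apply/measurable_EFinP; exact: normr_measurable.
rewrite gauss_law0 integral_dirac//=; first by rewrite diracT mul1e ltry.
by apply/measurable_EFinP; do 2 apply: measurableT_comp => //.
Qed.

Section clt.
Context {R : realType} {d} {T : measurableType d} (P : probability T R) {p q : nat}.
Variables (X : nat -> T -> p.-tuple R) (Y : nat -> T -> q.-tuple R).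
Hypothesis mX : forall i, measurable_fun setT (X i).
Hypothesis mY : forall i, measurable_fun setT (Y i).
Local Notation Z := (fun i x => (X i x, Y i x)).
Hypothesis iidZ : iid P Z.
Variables (wp : p.-tuple R -> R) (wq : q.-tuple R -> R).
Variables (nup : probability (p.-tuple R) R) (nuq : probability (q.-tuple R) R).
Hypothesis wpE : forall t, charw wp t = \int[nup]_s cos (dotv t s).
Hypothesis wqE : forall t, charw wq t = \int[nuq]_s cos (dotv t s).
Hypothesis nupN : forall f : p.-tuple R -> R, bm f ->
  \int[nup]_x f (oppv x) = \int[nup]_x f x.
Local Notation g := (influence P Z nup nuq).
Local Notation Delta := (gap2 P Z nup nuq).
Local Notation W n x := (Num.sqrt n%:R * (Delta_n wp wq X Y n x - Delta)).
Local Notation L n x := ((Num.sqrt n%:R)^-1 * psum Z g n x).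

Let mZ i : measurable_fun setT (fun x => (X i x, Y i x)).
Proof. exact: measurable_fun_pair. Qed.

Let v := \int[P]_x g (X 0%N x, Y 0%N x) ^+ 2.

(** The Lipschitz bound passes from the statistic to its linear part at the cost of the mean
    linearization error, and the replacement argument treats the linear part. Both errors are of
    order one over the square root of [n]. *)
Lemma taylor_class_clt (C K : R) f : taylor_class C f ->
  (forall x y, `|f x - f y| <= K * `|x - y|) ->
  exists c, forall n, (3 <= n)%N ->
    `|\int[P]_x f (W n x) - \int[gauss_law v]_y f y| <= c / Num.sqrt n%:R.
Proof.
move=> tf fK; have [bf _] := tf.
have K0 : 0 <= K.
  by have := fK 1 0; rewrite subr0 normr1 mulr1; apply: le_trans; exact: normr_ge0.
pose rho := \int[P]_x (`|g (X 0%N x, Y 0%N x)| ^+ 3).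
exists (K * 1074 + C * (rho + 2 * expR (9 / 2) * Num.sqrt v ^+ 3)) => n n3.
have n0 : (0 < n)%N by exact: leq_trans n3.
have bW := bm_scaled_gap P mX mY wpE wqE n.
have bL := bm_scaled_influence P mX mY nup nuq n.
have := lindeberg mZ iidZ (bm_influence P mZ nup nuq) (Rintegral_influence P mZ nup nuq) tf n0.
rewrite -/v -/rho => lin.
have bfW := bm_comp (proj1 bW) bf; have bfL := bm_comp (proj1 bL) bf.
have step : `|\int[P]_x f (W n x) - \int[P]_x f (L n x)| <= K * (1074 / Num.sqrt n%:R).
  rewrite -bm_RintegralB//.
  apply: le_trans; first exact: (bm_norm_Rintegral_le _ (bmB bfW bfL)).
  have bN := bm_norm (bmB bW bL).
  apply: le_trans; first apply: (@bm_le_Rintegral _ _ _ P _ (fun x => K * `|W n x - L n x|)).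
  - exact/bm_norm/bmB.
  - exact: bmZ.
  - by move=> x; exact: fK.
  rewrite bm_RintegralZl//; apply: ler_wpM2l => //.
  exact: (scaled_linearization mX mY iidZ wpE wqE nupN n3).
rewrite mulrDl -[K * _ / _]mulrA.
rewrite -[X in `|X|](subrKA (\int[P]_x f (L n x))).
apply: le_trans; first exact: ler_normD.
by apply: lerD.
Qed.

Lemma scaled_gap_clt f M : continuous f -> (forall x, `|f x| <= M) ->
  \int[P]_x f (W n x) @[n --> \oo] --> \int[gauss_law v]_y f y.
Proof.
move=> cf fM.
have v0 : 0 <= v by apply: Rintegral_ge0 => x _; exact: sqr_ge0.
(* The moment bound holds from [n = 3] on, whereas the weak convergence criterion asks for it at
   every index. *)
rewrite -(cvg_shiftn 3).
apply: (@weak_cvg_taylor_class _ _ _ P (gauss_law v) (fun n x => W (n + 3) x) (1074 + (1 + v)) _ _ _ _ f M cf fM).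
- by move=> n; exact: (bm_scaled_gap P mX mY wpE wqE).
- move=> n; apply: (Rintegral_norm_scaled_gap mX mY iidZ wpE wqE nupN).
  by rewrite leq_addl.
- exact: gauss_norm_integrable.
move=> C K h th hK; have [c cP] := taylor_class_clt th hK.
have cvgc := @cvg_div_sqrtn R c.
rewrite -(cvg_shiftn 3) in cvgc.
apply/cvgrPdist_le => e e0.
have /cvgrPdist_le/(_ _ e0) := cvgc.
apply: filterS => n; rewrite sub0r normrN => ce.
rewrite distrC; apply: (le_trans (cP _ (leq_addl _ _))).
exact: le_trans (ler_norm _) ce.
Qed.

End clt.

Theorem theorem1 (R : realType) (d : measure_display) (T : measurableType d)
  (P : probability T R) (p q : nat)
  (X : nat -> {RV P >-> p.-tuple R}) (Y : nat -> {RV P >-> q.-tuple R})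
  (wp : p.-tuple R -> R) (wq : q.-tuple R -> R) :
  assumptionA wp -> assumptionA wq ->
  iid P (fun i om => (X i om, Y i om)) ->
  let Delta := indep_dist P wp wq (X 0%N) (Y 0%N) in
  ((0 < Delta)%E ->
     cvg_dist_normal P
       (fun n om => Num.sqrt n%:R * (Delta_n wp wq X Y n om - fine Delta))
       (sigma2 P wp wq X Y)) /\
  (Delta = 0%E ->
     cvg_prob0 P (fun n om => Num.sqrt n%:R * Delta_n wp wq X Y n om)).
Proof.
move=> Ap Aq iidZ Delta.
have [nup [nupE nupN wpE]] := assumptionA_probability Ap.
have [nuq [nuqE _ wqE]] := assumptionA_probability Aq.
have mX i : measurable_fun setT (X i) by exact: measurable_funPT.
have mY i : measurable_fun setT (Y i) by exact: measurable_funPT.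
have DeltaE : Delta = (gap2 P (fun i x => (X i x, Y i x)) nup nuq)%:E.
  case: Ap Aq => _ wp0 _ _ [_ wq0 _ _].
  exact: (indep_dist_gap2 P mX mY).
rewrite DeltaE; split=> [_ f cf [M fM]|[D0]]; last first.
  exact: (gap2_0_cvg_prob0 mX mY iidZ wpE wqE nupN).
have bf := continuous_bm cf fM.
have -> : (\int[normal_law (sigma2 P wp wq X Y)]_x (f x)%:E)%E =
    (\int[gauss_law (sigma2 P wp wq X Y)]_x f x)%:E.
  by rewrite normal_lawE EFin_Rintegral.
rewrite (sigma2E mX mY iidZ wpE wqE nupN).
have clt := scaled_gap_clt mX mY iidZ wpE wqE nupN cf fM.
have bfW n := bm_comp (proj1 (bm_scaled_gap P mX mY wpE wqE n)) bf.
rewrite (_ : (fun n => _) = EFin \o (fun n => \int[P]_x f (Num.sqrt n%:R *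
    (Delta_n wp wq X Y n x - gap2 P (fun i x => (X i x, Y i x)) nup nuq)))).
  by apply: cvg_EFin; [exact: nearW|exact: clt].
by apply/funext => n; rewrite unlock /= EFin_Rintegral.
Qed.
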